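(* Let $k\ge3$. Then the sequence $$\mathcal P_1 \xrightarrow{\ \subset\ } U_h \xrightarrow{\operatorname{grad}\operatorname{grad}} \widetilde{\boldsymbol\Sigma}_h \xrightarrow{\operatorname{curl}} \widetilde{\boldsymbol\Xi}_h \xrightarrow{\operatorname{div}} \widetilde{\boldsymbol Q}_h \longrightarrow 0$$ is an exact complex; that is, each operator maps its space into the next one, the kernel of $\operatorname{grad}\operatorname{grad}$ on $U_h$ is $\mathcal P_1$, $\ker(\operatorname{curl}|_{\widetilde{\boldsymbol\Sigma}_h})=\operatorname{grad}\operatorname{grad}U_h$, $\ker(\operatorname{div}|_{\widetilde{\boldsymbol\Xi}_h})=\operatorname{curl}\widetilde{\boldsymbol\Sigma}_h$, and $\operatorname{div}\widetilde{\boldsymbol\Xi}_h=\widetilde{\boldsymbol Q}_h$.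
   Context: Notation. Coordinates are $(x_1,x_2,x_3)=(x,y,z)$, $\partial_i=\partial/\partial x_i$. Whenever indices $i,j,l$ occur together they are pairwise distinct, i.e. $\{i,j,l\}=\{1,2,3\}$. $\mathcal Q(i{:}a,j{:}b,l{:}c)$ is the space of polynomials of degree at most $a$ in $x_i$, at most $b$ in $x_j$ and at most $c$ in $x_l$ (separately); similarly with fewer variables on faces and edges; it is the zero space if some bound is negative. $\mathcal Q_{a,b,c}=\mathcal Q(1{:}a,2{:}b,3{:}c)$. $\mathbb S$, $\mathbb T$ are the symmetric, respectively traceless, real $3\times3$ matrices. $\operatorname{curl}$ and $\operatorname{div}$ act row-wise on matrix fields. $\mathcal P_1$ is the space of polynomials of total degree $\le1$. Mesh. $\Omega\subset\mathbb R^3$ is a contractible domain with Lipschitz boundary, partitioned by a (face-to-face) mesh $\mathcal T_h$ of axis-parallel cuboids. $e_i$ denotes an edge parallel to the $x_i$-axis; $F_{ij}=F_{ji}$ denotes a face parallel to the $x_i$- and $x_j$-axes (normal to the $x_l$-direction). A finite element space given by a shape function space on each cell $T$ and degrees of freedom (DOFs) on $T$ consists of all piecewise polynomial fields whose restriction to each cell is in the shape function space and such that each DOF attached to a vertex, edge or face has the same value from all cells containing that vertex, edge or face. ''Moments of $f$ on $G$ against $P$'' means the functionals $\int_G f\,p$ for all $p\in P$. $U_h$ (scalar): shape functions $\mathcal Q_{k,k,k}$; DOFs: (1) $\partial_1^{\alpha_1}\partial_2^{\alpha_2}\partial_3^{\alpha_3}u$, $\alpha\in\{0,1\}^3$, at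 each vertex; (2) moments of $u,\partial_ju,\partial_lu,\partial_j\partial_lu$ on each edge $e_i$ against $\mathcal Q(i{:}k-4)$; (3) moments of $u,\partial_lu$ on each face $F_{ij}$ against $\mathcal Q(i{:}k-4,j{:}k-4)$; (4) moments of $u$ on $T$ against $\mathcal Q_{k-4,k-4,k-4}$. $\widetilde{\boldsymbol\Sigma}_h$ (values in $\mathbb S$): shape functions: symmetric $\boldsymbol\sigma$ with $\sigma_{ii}\in\mathcal Q(i{:}k-2,j{:}k,l{:}k)$ and, for $i\neq j$, $\sigma_{ij}=\sigma_{ji}\in\mathcal Q(i{:}k-1,j{:}k-1,l{:}k)$. DOFs of $\sigma_{ii}$: moments of $\sigma_{ii}$ on each $e_i$ against $\mathcal Q(i{:}k-2)$; for each $j\neq i$, moments of $\sigma_{ii}$ on each $F_{ij}$ against $\mathcal Q(i{:}k-2,j{:}k-2)$; moments of $\sigma_{ii}$ on $T$ against $\mathcal Q_{k-2,k-2,k-2}$. DOFs of $\sigma_{ij}$ ($i<j$): $\sigma_{ij},\partial_l\sigma_{ij}$ at each vertex; moments of $\sigma_{ij},\partial_l\sigma_{ij}$ on each $e_i$ against $\mathcal Q(i{:}k-3)$ and on each $e_j$ against $\mathcal Q(j{:}k-3)$; moments of $\sigma_{ij}$ on each $e_l$ against $\mathcal Q(l{:}k-4)$; moments of $\sigma_{ij}$ on each $F_{ij}$ against $\mathcal Q(i{:}k-3,j{:}k-3)$, on each $F_{il}$ against $\mathcal Q(i{:}k-3,l{:}k-4)$ and on each $F_{jl}$ against $\mathcal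 Q(j{:}k-3,l{:}k-4)$; moments of $\sigma_{ij}$ on $T$ against $\mathcal Q(i{:}k-3,j{:}k-3,l{:}k-2)$. $\widetilde{\boldsymbol\Xi}_h$ (values in $\mathbb T$): shape functions: traceless $\boldsymbol\tau$ with $\tau_{ii}\in\mathcal Q_{k-1,k-1,k-1}$ and, for $i\ne j$, $\tau_{ij}\in\mathcal Q(i{:}k-2,j{:}k,l{:}k-1)$. DOFs of the diagonal $(\tau_{11},\tau_{22},\tau_{33})$: the values of $\tau_{11},\tau_{22},\tau_{33}$ at each vertex; moments of $\tau_{11},\tau_{22},\tau_{33}$ on each edge against polynomials of degree $\le k-3$; moments of $\tau_{ii}$ on each face $F_{jl}$ (normal to the $x_i$-direction) against $\mathcal Q(j{:}k-3,l{:}k-3)$, for $i=1,2,3$; and $\int_T(\tau_{11}\xi_1+\tau_{22}\xi_2+\tau_{33}\xi_3)$ for all $(\xi_1,\xi_2,\xi_3)\in\mathcal B(T)$, where $\mathcal B(T)$ is the set of triples in $(\mathcal Q_{k-1,k-1,k-1})^3$ with $\xi_1+\xi_2+\xi_3=0$ and such that $\xi_i$ vanishes on the two faces of $T$ normal to the $x_i$-direction for each $i$. DOFs of $\tau_{ij}$ (all $i\ne j$): moments on each $F_{il}$ against $\mathcal Q(i{:}k-2,l{:}k-1)$; moments on $T$ against $\mathcal Q(i{:}k-2,j{:}k-2,l{:}k-1)$. $\widetilde{\boldsymbol Q}_h$: all $\boldsymbol q\in L^2(\Omega;\mathbb R^3)$ with $q_i|_T\in\mathcal Q(i{:}k-2,j{:}k-1,l{:}k-1)$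 on each cell $T$ (no interelement continuity). *)

(* Defs.v *)
(* Coordinates x_1, x_2, x_3 are indexed by 0, 1, 2 : 'I_3. *)
From HB Require Import structures.
From mathcomp Require Export all_boot all_order all_algebra.
From mathcomp Require Export all_classical all_reals all_analysis.
(* The notations of mpoly clash with those of mathcomp-analysis. *)
From mathcomp Require Export -(notations) mpoly.
Export Order.TTheory GRing.Theory Num.Theory numFieldNormedType.Exports.

Set Implicit Arguments.
Unset Strict Implicit.
Unset Printing Implicit Defensive.

Local Open Scope classical_set_scope.
Local Open Scope ring_scope.

Section Domain.
Variable R : realType.
Implicit Types (Omega : set 'rV[R]_3).

Definition contractible Omega : Prop :=
  exists (x0 : 'rV[R]_3) (H : R * 'rV[R]_3 -> 'rV[R]_3),
    [/\ Omega x0,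
        {within `[0, 1] `*` Omega, continuous H},
        (forall t x, 0 <= t <= 1 -> Omega x -> Omega (H (t, x))),
        (forall x, Omega x -> H (0, x) = x)
      & (forall x, Omega x -> H (1, x) = x0)].

(* Near each boundary point, Omega is the strict epigraph of a Lipschitz
   function in the coordinates y = x *m B of some orthonormal frame B;
   [col' ord_max y] is (y_1, y_2). *)
Definition lipschitz_boundary Omega : Prop :=
  forall x0, (closure Omega `\` interior Omega) x0 ->
  exists (r : R) (B : 'M[R]_3) (gamma : 'rV[R]_2 -> R),
    [/\ 0 < r, B *m B^T = 1%:M, lipschitz gamma
      & forall x, ball x0 r x ->
          (Omega x <-> gamma (col' ord_max (x *m B)) < (x *m B) 0 ord_max)].

Definition contractible_lipschitz_domain Omega : Prop :=
  [/\ open Omega, connected Omega, contractible Omega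
    & lipschitz_boundary Omega].

End Domain.

Section Mesh.
Variable R : realType.

(* Axis-parallel boxes [lo_1, hi_1] x [lo_2, hi_2] x [lo_3, hi_3]. Vertices,
   edges and faces are the boxes that are degenerate in some directions. *)
Record box := Box { lo : 'rV[R]_3; hi : 'rV[R]_3 }.

Definition box_set (G : box) : set 'rV[R]_3 :=
  [set x | forall i, lo G 0 i <= x 0 i <= hi G 0 i].

(* G is T itself or one of its faces, edges, vertices *)
Definition subentity (T G : box) : Prop :=
  forall i, [\/ lo G 0 i = lo T 0 i /\ hi G 0 i = hi T 0 i,
                lo G 0 i = lo T 0 i /\ hi G 0 i = lo T 0 i
              | lo G 0 i = hi T 0 i /\ hi G 0 i = hi T 0 i].

(* The directions in which G extends are exactly those in s: G is a vertex for
   s = [::], an edge e_i for s = [:: i], a face F_ij for s = [:: i; j]. *)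
Definition parallel (s : seq 'I_3) (G : box) : Prop :=
  forall i, (lo G 0 i < hi G 0 i) = (i \in s).

Definition cuboid_mesh (Omega : set 'rV[R]_3) (N : nat) (T : 'I_N -> box) :
    Prop :=
  [/\ (forall c i, lo (T c) 0 i < hi (T c) 0 i),
      closure Omega = \bigcup_c box_set (T c),
      (forall c c', c != c' ->
         interior (box_set (T c)) `&` interior (box_set (T c')) = set0)
    & (forall c c', c != c' ->
         box_set (T c) `&` box_set (T c') = set0 \/
         exists G, [/\ subentity (T c) G, subentity (T c') G
                     & box_set (T c) `&` box_set (T c') = box_set G])].

Definition int1 (a b : R) (f : R -> R) : R :=
  if a == b then f a else \int[lebesgue_measure]_(t in `[a, b]) f t.

Definition point (x y z : R) : 'rV[R]_3 := \row_i nth 0 [:: x; y; z] i.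

(* Integral over a box with respect to the Lebesgue measure of the dimension of
   the box: degenerate directions are evaluated, not integrated. *)
Definition box_int (G : box) (f : 'rV[R]_3 -> R) : R :=
  int1 (lo G 0 0) (hi G 0 0) (fun x =>
  int1 (lo G 0 1) (hi G 0 1) (fun y =>
  int1 (lo G 0 2) (hi G 0 2) (fun z => f (point x y z)))).

End Mesh.

Section Polynomials.
Variable R : realType.
Notation pol := (mpoly 3 R).

Definition peval (p : pol) (x : 'rV[R]_3) : R := meval (x 0) p.

(* [Q [:: (i, a); (j, b)]] is the space of polynomials in x_i and x_j, of degree
   at most a in x_i and at most b in x_j; it is zero if a or b is negative. *)
Definition Q (s : seq ('I_3 * int)) : set pol :=
  [set p | forall m : multinom 3, m \in msupp p ->
     (forall d, d \in s -> (m d.1)%:Z <= d.2) /\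
     (forall i, i \notin unzip1 s -> m i = 0%N)].

Definition P1 : set pol := [set p | (mmeasure mdeg p <= 2)%N].


Definition hess1 (p : pol) : 'M[pol]_3 := \matrix_(j, i) mderiv j (mderiv i p).

(* j + 1 and j + 2 are taken modulo 3 *)
Definition curl1 (s : 'M[pol]_3) : 'M[pol]_3 :=
  \matrix_(i, j) (mderiv (j + 1) (s i (j + 2)) - mderiv (j + 2) (s i (j + 1))).

Definition div1 (t : 'M[pol]_3) : 'rV[pol]_3 :=
  \row_i \sum_j mderiv j (t i j).

End Polynomials.

Section Fields.
Variables (R : realType) (N : nat) (T : 'I_N -> box R).
Notation pol := (mpoly 3 R).

(* A piecewise polynomial field is given by its polynomial on each cell. *)
Definition sfield := {ffun 'I_N -> pol}.
Definition mfield := {ffun 'I_N -> 'M[pol]_3}.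
Definition vfield := {ffun 'I_N -> 'rV[pol]_3}.

Definition global (p : pol) : sfield := [ffun=> p].
Definition hess (u : sfield) : mfield := [ffun c => hess1 (u c)].
Definition curl (s : mfield) : mfield := [ffun c => curl1 (s c)].
Definition divm (t : mfield) : vfield := [ffun c => div1 (t c)].

Definition entry (s : mfield) (i j : 'I_3) : sfield := [ffun c => s c i j].
Definition vcomp (q : vfield) (i : 'I_3) : sfield := [ffun c => q c 0 i].
Definition dd (i : 'I_3) (u : sfield) : sfield := [ffun c => mderiv i (u c)].

Definition shape (P : set pol) (u : sfield) : Prop := forall c, P (u c).

(* The value of u at each vertex is the same from all cells containing it. *)
Definition vertex_dof (u : sfield) : Prop :=
  forall c c' v, parallel [::] v ->
    subentity (T c) v -> subentity (T c') v ->
    peval (u c) (lo v) = peval (u c') (lo v).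

(* The moments of u against P on each edge or face G with directions s are the
   same from all cells containing G. *)
Definition moment_dof (s : seq 'I_3) (P : set pol) (u : sfield) : Prop :=
  forall c c' G, parallel s G -> subentity (T c) G -> subentity (T c') G ->
  forall p, P p ->
    box_int G (fun x => peval (u c) x * peval p x) =
    box_int G (fun x => peval (u c') x * peval p x).

(* In the spaces below the degrees of freedom interior to a cell do not appear:
   a cell is shared with no other cell, so they impose no condition. *)

Section Spaces.
Variable k : nat.
Notation K := (k%:Z).

Definition U_h (u : sfield) : Prop :=
  [/\ shape (Q [:: (0, K); (1, K); (2, K)]) u,
      (forall alpha : multinom 3, (forall i, (alpha i <= 1)%N) ->
         vertex_dof [ffun c => mderivm alpha (u c)]),
      (forall i j l, uniq [:: i; j; l] ->
         [/\ moment_dof [:: i] (Q [:: (i, K - 4)]) u,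
             moment_dof [:: i] (Q [:: (i, K - 4)]) (dd j u),
             moment_dof [:: i] (Q [:: (i, K - 4)]) (dd l u)
           & moment_dof [:: i] (Q [:: (i, K - 4)]) (dd j (dd l u))])
    & (forall i j l, uniq [:: i; j; l] ->
         moment_dof [:: i; j] (Q [:: (i, K - 4); (j, K - 4)]) u /\
         moment_dof [:: i; j] (Q [:: (i, K - 4); (j, K - 4)]) (dd l u))].

Definition Sigma_shape (s : mfield) : Prop :=
  forall i j l, uniq [:: i; j; l] ->
    shape (Q [:: (i, K - 2); (j, K); (l, K)]) (entry s i i) /\
    shape (Q [:: (i, K - 1); (j, K - 1); (l, K)]) (entry s i j).

Definition Sigma_diag_dof (i : 'I_3) (f : sfield) : Prop :=
  moment_dof [:: i] (Q [:: (i, K - 2)]) f /\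
  (forall j, j != i -> moment_dof [:: i; j] (Q [:: (i, K - 2); (j, K - 2)]) f).

Definition Sigma_off_dof (i j l : 'I_3) (f : sfield) : Prop :=
  [/\ vertex_dof f /\ vertex_dof (dd l f),
      moment_dof [:: i] (Q [:: (i, K - 3)]) f /\
      moment_dof [:: i] (Q [:: (i, K - 3)]) (dd l f),
      moment_dof [:: j] (Q [:: (j, K - 3)]) f /\
      moment_dof [:: j] (Q [:: (j, K - 3)]) (dd l f),
      moment_dof [:: l] (Q [:: (l, K - 4)]) f
    & [/\ moment_dof [:: i; j] (Q [:: (i, K - 3); (j, K - 3)]) f,
          moment_dof [:: i; l] (Q [:: (i, K - 3); (l, K - 4)]) f
        & moment_dof [:: j; l] (Q [:: (j, K - 3); (l, K - 4)]) f]].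

Definition Sigma_h (s : mfield) : Prop :=
  [/\ (forall c, (s c)^T = s c),
      Sigma_shape s,
      (forall i, Sigma_diag_dof i (entry s i i))
    & (forall i j l : 'I_3, uniq [:: i; j; l] -> (i < j)%N ->
         Sigma_off_dof i j l (entry s i j))].

Definition Xi_shape (t : mfield) : Prop :=
  forall i j l, uniq [:: i; j; l] ->
    shape (Q [:: (i, K - 1); (j, K - 1); (l, K - 1)]) (entry t i i) /\
    shape (Q [:: (i, K - 2); (j, K); (l, K - 1)]) (entry t i j).

Definition Xi_diag_dof (t : mfield) : Prop :=
  forall i,
    [/\ vertex_dof (entry t i i),
        (forall m, moment_dof [:: m] (Q [:: (m, K - 3)]) (entry t i i))
      & (forall j l, uniq [:: i; j; l] ->
           moment_dof [:: j; l] (Q [:: (j, K - 3); (l, K - 3)]) (entry t i i))].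

Definition Xi_off_dof (t : mfield) : Prop :=
  forall i j l, uniq [:: i; j; l] ->
    moment_dof [:: i; l] (Q [:: (i, K - 2); (l, K - 1)]) (entry t i j).

Definition Xi_h (t : mfield) : Prop :=
  [/\ (forall c, \tr (t c) = 0), Xi_shape t, Xi_diag_dof t & Xi_off_dof t].

Definition Q_h (q : vfield) : Prop :=
  forall i j l, uniq [:: i; j; l] ->
    shape (Q [:: (i, K - 2); (j, K - 1); (l, K - 1)]) (vcomp q i).

End Spaces.

(* The operators act on fields on Omega in the sense of distributions. The
   following predicates say that the distributional derivative has no part
   concentrated on the faces, i.e. is the field computed cell by cell. *)
Section Distributions.
Variable Omega : set 'rV[R]_3.
Implicit Types phi : 'rV[R]_3 -> R.

Definition partial (i : 'I_3) phi : 'rV[R]_3 -> R :=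
  fun x => 'D_(delta_mx 0 i) phi x.

Definition smooth phi : Prop :=
  forall s : seq 'I_3, let psi := foldr partial phi s in
    continuous psi /\ (forall i x, derivable psi x (delta_mx 0 i)).

Definition test_function phi : Prop :=
  [/\ smooth phi, compact (closure [set x | phi x != 0])
    & closure [set x | phi x != 0] `<=` Omega].

(* the integral of u phi over Omega *)
Definition pairing (u : sfield) phi : R :=
  \sum_c box_int (T c) (fun x => peval (u c) x * phi x).

Definition is_hess (u : sfield) (s : mfield) : Prop :=
  forall phi, test_function phi -> forall i j,
    pairing (entry s i j) phi = pairing u (partial i (partial j phi)).

Definition is_curl (s t : mfield) : Prop :=
  forall phi, test_function phi -> forall i j,
    pairing (entry t i j) phi =
    - (pairing (entry s i (j + 2)) (partial (j + 1) phi)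
       - pairing (entry s i (j + 1)) (partial (j + 2) phi)).

Definition is_div (t : mfield) (q : vfield) : Prop :=
  forall phi, test_function phi -> forall i,
    pairing (vcomp q i) phi = - \sum_j pairing (entry t i j) (partial j phi).

End Distributions.

End Fields.

(* Main.v *)
(* The degrees of freedom attached to faces, edges and vertices determine exactly
   certain traces, so a field belongs to one of the spaces if and only if it has
   the prescribed separate degrees in each cell and these traces agree on the
   subentities shared by cells. Within a cell, explicit primitives in the
   coordinate directions give potentials with the prescribed degrees.

   What keeps potentials chosen cell by cell from gluing is a Cech cocycle on the
   nerve of the mesh, with coefficients in the affine functions. Such cocycles are
   coboundaries: pushing the closure of Omega inwards along its Lipschitz boundary
   and contracting Omega gives a homotopy which, at a scale small enough for close
   cells to touch, becomes a combinatorial contraction of the mesh, and inside a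
   box a cocycle at small scale is the boundary of its sum along segments. For
   curl, the potentials of the differences s_b - s_a live on the intersections of
   cells; once corrected to a cocycle they are extended to the cells by Hermite
   interpolation.

   Surjectivity of div only needs three off-diagonal entries, which are primitives
   along columns of cells. That the operators act cell by cell in the sense of
   distributions is integration by parts: the contributions of a common face cancel
   and the test function vanishes on the boundary faces. *)

(* Affine functions are the kernel of the Hessian, and a vanishing 1-jet at one point kills an
   affine function; so a relation between such functions can be checked at a single common point of
   the cells involved. The three kernels need the nerve in degrees 0, 1 and 2 respectively.

   The obstacle is that the traces of Sigma and Xi depend on the direction and dimension of the
   subentity. Potentials of the Hessian must therefore be built on intersections of any dimension,
   from traces alone; there they are unique up to an affine function and up to polynomials whose
   mixed first derivatives all vanish on the intersection. This is why the trace predicates are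
   stated uniformly for vertices, edges, faces and cells.

   The degrees of the moments are what remains after division by ((t - a)(t - b))^m, where m counts
   the derivatives known at both ends: k - 4 is k with m = 2, and k - 3 is k - 1 with m = 1. Hermite
   extension is cubic in each new variable, and must fit into degree k.

   The pushing is forced because the given contraction lives on the open set Omega only, while the
   cells fill its closure, and uniform continuity needs a compact set. *)
From HB Require Import structures.
Require Import Defs.
From mathcomp Require finmap.
From mathcomp Require Import ring lra zify.

Set Implicit Arguments.
Unset Strict Implicit.
Unset Printing Implicit Defensive.

Local Open Scope classical_set_scope.
Local Open Scope ring_scope.

(** * Polynomials along coordinate lines *)

Section Calculus.
Variable R : realType.
Notation pol := (mpoly 3 R).
Notation pt := 'rV[R]_3.
Implicit Types (p q f g : pol) (x y : pt) (i j l d e : 'I_3) (s t a b c : R).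

Definition upd x i t : pt := \row_j (if j == i then t else x 0 j).

Lemma upd_same x i t : upd x i t 0 i = t.
Proof. by rewrite mxE eqxx. Qed.

Lemma upd_other x i j t : j != i -> upd x i t 0 j = x 0 j.
Proof. by move=> ji; rewrite mxE (negbTE ji). Qed.

Lemma upd_id x i : upd x i (x 0 i) = x.
Proof. by apply/rowP => j; rewrite mxE; case: eqP => // ->. Qed.

Lemma upd_idE x i t : x 0 i = t -> upd x i t = x.
Proof. by move=> <-; exact: upd_id. Qed.

Lemma updC x i j s t : i != j -> upd (upd x i s) j t = upd (upd x j t) i s.
Proof.
move=> ij; apply/rowP => k; rewrite !mxE.
by case: (eqVneq k j) => // kj; case: (eqVneq k i) => // ki; rewrite -ki -kj eqxx in ij.
Qed.

Lemma upd_upd x i s t : upd (upd x i s) i t = upd x i t.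
Proof. by apply/rowP => k; rewrite !mxE; case: eqP. Qed.

Lemma pevalD p q x : peval (p + q) x = peval p x + peval q x.
Proof. exact: mevalD. Qed.
Lemma pevalB p q x : peval (p - q) x = peval p x - peval q x.
Proof. exact: mevalB. Qed.
Lemma pevalN p x : peval (- p) x = - peval p x.
Proof. exact: mevalN. Qed.
Lemma pevalM p q x : peval (p * q) x = peval p x * peval q x.
Proof. exact: mevalM. Qed.
Lemma peval0 x : peval 0 x = 0.
Proof. exact: meval0. Qed.
Lemma pevalC c x : peval (mpolyC 3 c) x = c.
Proof. exact: mevalC. Qed.
Lemma pevalX i x : peval (mpolyX R (mnm1 i)) x = x 0 i.
Proof. exact: mevalXU. Qed.
Lemma peval_sum (I : Type) (r : seq I) (P : pred I) (F : I -> pol) x :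
  peval (\sum_(i <- r | P i) F i) x = \sum_(i <- r | P i) peval (F i) x.
Proof. exact: raddf_sum. Qed.
Definition pevalE := (pevalD, pevalB, pevalN, pevalM, peval0, pevalC, pevalX).

(** The restriction of [p] to the coordinate line through [x], made univariate so that root
    counting, factorisation and formal derivatives of [{poly R}] apply. *)
Definition slice i x p : {poly R} :=
  mmap (@polyC R) (fun j => if j == i then 'X else (x 0 j)%:P) p.

Lemma slice_sum i x p : slice i x p =
  \sum_(m <- msupp p) (mcoeff m p * \prod_(j | j != i) x 0 j ^+ m j) *: 'X^(m i).
Proof.
rewrite /slice /mmap; apply: eq_bigr => m _.
rewrite /mmap1 (bigD1 i) //= eqxx.
rewrite (eq_bigr (fun j => (x 0 j ^+ m j)%:P)); last first.
  by move=> j ji; rewrite (negbTE ji) polyC_exp.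
by rewrite -rmorph_prod /= mulrCA mulrC -polyCM mul_polyC.
Qed.

Lemma slice_horner i x p t : (slice i x p).[t] = peval p (upd x i t).
Proof.
rewrite slice_sum horner_sum /peval mevalE; apply: eq_bigr => m _.
rewrite hornerZ hornerXn [in RHS](bigD1 i) //= upd_same -mulrA; congr (_ * _).
by rewrite mulrC; congr (_ * _); apply: eq_bigr => j ji; rewrite upd_other.
Qed.

Lemma slice_is_additive i x : additive (slice i x).
Proof. exact: mmap_is_additive. Qed.
HB.instance Definition _ i x := GRing.isZmodMorphism.Build pol {poly R} (slice i x)
  (slice_is_additive i x).

Lemma sliceMon i x c (m : multinom 3) : slice i x (c *: mpolyX R m) =
  (c * \prod_(j | j != i) x 0 j ^+ m j) *: 'X^(m i).
Proof.
rewrite /slice mmapZ mmapX /mmap1 (bigD1 i) //= eqxx.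
rewrite (eq_bigr (fun j => (x 0 j ^+ m j)%:P)); last first.
  by move=> j ji; rewrite (negbTE ji) polyC_exp.
by rewrite -rmorph_prod /= mulrCA mulrC -polyCM mul_polyC.
Qed.

Lemma slice_deriv i x p : (slice i x p)^`() = slice i x (mderiv i p).
Proof.
have -> : slice i x p = \sum_(m <- msupp p) slice i x (mcoeff m p *: mpolyX R m).
  by rewrite -raddf_sum -mpolyE.
have -> : mderiv i p = \sum_(m <- msupp p) mderiv i (mcoeff m p *: mpolyX R m).
  by rewrite -raddf_sum -mpolyE.
rewrite [RHS](raddf_sum (slice i x)) (raddf_sum (@deriv R)) /=; apply: eq_bigr => m _.
rewrite mderivZ mderivX scalerA !sliceMon poly.derivZ derivXn.
rewrite -scaler_nat scalerA mnmBE mnm1E eqxx subn1; congr (_ *: _).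
rewrite -!mulrA; congr (_ * _); rewrite mulrC; congr (_ * _).
apply: eq_bigr => j ji; congr (_ ^+ _).
by rewrite mnmBE mnm1E eq_sym (negbTE ji) subn0.
Qed.

Lemma poly_itv0 (P : {poly R}) a b : a < b ->
  (forall t, a <= t <= b -> P.[t] = 0) -> P = 0.
Proof.
move=> ab P0; apply/eqP; apply: contraT => Pn0.
(* These are [size P] distinct points of [a, b), one more than the number of roots a nonzero
   polynomial of this size can have. *)
pose rs := [seq a + (b - a) * (n%:R / (size P)%:R) | n <- iota 0 (size P)].
have sP : 0 < (size P)%:R :> R by rewrite ltr0n lt0n size_poly_eq0.
have u : uniq rs.
  rewrite map_inj_in_uniq ?iota_uniq // => m n _ _ /addrI /mulfI.
  rewrite subr_eq0 gt_eqF // => /(_ isT) /mulIf.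
  by rewrite invr_eq0 gt_eqF // => /(_ isT) /eqP; rewrite eqr_nat => /eqP.
have := max_poly_roots Pn0 _ u; rewrite size_map size_iota ltnn; apply.
apply/allP => _ /mapP [n + ->]; rewrite mem_iota /= => nP.
apply/rootP/P0; have : 0 <= (n%:R / (size P)%:R : R) <= 1.
  by rewrite divr_ge0 ?ler0n //= ler_pdivrMr // mul1r ler_nat ltnW.
move: (n%:R / _) => r /andP [r0 r1].
by rewrite lerDl mulr_ge0 ?subr_ge0 ?(ltW ab) //= -lerBrDl ler_piMr // subr_ge0 ltW.
Qed.

(** Induction on the total degree of a monomial m. The constant coefficient is the value at 0. If
    m_i > 0, the coefficient at m is, up to a nonzero integer factor, a coefficient of the
    derivative in x_i at a monomial of smaller degree, and that derivative vanishes everywhere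
    too. *)
Lemma peval_all0 p : (forall x, peval p x = 0) -> p = 0.
Proof.
move=> p0; apply/mpolyP => m; rewrite mcoeff0.
suff H (n : nat) : forall q, (forall x, peval q x = 0) ->
    (\sum_j m j)%N = n -> mcoeff m q = 0 by exact: (H _ p).
elim: n m {p p0} => [|n IH] m q q0 mn.
  have -> : m = mnm0.
    apply/mnmP => j; rewrite mnm0E; apply/eqP.
    by move/eqP: mn; rewrite sum_nat_eq0 => /forallP /(_ j).
  have := q0 0; rewrite /peval mevalE.
  case: (boolP ((mnm0 : multinom 3) \in msupp q)) => [z|/memN_msupp_eq0 //].
  rewrite (bigD1_seq (mnm0 : multinom 3)) ?msupp_uniq //= [X in _ + X]big1_seq.
    by rewrite addr0 big1 ?mulr1 // => j _; rewrite mxE mnm0E.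
  move=> k /andP [kn0 _]; have [j kj] : exists j, k j != 0%N.
    apply/existsP; apply: contraNT kn0; rewrite negb_exists => /forallP k0.
    by apply/eqP/mnmP => j; apply/eqP; rewrite mnm0E; move: (k0 j); rewrite negbK.
  by rewrite (bigD1 j) //= mxE expr0n (negbTE kj) mul0r mulr0.
have [i mi] : exists i, m i != 0%N.
  apply/existsP; apply: contra_eqT mn; rewrite negb_exists => /forallP k0.
  by rewrite big1 // => j _; apply/eqP; move: (k0 j); rewrite negbK.
pose m' := mnm_sub m (mnm1 i).
have mE : m = mnm_add m' (mnm1 i).
  apply/mnmP => j; rewrite mnmDE mnmBE mnm1E subnK //.
  by case: eqP => // <-; rewrite lt0n.
have D0 : forall x, peval (mderiv i q) x = 0.
  move=> x; rewrite -[x](upd_id _ i) -slice_horner -slice_deriv.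
  rewrite (@poly_itv0 (slice i x q) 0 1) ?ltr01 ?deriv0 ?horner0 // => t _.
  by rewrite slice_horner q0.
have := IH m' (mderiv i q) D0; rewrite mcoeff_mderiv -mE => H.
have /H/eqP : (\sum_j m' j)%N = n.
  apply: succn_inj; rewrite -mn (bigD1 i) //= [RHS](bigD1 i) //= -addSn.
  rewrite mnmBE mnm1E eqxx subn1 prednK ?lt0n //; congr addn.
  by apply: eq_bigr => j ji; rewrite mnmBE mnm1E eq_sym (negbTE ji) subn0.
by rewrite mulrn_eq0 /= => /eqP.
Qed.

Lemma peval_inj p q : (forall x, peval p x = peval q x) -> p = q.
Proof.
move=> H; apply/eqP; rewrite -subr_eq0; apply/eqP/peval_all0 => x.
by rewrite pevalB H subrr.
Qed.

Lemma sliceP i x p y q :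
  (forall t, peval p (upd x i t) = peval q (upd y i t)) -> slice i x p = slice i y q.
Proof.
move=> H; apply/eqP; rewrite -subr_eq0; apply/eqP.
by apply: (@poly_itv0 _ 0 1) => // t _; rewrite hornerD hornerN !slice_horner H subrr.
Qed.

Lemma eq_mderiv_line i p q x y t :
  (forall t, peval p (upd x i t) = peval q (upd y i t)) ->
  peval (mderiv i p) (upd x i t) = peval (mderiv i q) (upd y i t).
Proof. by move=> /sliceP E; rewrite -!slice_horner -!slice_deriv E. Qed.

Lemma mderiv_seg0 i p x a b : a < b ->
  (forall t, a <= t <= b -> peval p (upd x i t) = 0) ->
  forall t, peval (mderiv i p) (upd x i t) = 0.
Proof.
move=> ab H t; rewrite -slice_horner -slice_deriv.
by rewrite (@poly_itv0 (slice i x p) a b ab) ?deriv0 ?horner0 // => u /H; rewrite slice_horner.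
Qed.

Lemma const_seg i p x a b : a < b ->
  (forall t, a <= t <= b -> peval (mderiv i p) (upd x i t) = 0) ->
  forall s t, peval p (upd x i s) = peval p (upd x i t).
Proof.
move=> ab H s t; rewrite -!slice_horner.
have : (slice i x p)^`() = 0.
  by apply: (poly_itv0 ab) => u /H; rewrite slice_deriv slice_horner.
move=> d0; have /size1_polyC -> : (size (slice i x p) <= 1)%N; last by rewrite !hornerC.
move: d0; move: (slice i x p) => P d0; case sP : (size P) => [|[|n]] //.
have := congr1 (fun Q : {poly R} => Q`_n) d0.
rewrite coef_deriv coef0 => /eqP; rewrite mulrn_eq0 /=.
have := lead_coef_eq0 P; rewrite lead_coefE sP /= => -> /eqP P0.
by rewrite P0 size_poly0 in sP.
Qed.

(** Substitution of a constant and the formal primitive in one variable both act monomial by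
    monomial; this common form yields the supports, hence the degrees, of both. *)
Definition mono_map (c : multinom 3 -> R) (h : multinom 3 -> multinom 3) p : pol :=
  \sum_(m <- msupp p) (mcoeff m p * c m) *: mpolyX R (h m).

Lemma msupp_mono_map (c : multinom 3 -> R) (h : multinom 3 -> multinom 3) p m :
  m \in msupp (mono_map c h p) -> exists2 m', m' \in msupp p & m = h m'.
Proof.
move=> /msupp_sum_le /flattenP [_ /mapP [m' m's ->]].
move=> /msuppZ_le; rewrite msuppX inE => /eqP ->; exists m' => //.
by move: m's; rewrite mem_filter.
Qed.

Definition esub i a p : pol :=
  mono_map (fun m => a ^+ m i) (fun m => Multinom [tuple (if j == i then 0 else m j)%N | j < 3]) p.

Lemma peval_esub i a p x : peval (esub i a p) x = peval p (upd x i a).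
Proof.
rewrite /esub /mono_map peval_sum /peval mevalE; apply: eq_bigr => m _.
rewrite mevalZ mevalX -mulrA; congr (_ * _).
rewrite [in LHS](bigD1 i) //= [in RHS](bigD1 i) //= mnmE eqxx expr0 mul1r upd_same.
by congr (_ * _); apply: eq_bigr => j ji; rewrite mnmE (negbTE ji) upd_other.
Qed.

Lemma esub_mderiv i j a p : i != j -> mderiv j (esub i a p) = esub i a (mderiv j p).
Proof.
move=> ij; apply: peval_inj => x; rewrite peval_esub -[x in LHS](upd_id _ j).
rewrite -[upd x i a in RHS](upd_id _ j) upd_other 1?eq_sym //.
by apply: eq_mderiv_line => t; rewrite peval_esub updC // eq_sym.
Qed.

Lemma mderiv_esub i a p : mderiv i (esub i a p) = 0.
Proof.
apply: peval_inj => x; rewrite peval0 -[x](upd_id _ i).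
rewrite (@eq_mderiv_line _ _ (mpolyC 3 (peval p (upd x i a))) _ 0).
  by rewrite mderivC peval0.
by move=> t; rewrite peval_esub upd_upd pevalC.
Qed.

Definition prim i p : pol :=
  mono_map (fun m => (m i).+1%:R^-1) (fun m => mnm_add m (mnm1 i)) p.

Lemma mderiv_prim i p : mderiv i (prim i p) = p.
Proof.
rewrite /prim /mono_map raddf_sum [RHS]mpolyE /=; apply: eq_bigr => m _.
rewrite mderivZ mderivX scalerA mnmDE mnm1E eqxx addn1 -mulrA mulVf ?pnatr_eq0 // mulr1.
by rewrite addmK.
Qed.

(** The primitive in x_i normalised to vanish on the plane x_i = a. The normalisation makes it
    unique, which is why it is additive and commutes with the other derivatives. *)
Definition pint i a p : pol := prim i p - esub i a (prim i p).

Lemma mderiv_pint i a p : mderiv i (pint i a p) = p.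
Proof. by rewrite mderivB mderiv_prim mderiv_esub subr0. Qed.

Lemma peval_pint i a p x : x 0 i = a -> peval (pint i a p) x = 0.
Proof. by move=> xa; rewrite pevalB peval_esub upd_idE // subrr. Qed.

(** Uniqueness for the initial value problem in x_i. Identities between primitives are proved by
    comparing one derivative and the values on one plane. *)
Lemma eq_mderiv_sub i a p q : mderiv i p = mderiv i q ->
  (forall x, x 0 i = a -> peval p x = peval q x) -> p = q.
Proof.
move=> D E; apply: peval_inj => x; apply/eqP; rewrite -subr_eq0 -pevalB.
rewrite -[x](upd_id _ i) (@const_seg i (p - q) x 0 1 ltr01 _ _ a).
  by rewrite pevalB E ?upd_same ?subrr.
by move=> t _; rewrite mderivB D subrr peval0.
Qed.

Lemma mderiv_vanish i a p j : i != j -> (forall x, x 0 i = a -> peval p x = 0) ->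
  forall x, x 0 i = a -> peval (mderiv j p) x = 0.
Proof.
move=> ij H x xa; rewrite -[x](upd_id _ j); apply: (@mderiv_seg0 _ _ _ 0 1) => // t _.
by rewrite H // upd_other.
Qed.

Lemma pint_mderiv i j a p : i != j -> mderiv j (pint i a p) = pint i a (mderiv j p).
Proof.
move=> ij; apply: (@eq_mderiv_sub i a).
  by rewrite mderiv_comm !mderiv_pint.
move=> x xa; rewrite [RHS]peval_pint //; apply: (@mderiv_vanish i a) => // y ya.
exact: peval_pint.
Qed.

Lemma pint_deriv i a p : pint i a (mderiv i p) = p - esub i a p.
Proof.
apply: (@eq_mderiv_sub i a); first by rewrite mderivB mderiv_esub mderiv_pint subr0.
by move=> x xa; rewrite peval_pint // pevalB peval_esub upd_idE // subrr.
Qed.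

End Calculus.

(** * Separate degrees and the potential of the curl *)

Section Degrees.
Variable R : realType.
Notation pol := (mpoly 3 R).
Implicit Types (p q f g : pol) (i j l d e : 'I_3).

(** With an integer bound the differences of degrees are not truncated, and a negative bound forces
    the zero polynomial, in agreement with [Q]. *)
Definition degle i (a : int) p : Prop :=
  forall m : multinom 3, m \in msupp p -> (m i)%:Z <= a.

Lemma degle_le i a b p : a <= b -> degle i a p -> degle i b p.
Proof. by move=> ab H m /H /le_trans; apply. Qed.

Lemma degle0 i a : degle i a 0.
Proof. by move=> m; rewrite msupp0. Qed.

Lemma degleD i a p q : degle i a p -> degle i a q -> degle i a (p + q).
Proof. by move=> Hp Hq m /msuppD_le; rewrite mem_cat => /orP [/Hp|/Hq]. Qed.

Lemma degleN i a p : degle i a p -> degle i a (- p).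
Proof. by move=> Hp m; rewrite (perm_mem (msuppN p)) => /Hp. Qed.

Lemma degleB i a p q : degle i a p -> degle i a q -> degle i a (p - q).
Proof. by move=> Hp Hq; apply: degleD => //; apply: degleN. Qed.

Lemma degleM i a b p q : degle i a p -> degle i b q -> degle i (a + b) (p * q).
Proof.
move=> Hp Hq m /msuppM_le /allpairsP [[m1 m2] [/= /Hp h1 /Hq h2 ->]].
by rewrite mnmDE PoszD lerD.
Qed.

Lemma degle_sum i a (I : Type) (r : seq I) (P : pred I) (F : I -> pol) :
  (forall k, P k -> degle i a (F k)) -> degle i a (\sum_(k <- r | P k) F k).
Proof. by move=> H; apply: big_ind => //; [exact: degle0|exact: degleD]. Qed.

Lemma degleC i c : degle i 0 (mpolyC 3 c : pol).
Proof. by move=> m; rewrite msuppC; case: eqP => //= _; rewrite inE => /eqP ->; rewrite mnm0E. Qed.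

Lemma degleX i j : degle i (i == j)%:Z (mpolyX R (mnm1 j)).
Proof. by move=> m; rewrite msuppX inE => /eqP ->; rewrite mnm1E eq_sym. Qed.

Lemma degle_mono_map i a b (c : multinom 3 -> R) (h : multinom 3 -> multinom 3) p : degle i a p ->
  (forall m : multinom 3, (m i)%:Z <= a -> (h m i)%:Z <= b) -> degle i b (mono_map c h p).
Proof. by move=> Hp H _ /msupp_mono_map [m /Hp ma ->]; apply: H. Qed.

Lemma degle_esub i j a t p : 0 <= a \/ j != i -> degle j a p -> degle j a (esub i t p).
Proof.
move=> H /degle_mono_map; apply => m ma; rewrite mnmE.
by case: eqP => // ji; case: H => //; rewrite ji eqxx.
Qed.

Lemma degle_prim i j a p : degle j a p -> degle j (a + (j == i)%:Z) (prim i p).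
Proof.
move=> /degle_mono_map; apply => m ma.
by rewrite mnmDE mnm1E PoszD lerD // eq_sym.
Qed.

Lemma degle_pint i j a t p : 0 <= a \/ j != i ->
  degle j a p -> degle j (a + (j == i)%:Z) (pint i t p).
Proof.
move=> H /(degle_prim (i := i)) D; apply: degleB => //; apply: degle_esub => //.
by case: H => [a0|]; [left; rewrite addr_ge0|right].
Qed.

Lemma degle_pint_same i a t p : 0 <= a -> degle i (a - 1) p -> degle i a (pint i t p).
Proof.
move=> a0 /(degle_prim (i := i)); rewrite eqxx /= subrK => D.
by apply: degleB => //; apply: degle_esub => //; left.
Qed.

Lemma degle_pint_other i j a t p : j != i -> degle j a p -> degle j a (pint i t p).
Proof.
by move=> ji /(@degle_pint i _ _ t _ (or_intror ji)); rewrite (negbTE ji) addr0.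
Qed.

Lemma degle_pintE i j a t p : 0 <= a -> degle j (a - (j == i)%:Z) p -> degle j a (pint i t p).
Proof.
move=> a0; case: eqVneq => [->|ji]; first exact: degle_pint_same.
by rewrite subr0; apply: degle_pint_other.
Qed.

Lemma msupp_mderiv i p m : m \in msupp (mderiv i p) -> mnm_add m (mnm1 i) \in msupp p.
Proof.
rewrite !mcoeff_msupp mcoeff_mderiv; apply: contraNneq => ->.
by rewrite mul0rn.
Qed.

Lemma degle_mderiv i j a p : degle j a p -> degle j a (mderiv i p).
Proof.
move=> H m /msupp_mderiv /H; rewrite mnmDE; apply: le_trans.
by rewrite lez_nat leq_addr.
Qed.

Lemma degle_mderiv_same i a p : degle i a p -> degle i (a - 1) (mderiv i p).
Proof.
move=> H m /msupp_mderiv /H; rewrite mnmDE mnm1E eqxx addn1 => h.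
by rewrite lerBrDr -PoszD addn1.
Qed.

Lemma degle_mderivE i j a p : degle j a p -> degle j (a - (j == i)%:Z) (mderiv i p).
Proof.
case: eqVneq => [->|ji]; first exact: degle_mderiv_same.
by rewrite subr0; apply: degle_mderiv.
Qed.

Lemma size_slice i (a : nat) x p : degle i a%:Z p -> (size (slice i x p) <= a.+1)%N.
Proof.
move=> H; rewrite slice_sum; elim/big_ind: _; first by rewrite size_poly0.
  by move=> P1 P2 h1 h2; apply: leq_trans (size_polyD _ _) _; rewrite geq_max h1.
move=> m _; case: (boolP (m \in msupp p)) => [/H ma|/memN_msupp_eq0 ->].
  by apply: leq_trans (size_scale_leq _ _) _; rewrite size_polyXn ltnS.
by rewrite mul0r scale0r size_poly0.
Qed.

Lemma uniq3 i j l : uniq [:: i; j; l] -> forall d, [\/ d = i, d = j | d = l].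
Proof.
rewrite /= !inE => /andP [/norP [ij il] /andP [jl _]] d.
suff /or3P [/eqP|/eqP|/eqP] : [|| d == i, d == j | d == l].
- by constructor 1.
- by constructor 2.
- by constructor 3.
by move: d i j l ij il jl; do 4![case=> [[|[|[|]]] ? //=]].
Qed.

Lemma uniq3P i j l : uniq [:: i; j; l] -> [/\ i != j, i != l, j != l & [/\ j != i, l != i & l != j]].
Proof.
rewrite /= !inE => /andP [/norP [ij il] /andP [jl _]].
by split => //; rewrite ![_ == i]eq_sym [l == j]eq_sym.
Qed.

Lemma Q3E i j l a b c p : uniq [:: i; j; l] ->
  Q [:: (i, a); (j, b); (l, c)] p <-> [/\ degle i a p, degle j b p & degle l c p].
Proof.
move=> u; split => [H|[Hi Hj Hl] m mp].
  by split => m /H [+ _];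
  [move/(_ (i, a))|move/(_ (j, b))|move/(_ (l, c))]; rewrite !inE eqxx ?orbT; apply.
split => [d|d].
  by rewrite !inE => /or3P [] /eqP -> /=; [exact: Hi|exact: Hj|exact: Hl].
by rewrite !inE; case: (uniq3 u d) => -> ; rewrite eqxx ?orbT.
Qed.

Lemma ord3P (P : 'I_3 -> Prop) : P 0 -> P 1 -> P 2%R -> forall i, P i.
Proof.
move=> P0 P1 P2 [[|[|[|//]]] H].
- by rewrite (_ : Ordinal H = 0) //; apply/val_inj.
- by rewrite (_ : Ordinal H = 1) //; apply/val_inj.
- by rewrite (_ : Ordinal H = 2) //; apply/val_inj.
Qed.

Lemma uniq3_next i : uniq [:: i; i + 1; i + 2].
Proof. by elim/ord3P: i. Qed.

Lemma uniq3_third i j : i != j -> exists l, uniq [:: i; j; l].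
Proof. by move: i j; elim/ord3P; elim/ord3P => // _; by [exists 0|exists 1|exists 2]. Qed.

Lemma sum3 (V : nmodType) (F : 'I_3 -> V) : \sum_i F i = F 0 + F 1 + F 2.
Proof.
rewrite !big_ord_recl big_ord0 addr0 addrA.
by congr (F _ + F _ + F _); apply/val_inj.
Qed.

End Degrees.

Ltac degree_lia k0 d := clear - k0; elim/ord3P: d => /=; lia.

Section Potential.
Variable R : realType.
Notation pol := (mpoly 3 R).
Implicit Types (p q f g : pol) (i j l d e : 'I_3).

(** One formula covers diagonal and off-diagonal shapes: s_ij has the degrees of the derivative of u
    in x_i and x_j, t_ij loses in addition one degree in each of the two directions other than j and
    regains none of the one lost in i, and q_i has the degrees left after differentiating t_ij in
    x_j. *)
Definition U_deg (k : nat) (u : pol) : Prop := forall d, degle d k%:Z u.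
Definition Sigma_deg (k : nat) (s : 'M[pol]_3) : Prop :=
  forall i j d, degle d (k%:Z - (d == i)%:Z - (d == j)%:Z) (s i j).
Definition Xi_deg (k : nat) (t : 'M[pol]_3) : Prop :=
  forall i j d, degle d (k%:Z - 1 + (d == j)%:Z - (d == i)%:Z) (t i j).
Definition Q_deg (k : nat) (q : 'rV[pol]_3) : Prop :=
  forall i d, degle d (k%:Z - 1 - (d == i)%:Z) (q 0 i).

Lemma esubD i a p q : esub i a (p + q) = esub i a p + esub i a q.
Proof. by apply: peval_inj => x; rewrite pevalD !peval_esub pevalD. Qed.
Lemma esubN i a p : esub i a (- p) = - esub i a p.
Proof. by apply: peval_inj => x; rewrite pevalN !peval_esub pevalN. Qed.
Lemma pintD i a p q : pint i a (p + q) = pint i a p + pint i a q.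
Proof.
apply: (@eq_mderiv_sub _ i a); first by rewrite mderivD !mderiv_pint.
by move=> x xa; rewrite pevalD !peval_pint // addr0.
Qed.
Lemma pintN i a p : pint i a (- p) = - pint i a p.
Proof.
apply: (@eq_mderiv_sub _ i a); first by rewrite mderivN !mderiv_pint.
by move=> x xa; rewrite pevalN !peval_pint // oppr0.
Qed.

Lemma curl1E (s : 'M[pol]_3) :
  [/\ [/\ curl1 s 0 0 = mderiv 1 (s 0 2) - mderiv 2 (s 0 1),
      curl1 s 0 1 = mderiv 2 (s 0 0) - mderiv 0 (s 0 2) &
      curl1 s 0 2 = mderiv 0 (s 0 1) - mderiv 1 (s 0 0)],
      [/\ curl1 s 1 0 = mderiv 1 (s 1 2) - mderiv 2 (s 1 1),
      curl1 s 1 1 = mderiv 2 (s 1 0) - mderiv 0 (s 1 2) &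
      curl1 s 1 2 = mderiv 0 (s 1 1) - mderiv 1 (s 1 0)] &
      [/\ curl1 s 2 0 = mderiv 1 (s 2 2) - mderiv 2 (s 2 1),
      curl1 s 2 1 = mderiv 2 (s 2 0) - mderiv 0 (s 2 2) &
      curl1 s 2 2 = mderiv 0 (s 2 1) - mderiv 1 (s 2 0)]].
Proof.
have e1 : (1 + 1 : 'I_3) = 2 by apply/val_inj.
have e2 : (1 + 2 : 'I_3) = 0 by apply/val_inj.
have e3 : (2 + 1 : 'I_3) = 0 by apply/val_inj.
have e4 : (2 + 2 : 'I_3) = 1 by apply/val_inj.
by split; split; rewrite mxE ?add0r ?e1 ?e2 ?e3 ?e4.
Qed.

Lemma div1E (t : 'M[pol]_3) i :
  div1 t 0 i = mderiv 0 (t i 0) + mderiv 1 (t i 1) + mderiv 2 (t i 2).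
Proof. by rewrite mxE sum3. Qed.

Lemma trace3 (t : 'M[pol]_3) : \tr t = t 0 0 + t 1 1 + t 2 2.
Proof. by rewrite /mxtrace sum3. Qed.

Lemma esub0 i a : esub i a 0 = 0 :> pol.
Proof. by apply: peval_inj => x; rewrite peval_esub !peval0. Qed.
Lemma pint0 i a : pint i a 0 = 0 :> pol.
Proof. by rewrite -[X in pint _ _ X](subrr 0) pintD pintN subrr. Qed.

Definition sym3 (a00 a11 a22 a01 a02 a12 : pol) : 'M[pol]_3 :=
  \matrix_(i, j) nth 0 [:: a00; a01; a02; a01; a11; a12; a02; a12; a22] (3 * i + j)%N.

Lemma sym3T a00 a11 a22 a01 a02 a12 :
  (sym3 a00 a11 a22 a01 a02 a12)^T = sym3 a00 a11 a22 a01 a02 a12.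
Proof.
by apply/matrixP => i j; rewrite !mxE; move: i j; do 2![case=> [[|[|[]]] ? //=]].
Qed.

(* In the gauge s_22 = 0 the other entries are successive primitives in x_2; their
   values on x_2 = 0 are primitives in x_0 or x_1. *)
Lemma curl_potential (k : nat) (t : 'M[pol]_3) : (3 <= k)%N ->
  \tr t = 0 -> div1 t = 0 -> Xi_deg k t ->
  exists s : 'M[pol]_3, [/\ s^T = s, curl1 s = t & Sigma_deg k s].
Proof.
move=> k3 tr0 div0 sh.
have dv i : mderiv 0 (t i 0) + mderiv 1 (t i 1) + mderiv 2 (t i 2) = 0.
  by rewrite -div1E div0 mxE.
rewrite trace3 in tr0.
have [s12 s12E] : {p : pol | p = - pint 2 0 (t 2 0) + pint 0 0 (esub 2 0 (t 2 2))} by exact: exist.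
have [s02 s02E] : {p : pol | p = pint 2 0 (t 2 1)} by exact: exist.
have [s00 s00E] : {p : pol | p = pint 2 0 (t 0 1 + mderiv 0 s02) - pint 1 0 (esub 2 0 (t 0 2))} by exact: exist.
have [s11 s11E] : {p : pol | p = pint 2 0 (mderiv 1 s12 - t 1 0) + pint 0 0 (esub 2 0 (t 1 2))} by exact: exist.
have [s01 s01E] : {p : pol | p = pint 2 0 (t 1 1 + mderiv 0 s12)} by exact: exist.
have n01 : (0 : 'I_3) != 1 by [].
have n02 : (0 : 'I_3) != 2 by [].
have n12 : (1 : 'I_3) != 2 by [].
have n10 : (1 : 'I_3) != 0 by [].
have n20 : (2 : 'I_3) != 0 by [].
have n21 : (2 : 'I_3) != 1 by [].
have dp0 p : mderiv 0 (pint 0 0 p) = p by apply: mderiv_pint.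
have dp1 p : mderiv 1 (pint 1 0 p) = p by apply: mderiv_pint.
have dp2 p : mderiv 2 (pint 2 0 p) = p by apply: mderiv_pint.
have pz i p : i != 2 -> mderiv 2 (pint i 0 (esub 2 0 p)) = 0.
  by move=> i2; rewrite pint_mderiv // mderiv_esub pint0.
(* The derivative of the left side in x_2 is that of t_22, by row 2 of the divergence; the second
   term of [s12] supplies the value on x_2 = 0. *)
have e22 : mderiv 0 s12 - mderiv 1 s02 = t 2 2.
  have h : mderiv 0 (t 2 0) + mderiv 1 (t 2 1) = - mderiv 2 (t 2 2).
    by apply/eqP; rewrite -addr_eq0 dv.
  rewrite s12E s02E mderivD mderivN dp0 !pint_mderiv //.
  by rewrite addrAC -opprD -pintD h pintN opprK pint_deriv subrK.
(* The entries were chosen to solve the equations for t_11 and t_22; this third diagonal equation is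
   then forced by the vanishing trace. *)
have e00 : mderiv 1 s02 - mderiv 2 s01 = t 0 0.
  rewrite s01E dp2; apply/eqP; rewrite -subr_eq0; apply/eqP.
  have -> : t 0 0 = - (t 1 1 + t 2 2) by apply/eqP; rewrite -addr_eq0 addrA tr0.
  by rewrite -e22; ring.
(* Same pattern: both sides have the same derivative in x_2, now by row 0 of the divergence together
   with the derivative of the trace in x_0, and the second term of [s00] supplies the value on x_2 =
   0. *)
have e02 : mderiv 0 s01 - mderiv 1 s00 = t 0 2.
  have h : mderiv 0 (t 1 1 + mderiv 0 s12) - mderiv 1 (t 0 1 + mderiv 0 s02) = mderiv 2 (t 0 2).
    rewrite !mderivD opprD addrACA (mderiv_comm 0 1) -mderivB e22.
    have := congr1 (mderiv 0) tr0; rewrite !mderivD mderiv0 => h.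
    have D := dv 0.
    apply/eqP; rewrite -subr_eq0 -(subrr 0) -{1}h -{1}D; apply/eqP; ring.
  rewrite s01E s00E mderivB dp1 !pint_mderiv //.
  by rewrite opprB addrCA addrC -pintN -pintD h pint_deriv subrK.
have e12 : mderiv 0 s11 - mderiv 1 s01 = t 1 2.
  have h : mderiv 0 (mderiv 1 s12 - t 1 0) - mderiv 1 (t 1 1 + mderiv 0 s12) = mderiv 2 (t 1 2).
    rewrite mderivB mderivD (mderiv_comm 1 0).
    have D := dv 1.
    apply/eqP; rewrite -subr_eq0 -oppr0 -{1}D; apply/eqP; ring.
  rewrite s01E s11E mderivD dp0 !pint_mderiv //.
  by rewrite addrAC -pintN -pintD h pint_deriv subrK.
exists (sym3 s00 s11 0 s01 s02 s12); split.
- exact: sym3T.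
- have [[h00 h01 h02] [h10 h11 h12] [h20 h21 h22]] := curl1E (sym3 s00 s11 0 s01 s02 s12).
  apply/matrixP; elim/ord3P; elim/ord3P;
    rewrite ?h00 ?h01 ?h02 ?h10 ?h11 ?h12 ?h20 ?h21 ?h22 !mxE /=
      ?e00 ?e02 ?e12 ?e22 ?mderiv0 ?subr0 ?sub0r //.
  + by rewrite s00E mderivB dp2 pz // subr0 addrK.
  + by rewrite s11E mderivD dp2 pz // addr0 subKr.
  + by rewrite s01E dp2 addrK.
  + by rewrite s12E mderivD mderivN dp2 pz // addr0 opprK.
  + by rewrite s02E dp2.
- have k0 : (2 : int) <= k%:Z by lia.
  have d12 d : degle d (k%:Z - (d == 1)%:Z - (d == 2)%:Z) s12.
    rewrite s12E; apply: degleD; [apply: degleN|]; apply: degle_pintE;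
      try (degree_lia k0 d).
      by apply: degle_le (sh 2 0 d); degree_lia k0 d.
    elim/ord3P: d; apply: degle_esub; rewrite /=; try (by right); try (by left; clear - k0; lia);
      (apply: degle_le (sh 2 2 _); rewrite /=; clear - k0; lia).
  have d02 d : degle d (k%:Z - (d == 0)%:Z - (d == 2)%:Z) s02.
    rewrite s02E; apply: degle_pintE; try (degree_lia k0 d).
    by apply: degle_le (sh 2 1 d); degree_lia k0 d.
  have d00 d : degle d (k%:Z - (d == 0)%:Z - (d == 0)%:Z) s00.
    rewrite s00E; apply: degleB; apply: degle_pintE;
      try (degree_lia k0 d).
      apply: degleD; first by apply: degle_le (sh 0 1 d); degree_lia k0 d.
      by apply: degle_le (degle_mderivE (d02 d)); degree_lia k0 d.
    elim/ord3P: d; apply: degle_esub; rewrite /=; try (by right); try (by left; clear - k0; lia);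
      (apply: degle_le (sh 0 2 _); rewrite /=; clear - k0; lia).
  have d11 d : degle d (k%:Z - (d == 1)%:Z - (d == 1)%:Z) s11.
    rewrite s11E; apply: degleD; apply: degle_pintE;
      try (degree_lia k0 d).
      apply: degleB; last by apply: degle_le (sh 1 0 d); degree_lia k0 d.
      by apply: degle_le (degle_mderivE (d12 d)); degree_lia k0 d.
    elim/ord3P: d; apply: degle_esub; rewrite /=; try (by right); try (by left; clear - k0; lia);
      (apply: degle_le (sh 1 2 _); rewrite /=; clear - k0; lia).
  have d01 d : degle d (k%:Z - (d == 0)%:Z - (d == 1)%:Z) s01.
    rewrite s01E; apply: degle_pintE; try (degree_lia k0 d).
    apply: degleD; first by apply: degle_le (sh 1 1 d); degree_lia k0 d.
    by apply: degle_le (degle_mderivE (d12 d)); degree_lia k0 d.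
  move=> i j d; rewrite mxE; move: i j; elim/ord3P; elim/ord3P => //=;
    try exact: degle0; rewrite addrAC; exact: d01 || exact: d02 || exact: d12.
Qed.
End Potential.

(** * Traces and the potential of the Hessian *)

Section Traces.
Variable R : realType.
Notation pol := (mpoly 3 R).
Notation pt := 'rV[R]_3.
Implicit Types (p q f g u w : pol) (i j l d e : 'I_3) (G : box R) (x y v : pt) (s t : 'M[pol]_3).

Definition par G i : bool := lo G 0 i < hi G 0 i.

(** A vertex or an edge. Only on these do the degrees of freedom control all diagonal entries of a
    field in Xi, and the derivative in x_l of the entry ij of a field in Sigma. *)
Definition thin G : Prop := exists d, forall e, e != d -> ~~ par G e.

Definition zero_on G f : Prop := forall x, box_set G x -> peval f x = 0.

(** Derivatives of order at most one in each variable: the nodal data of tensor-product Hermite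
    elements. *)
Definition jet (b : 'I_3 -> bool) p : pol :=
  iter (b 0) (mderiv 0) (iter (b 1) (mderiv 1) (iter (b 2) (mderiv 2) p)).

(* The traces on G that are determined by the degrees of freedom on G and its
   subentities. *)
Definition U_trace0 G u : Prop := forall b, zero_on G (jet b u).

Definition Sigma_trace0 G s : Prop :=
  [/\ forall i, par G i -> zero_on G (s i i),
      forall i j, i != j -> zero_on G (s i j)
    & thin G -> forall i j l, uniq [:: i; j; l] -> zero_on G (mderiv l (s i j))].

Definition Xi_trace0 G t : Prop :=
  [/\ thin G -> forall i, zero_on G (t i i),
      forall i j l, uniq [:: i; j; l] -> par G j -> par G l -> zero_on G (t i i)
    & forall i j l, uniq [:: i; j; l] -> par G i -> par G l -> zero_on G (t i j)].

Lemma box_upd G x i a : box_set G x -> lo G 0 i <= a <= hi G 0 i -> box_set G (upd x i a).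
Proof. by move=> Gx a1 j; rewrite mxE; case: eqP => [->|_]. Qed.

Lemma zero_on_mderiv G d f : par G d -> zero_on G f -> zero_on G (mderiv d f).
Proof.
move=> Gd f0 x Gx; rewrite -[x](upd_id _ d).
by apply: (mderiv_seg0 Gd) => a ab; apply: f0; apply: box_upd.
Qed.

Lemma const_on_dir G d f x a : (par G d -> zero_on G (mderiv d f)) ->
  box_set G x -> lo G 0 d <= a <= hi G 0 d -> peval f (upd x d a) = peval f x.
Proof.
move=> f0 Gx ad; case: (boolP (par G d)) => [Gd|nGd].
  rewrite -[x in RHS](upd_id _ d); apply: (const_seg Gd) => b bd.
  by apply: f0 => //; apply: box_upd.
rewrite upd_idE //; apply/eqP; move: nGd; rewrite /par -leNgt => h.
by have := Gx d; move: ad h => /andP [? ?] ? /andP [? ?]; apply/eqP; lra.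
Qed.

Lemma zero_on_const G f x0 : (forall d, par G d -> zero_on G (mderiv d f)) ->
  box_set G x0 -> peval f x0 = 0 -> zero_on G f.
Proof.
move=> f0 G0 fx0 x Gx.
have -> : x = upd (upd (upd x0 0 (x 0 0)) 1 (x 0 1)) 2 (x 0 2).
  by apply/rowP; elim/ord3P; rewrite !mxE.
have G1 : box_set G (upd x0 0 (x 0 0)) by apply: box_upd.
have G2 : box_set G (upd (upd x0 0 (x 0 0)) 1 (x 0 1)) by apply: box_upd.
by rewrite !(@const_on_dir G) //; exact: f0.
Qed.

Lemma hess1E w i j : hess1 w i j = mderiv i (mderiv j w).
Proof. by rewrite mxE. Qed.

Lemma hess1B u w : hess1 (u - w) = hess1 u - hess1 w.
Proof. by apply/matrixP => i j; rewrite !mxE !mderivB. Qed.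

Lemma hess1D u w : hess1 (u + w) = hess1 u + hess1 w.
Proof. by apply/matrixP => i j; rewrite !mxE !mderivD. Qed.

Lemma U_trace0I G u : zero_on G u -> (forall d, zero_on G (mderiv d u)) ->
  (forall i j, i != j -> zero_on G (mderiv i (mderiv j u))) ->
  zero_on G (mderiv 0 (mderiv 1 (mderiv 2 u))) -> U_trace0 G u.
Proof.
move=> H0 H1 H2 H3 b; rewrite /jet.
by case: (b 0); case: (b 1); case: (b 2) => //=; exact: H2.
Qed.

Lemma U_trace0E G u : U_trace0 G u ->
  [/\ zero_on G u, (forall d, zero_on G (mderiv d u)),
   (forall i j, i != j -> zero_on G (mderiv i (mderiv j u))) &
   (forall i j l, uniq [:: i; j; l] -> zero_on G (mderiv l (mderiv i (mderiv j u))))].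
Proof.
move=> H; have H0 := H (fun=> false); have H3 := H (fun=> true).
have H1 d : zero_on G (mderiv d u).
  by move: (H (fun e => e == d)); elim/ord3P: d.
have H2 i j : i != j -> zero_on G (mderiv i (mderiv j u)).
  move: (H (fun e => (e == i) || (e == j))) => + ij.
  move: i j ij; elim/ord3P; elim/ord3P => // _ h; rewrite ?[mderiv 1 (mderiv 0 _)]mderiv_comm
   ?[mderiv 2 (mderiv 0 _)]mderiv_comm ?[mderiv 2 (mderiv 1 _)]mderiv_comm; exact: h.
split=> // i j l u3.
suff -> : mderiv l (mderiv i (mderiv j u)) = mderiv 0 (mderiv 1 (mderiv 2 u)) by [].
apply: (@mderiv_perm _ _ [:: l; i; j] [:: 0; 1; 2]).
by clear -u3; move: i j l u3; elim/ord3P; elim/ord3P; elim/ord3P.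
Qed.

Lemma mderiv3_perm i j l u : uniq [:: i; j; l] ->
  mderiv i (mderiv j (mderiv l u)) = mderiv 0 (mderiv 1 (mderiv 2 u)).
Proof.
move=> u3; apply: (@mderiv_perm _ _ [:: i; j; l] [:: 0; 1; 2]).
by clear -u3; move: i j l u3; elim/ord3P; elim/ord3P; elim/ord3P.
Qed.

Lemma hess_trace G w : U_trace0 G w -> Sigma_trace0 G (hess1 w).
Proof.
move=> /U_trace0E [H0 H1 H2 H3]; split => [i Gi|i j ij|_ i j l u]; rewrite hess1E.
- exact: zero_on_mderiv.
- exact: H2.
- exact: H3.
Qed.

(** The tangential derivatives of the derivative of w in x_d are either the tangential s_dd or
    off-diagonal entries, so that derivative is constant on G, hence zero; the same argument then
    applies to w. The mixed third derivative is a tangential derivative of an off-diagonal entry as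
    soon as G extends in some direction; at a vertex it is given by the last clause of
    [Sigma_trace0]. *)
Lemma hess_trace_inj G w x0 : Sigma_trace0 G (hess1 w) -> box_set G x0 ->
  peval w x0 = 0 -> (forall d, peval (mderiv d w) x0 = 0) -> U_trace0 G w.
Proof.
move=> [S1 S2 S3] G0 w0 dw0.
have H2 i j : i != j -> zero_on G (mderiv i (mderiv j w)).
  by move=> /S2; rewrite hess1E.
have H1 d : zero_on G (mderiv d w).
  apply: (zero_on_const _ G0) => // e Ge; case: (eqVneq e d) => [<-|ed]; last exact: H2.
  by have := S1 _ Ge; rewrite hess1E.
apply: U_trace0I => //.
  by apply: (zero_on_const _ G0) => // e Ge; exact: H1.
case: (boolP [exists e, par G e]) => [/existsP [e]|].
  rewrite -(@mderiv3_perm e (e + 1) (e + 2)); last by elim/ord3P: e.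
  by move=> Ge; apply: zero_on_mderiv => //; apply: H2; elim/ord3P: e {Ge}.
rewrite negb_exists => /forallP H; rewrite -(@mderiv3_perm 2 0 1) //.
have -> : mderiv 0 (mderiv 1 w) = hess1 w 0 1 by rewrite hess1E.
by apply: S3 => //; exists 0 => e _; exact: H.
Qed.

(** Writing the vanishing as an equality of two derivatives hides the sign, so that it holds for all
    permutations of the indices and not only for the cyclic ones. *)
Lemma curl1_diag0 s i j l x : uniq [:: i; j; l] ->
  peval (curl1 s i i) x = 0 <-> peval (mderiv j (s i l)) x = peval (mderiv l (s i j)) x.
Proof.
have [[h00 h01 h02] [h10 h11 h12] [h20 h21 h22]] := curl1E s.
move: i j l; elim/ord3P; elim/ord3P; elim/ord3P => //= _;
  rewrite ?h00 ?h11 ?h22 pevalB; split=> [/subr0_eq //|->]; exact: subrr.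
Qed.

Lemma curl1_off0 s i j l x : uniq [:: i; j; l] ->
  peval (curl1 s i j) x = 0 <-> peval (mderiv l (s i i)) x = peval (mderiv i (s i l)) x.
Proof.
have [[h00 h01 h02] [h10 h11 h12] [h20 h21 h22]] := curl1E s.
move: i j l; elim/ord3P; elim/ord3P; elim/ord3P => //= _;
  rewrite ?h01 ?h02 ?h10 ?h12 ?h20 ?h21 pevalB; split=> [/subr0_eq //|->]; exact: subrr.
Qed.

(** Every derivative in the entry of the curl at hand is either tangential to G, and applied to an
    entry of s that vanishes on G, or of the kind controlled on thin subentities. *)
Lemma curl_trace G s : s^T = s -> Sigma_trace0 G s -> Xi_trace0 G (curl1 s).
Proof.
move=> sT [S1 S2 S3]; have u3 := uniq3_next.
have sE i j : s i j = s j i by rewrite -{1}sT mxE.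
split => [tG i x Gx|i j l u Gj Gl x Gx|i j l u Gi Gl x Gx].
- apply/(curl1_diag0 _ _ (u3 i)).
  rewrite S3 // ?S3 //; by elim/ord3P: {Gx} i.
- have [? ? ? [? ? ?]] := uniq3P u.
  by apply/(curl1_diag0 _ _ u); rewrite !(@zero_on_mderiv G) //; apply: S2.
- have [? ? ? [? ? ?]] := uniq3P u.
  apply/(curl1_off0 _ _ u); rewrite !(@zero_on_mderiv G) //; [exact: S2|exact: S1].
Qed.

Lemma curl1B s t : curl1 (s - t) = curl1 s - curl1 t.
Proof. apply/matrixP => i j; rewrite !mxE !mderivB; ring. Qed.

Lemma curl1_hess u : curl1 (hess1 u) = 0.
Proof.
apply/matrixP => i j; rewrite !mxE.
rewrite (mderiv_comm i (j + 1)) (mderiv_comm i (j + 2)).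
by rewrite (mderiv_comm (j + 1) (j + 2)) subrr.
Qed.

Lemma hess1T u : (hess1 u)^T = hess1 u.
Proof. by apply/matrixP => i j; rewrite !mxE mderiv_comm. Qed.

Lemma subentity_set G G' : (forall i, lo G 0 i <= hi G 0 i) ->
  subentity G G' -> box_set G' `<=` box_set G.
Proof.
move=> Gi sG x Gx i; move: (Gx i) (Gi i).
by case: (sG i) => -[-> ->] //; move=> /andP [? ?] ?; lra.
Qed.

Lemma subentity_par G G' i : subentity G G' -> par G' i ->
  lo G' 0 i = lo G 0 i /\ hi G' 0 i = hi G 0 i.
Proof. by rewrite /par => /(_ i) [] [-> ->]; rewrite ?ltxx. Qed.


(* Subtracting the Hessian of this polynomial makes s_ll vanish, s_jl and s_jj
   vanish on x_l = v_l, and the remaining entries on x_j = v_j, x_l = v_l. *)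
Definition gauge i j l v s : pol :=
  let E p := esub j (v 0 j) (esub l (v 0 l) p) in
  let I d p := pint d (v 0 d) p in
  let X d := mpolyX R (mnm1 d) - mpolyC 3 (v 0 d) in
  I i (I i (E (s i i))) + X j * I i (E (s i j)) + X l * I i (E (s i l))
  + I j (I j (esub l (v 0 l) (s j j))) + X l * I j (esub l (v 0 l) (s j l))
  + I l (I l (s l l)).

Lemma mderiv_linear d e (a : R) :
  mderiv d (mpolyX R (mnm1 e) - mpolyC 3 a) = mpolyC 3 (d == e)%:R.
Proof.
rewrite mderivB mderivC subr0 mderivX mnm1E eq_sym; case: eqVneq => [->|_].
  have -> : mnm_sub (mnm1 e) (mnm1 e) = mnm0.
    by apply/mnmP => f; rewrite mnmBE mnm0E subnn.
  by rewrite mpolyX0 scale1r mpolyC1.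
by rewrite scale0r mpolyC0.
Qed.

(** A linear factor raises the degree in its variable x_e by one; the entry of s it multiplies has
    one degree in x_e to spare, because e is one of its indices. *)
Lemma gauge_deg k i j l v s : (3 <= k)%N -> uniq [:: i; j; l] ->
  Sigma_deg k s -> U_deg k (gauge i j l v s).
Proof.
move=> k3 u sh d; have k0 : (3 : int) <= k%:Z by lia.
have lin e c : degle d (d == e)%:Z (mpolyX R (mnm1 e) - mpolyC 3 c).
  by apply: degleB; [exact: degleX|apply: degle_le (@degleC _ _ _); case: eqP].
have Xk e c q : degle d (k%:Z - (d == e)%:Z) q ->
    degle d k%:Z ((mpolyX R (mnm1 e) - mpolyC 3 c) * q).
  by move=> /(degleM (lin e c)); rewrite addrC subrK.
have I1 (e f : 'I_3) (a : R) q : degle d (k%:Z - (d == e)%:Z - (d == f)%:Z) q ->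
    degle d (k%:Z - (d == f)%:Z) (pint e a q).
  by move=> h; apply: degle_pintE; [lia|apply: degle_le h; lia].
have I2 e a q : degle d (k%:Z - (d == e)%:Z - (d == e)%:Z) q ->
    degle d k%:Z (pint e a (pint e a q)).
  by move=> /I1 h; apply: degle_pintE => //; apply: h.
have E1 e (a : R) (f g : 'I_3) q : degle d (k%:Z - (d == f)%:Z - (d == g)%:Z) q ->
    degle d (k%:Z - (d == f)%:Z - (d == g)%:Z) (esub e a q).
  by apply: degle_esub; left; lia.
rewrite /gauge; apply: degleD; last exact/I2/sh.
apply: degleD; last exact/Xk/I1/E1/sh.
apply: degleD; last exact/I2/E1/sh.
apply: degleD; last exact/Xk/I1/E1/E1/sh.
apply: degleD; last exact/Xk/I1/E1/E1/sh.
exact/I2/E1/E1/sh.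
Qed.


(** The six summands of [gauge] are replaced by variables known only through their derivatives and
    their values on the reference planes; the claims then become ring identities. *)
Lemma gaugeP i j l v s : uniq [:: i; j; l] -> s^T = s ->
  let r := s - hess1 (gauge i j l v s) in
  [/\ r l l = 0,
      forall x, x 0 l = v 0 l -> peval (r j l) x = 0 /\ peval (r j j) x = 0 &
      forall x, x 0 j = v 0 j -> x 0 l = v 0 l ->
        [/\ peval (r i i) x = 0, peval (r i j) x = 0 & peval (r i l) x = 0]].
Proof.
move=> u sT; have [ij il jl [ji li lj]] := uniq3P u.
have II d p : mderiv d (pint d (v 0 d) p) = p by apply: mderiv_pint.
have IC d e p : d != e -> mderiv e (pint d (v 0 d) p) = pint d (v 0 d) (mderiv e p).
  exact: pint_mderiv.
have IE d p x : x 0 d = v 0 d -> peval (pint d (v 0 d) p) x = 0 by apply: peval_pint.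
pose E p := esub j (v 0 j) (esub l (v 0 l) p).
have El p : mderiv l (E p) = 0 by rewrite /E esub_mderiv // mderiv_esub esub0.
have Ej p : mderiv j (E p) = 0 by rewrite /E mderiv_esub.
have EE p x : x 0 j = v 0 j -> x 0 l = v 0 l -> peval (E p) x = peval p x.
  by move=> xj xl; rewrite /E !peval_esub !upd_idE // upd_idE.
rewrite /gauge -!/(E _).
set y := mpolyX R (mnm1 j) - _; set z := mpolyX R (mnm1 l) - _.
have [yi yj yl] : [/\ mderiv i y = 0, mderiv j y = 1 & mderiv l y = 0].
  by rewrite !mderiv_linear eqxx (negbTE ij) (negbTE lj) mpolyC1 mpolyC0.
have [zi zj zl] : [/\ mderiv i z = 0, mderiv j z = 0 & mderiv l z = 1].
  by rewrite !mderiv_linear eqxx (negbTE il) (negbTE jl) mpolyC1 mpolyC0.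
have y0 x : x 0 j = v 0 j -> peval y x = 0 by move=> xj; rewrite !pevalE xj subrr.
have z0 x : x 0 l = v 0 l -> peval z x = 0 by move=> xl; rewrite !pevalE xl subrr.
move: y z yi yj yl zi zj zl y0 z0 => y z yi yj yl zi zj zl y0 z0.
set A := pint i _ (pint i _ _); set B := pint i _ _; set C := pint i _ _.
set D := pint j _ (pint j _ _); set F := pint j _ _; set H := pint l _ _.
have [Aj Al Aii] : [/\ mderiv j A = 0, mderiv l A = 0 & mderiv i (mderiv i A) = E (s i i)].
  by rewrite ?/A ?/B ?/C !II !IC // Ej El !pint0.
have [Bj Bl Bi] : [/\ mderiv j B = 0, mderiv l B = 0 & mderiv i B = E (s i j)].
  by rewrite ?/A ?/B ?/C !II !IC // Ej El !pint0.
have [Cj Cl Ci] : [/\ mderiv j C = 0, mderiv l C = 0 & mderiv i C = E (s i l)].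
  by rewrite ?/A ?/B ?/C !II !IC // Ej El !pint0.
have [Dl Djj] : mderiv l D = 0 /\ mderiv j (mderiv j D) = esub l (v 0 l) (s j j).
  by rewrite ?/D ?/F !II !IC // mderiv_esub !pint0.
have Di x : x 0 j = v 0 j -> peval (mderiv i (mderiv i D)) x = 0 /\ peval (mderiv i (mderiv j D)) x = 0.
  by move=> xj; rewrite /D !II !IC // !IE.
have [Fl Fj] : mderiv l F = 0 /\ mderiv j F = esub l (v 0 l) (s j l).
  by rewrite ?/D ?/F !II !IC // mderiv_esub !pint0.
have Fi x : x 0 j = v 0 j -> peval (mderiv i F) x = 0 by move=> xj; rewrite /F !IC // !IE.
have Hll : mderiv l (mderiv l H) = s l l by rewrite /H !II.
have Hl x : x 0 l = v 0 l -> [/\ peval (mderiv j (mderiv l H)) x = 0,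
    peval (mderiv i (mderiv l H)) x = 0, peval (mderiv j (mderiv j H)) x = 0,
    peval (mderiv i (mderiv i H)) x = 0 & peval (mderiv i (mderiv j H)) x = 0].
  by move=> xl; rewrite /H II !(IC _ _ _ li) !(IC _ _ _ lj) !(IC _ _ _ li); split; exact: IE.
have sl x : x 0 l = v 0 l -> forall p, peval (esub l (v 0 l) p) x = peval p x.
  by move=> xl p; rewrite peval_esub upd_idE.
move: A B C D F H Aj Al Aii Bj Bl Bi Cj Cl Ci Dl Djj Di Fl Fj Fi Hll Hl.
move=> A B C D F H Aj Al Aii Bj Bl Bi Cj Cl Ci Dl Djj Di Fl Fj Fi Hll Hl.
set U := A + _ + _ + _ + _ + _.
have Ul : mderiv l U = C + F + mderiv l H.
  by rewrite /U !mderivD !mderivM Al Bl Cl Dl Fl yl zl; ring.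
have Uj : mderiv j U = B + mderiv j D + z * esub l (v 0 l) (s j l) + mderiv j H.
  by rewrite /U !mderivD !mderivM Aj Bj Cj Fj yj zj; ring.
have Ui : mderiv i U = mderiv i A + y * mderiv i B + z * mderiv i C + mderiv i D
    + z * mderiv i F + mderiv i H.
  by rewrite /U !mderivD !mderivM yi zi; ring.
move: {U} (U) Ul Uj Ui => U Ul Uj Ui.
have rE a b : (s - hess1 U) a b = s a b - mderiv a (mderiv b U) by rewrite !mxE.
split=> [|x xl|x xj xl]; rewrite !rE.
- by rewrite Ul !mderivD Cl Fl Hll !add0r subrr.
- have [h1 h2 h3 h4 h5] := Hl _ xl.
  rewrite Ul Uj !mderivD !mderivM Cj Fj Bj Djj zj !pevalE !sl // h1 h3 z0 //; split; ring.
- have [h1 h2 h3 h4 h5] := Hl _ xl; have [d1 d2] := Di _ xj.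
  rewrite Ui Uj Ul !mderivD !mderivM yi zi !pevalE Aii Bi Ci z0 // y0 // h2 h4 h5 d1 d2 Fi //.
  by rewrite !EE //; split; ring.
Qed.


(** The directions in which G extends are listed first. If G does not extend in x_l, say, it lies in
    the reference plane of [gauge] where the remaining entries already vanish. *)
Lemma par_order G : exists i j l,
  [/\ uniq [:: i; j; l], par G l -> par G j & par G j -> par G i].
Proof.
case p0 : (par G 0); case p1 : (par G 1); case p2 : (par G 2).
- by exists 0, 1, 2.
- by exists 0, 1, 2; rewrite p2.
- by exists 0, 2, 1; rewrite p1.
- by exists 0, 1, 2; rewrite p1 p2.
- by exists 1, 2, 0; rewrite p0 p1.
- by exists 1, 2, 0; rewrite p0 p2.
- by exists 2, 1, 0; rewrite p0 p1.
- by exists 0, 1, 2; rewrite p1 p2.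
Qed.

Lemma zero_on_dir2 G d e f : d != e ->
  (par G d -> zero_on G (mderiv d f)) -> (par G e -> zero_on G (mderiv e f)) ->
  (forall x, box_set G x -> x 0 d = lo G 0 d -> x 0 e = lo G 0 e -> peval f x = 0) ->
  zero_on G f.
Proof.
move=> de fd fe f0 x Gx.
have ll c : lo G 0 c <= lo G 0 c <= hi G 0 c.
  by rewrite lexx; move: (Gx c) => /andP [/le_trans h /h].
have Gx1 : box_set G (upd x d (lo G 0 d)) by apply: box_upd.
rewrite -(@const_on_dir G d f x (lo G 0 d)) //.
rewrite -(@const_on_dir G e f _ (lo G 0 e)) //.
apply: f0; [exact: box_upd| |exact: upd_same].
by rewrite upd_other // upd_same.
Qed.

Lemma zero_on_dir1 G d f : (par G d -> zero_on G (mderiv d f)) ->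
  (forall x, box_set G x -> x 0 d = lo G 0 d -> peval f x = 0) -> zero_on G f.
Proof.
move=> fd f0 x Gx; have ll : lo G 0 d <= lo G 0 d <= hi G 0 d.
  by rewrite lexx; move: (Gx d) => /andP [/le_trans h /h].
by rewrite -(@const_on_dir G d f x (lo G 0 d)) // f0 ?upd_same //; apply: box_upd.
Qed.

(* When G is a cell this is the Poincare lemma for the Hessian. *)
Lemma hess_potential k G s : (3 <= k)%N -> (forall d, lo G 0 d <= hi G 0 d) ->
  s^T = s -> Sigma_deg k s ->
  (forall G', subentity G G' -> Xi_trace0 G' (curl1 s)) ->
  exists u, U_deg k u /\
    forall G', subentity G G' -> Sigma_trace0 G' (s - hess1 u).
Proof.
move=> k3 Gi sT sd X0; have [i [j [l [u plj pji]]]] := par_order G.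
have [ij il jl [ji li lj]] := uniq3P u.
exists (gauge i j l (lo G) s); split; first exact: gauge_deg.
have := @gaugeP i j l (lo G) s u sT; set r := s - _ => -[g1 g2 g3].
have rT : r^T = r by rewrite linearB /= sT hess1T.
have rE a b : r a b = r b a by rewrite -{1}rT mxE.
have {}X0 G' : subentity G G' -> Xi_trace0 G' (curl1 r).
  by rewrite curl1B curl1_hess subr0; apply: X0.
have ujil : uniq [:: j; i; l] by rewrite /= !inE negb_or ji jl il.
have ulij : uniq [:: l; i; j] by rewrite /= !inE negb_or li lj ij.
have ulji : uniq [:: l; j; i] by rewrite /= !inE negb_or lj li ji.
have uilj : uniq [:: i; l; j] by rewrite /= !inE negb_or il ij lj.
have ujli : uniq [:: j; l; i] by rewrite /= !inE negb_or jl ji li.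
have GG : subentity G G by move=> d; constructor 1.
have [_ Xd Xo] := X0 _ GG.
have diag a b c x : uniq [:: a; b; c] -> box_set G x -> par G b -> par G c ->
    peval (mderiv b (r a c)) x = peval (mderiv c (r a b)) x.
  by move=> v Gx Gb Gc; apply/(curl1_diag0 _ _ v)/(Xd _ _ _ v Gb Gc).
have off a b c x : uniq [:: a; b; c] -> box_set G x -> par G a -> par G c ->
    peval (mderiv c (r a a)) x = peval (mderiv a (r a c)) x.
  by move=> v Gx Ga Gc; apply/(curl1_off0 _ _ v)/(Xo _ _ _ v Ga Gc).
(* The entries are treated in the order jl, jj, il, ij, ii. Each vanishes on a reference plane by
   the choice of gauge, and a curl equation turns its derivative leaving that plane into a
   derivative of r_ll = 0 or a tangential derivative of an entry already treated. *)
have zjl : zero_on G (r j l).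
  apply: (@zero_on_dir1 _ l) => [Gl x Gx|x Gx /g2 []//].
  by rewrite rE -(off l i j) ?plj // g1 mderiv0 peval0.
have zjj : par G j -> zero_on G (r j j).
  move=> Gj; apply: (@zero_on_dir1 _ l) => [Gl x Gx|x Gx /g2 []//].
  by rewrite (off j i l) //; apply: (zero_on_mderiv Gj zjl).
have zil : zero_on G (r i l).
  apply: (@zero_on_dir2 _ j l) => // [Gj x Gx|Gl x Gx|x Gx xj xl].
  - by rewrite rE -(diag l i j) ?pji // rE; apply: (@zero_on_mderiv G i (r j l)) => //; exact: pji.
  - by rewrite rE -(off l j i) ?pji ?plj // g1 mderiv0 peval0.
  - by case: (g3 x xj xl).
have zij : zero_on G (r i j).
  apply: (@zero_on_dir2 _ j l) => // [Gj x Gx|Gl x Gx|x Gx xj xl].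
  - by rewrite rE -(off j l i) ?pji //; apply: (@zero_on_mderiv G i (r j j)) => //; [exact: pji|exact: zjj].
  - rewrite rE -(diag j i l) ?pji ?plj //.
    by apply: (@zero_on_mderiv G i (r j l)) => //; apply/pji/plj.
  - by case: (g3 x xj xl).
have zii : par G i -> zero_on G (r i i).
  move=> Gi'; apply: (@zero_on_dir2 _ j l) => // [Gj x Gx|Gl x Gx|x Gx xj xl].
  - by rewrite (off i l j) //; apply: (@zero_on_mderiv G i (r i j)).
  - by rewrite (off i j l) //; apply: (@zero_on_mderiv G i (r i l)).
  - by case: (g3 x xj xl).
(* If G does not extend in x_l, then r_jl vanishes on the whole plane containing G and not merely on
   G, so its derivative in x_i vanishes even when x_i is normal to G. *)
have zjli : zero_on G (mderiv i (r j l)).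
  move=> x Gx; case: (boolP (par G l)) => [/plj/pji Gi'|nl].
    exact: (zero_on_mderiv Gi' zjl).
  apply: (@mderiv_vanish _ l (lo G 0 l)) => // [y /g2 []//|].
  have /andP [h1 h2] := Gx l; apply/eqP; rewrite eq_le h1 andbT.
  by apply: le_trans h2 _; rewrite leNgt.
move=> G' sG; have GsG := subentity_set Gi sG; split.
- move=> a Ga; have {Ga} : par G a.
    by have [h1 h2] := subentity_par sG Ga; rewrite /par -h1 -h2.
  by case: (uniq3 u a) => -> Ga x /GsG; [exact: zii|exact: zjj|rewrite g1 peval0].
- move=> a b ab x /GsG Gx; move: ab.
  by case: (uniq3 u a) => ->; case: (uniq3 u b) => ->; rewrite ?eqxx // => _;
    do 1?[exact: zij|exact: zil|exact: zjl|rewrite rE; do 1?[exact: zij|exact: zil|exact: zjl]].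
(* On a thin subentity the diagonal of the curl vanishes, so the three derivatives of off-diagonal
   entries in the remaining variable are equal; one of them is zero by [zjli]. *)
- move=> tG a b c v x G'x; have [/(_ tG) Xt _ _] := X0 _ sG.
  have dt a' b' c' : uniq [:: a'; b'; c'] ->
      peval (mderiv b' (r a' c')) x = peval (mderiv c' (r a' b')) x.
    by move=> w; apply/(curl1_diag0 _ _ w)/Xt.
  have e1 : peval (mderiv i (r j l)) x = 0 by apply/zjli/GsG.
  have e2 : peval (mderiv j (r i l)) x = 0 by rewrite rE -(dt l i j) // rE.
  have e3 : peval (mderiv l (r i j)) x = 0 by rewrite rE -(dt j i l).
  move: v; case: (uniq3 u a) => ->; case: (uniq3 u b) => ->; case: (uniq3 u c) => ->;
    rewrite /= !inE ?eqxx ?orbT /= ?andbF // => _; do 1?[done|by rewrite [r j i]rE|by rewrite [r l i]rE|by rewrite [r l j]rE].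
Qed.

End Traces.

(** * Cech cohomology of a contractible mesh *)

Section Cech.
Variables (R : realType) (N : nat) (T : 'I_N -> box R).
Notation pt := 'rV[R]_3.
Implicit Types (x y z v : pt) (a b c d : 'I_N) (e r : R).

Definition near e x y : Prop := forall i, `|x 0 i - y 0 i| < e.

Definition in_mesh x : Prop := exists c, box_set (T c) x.

Definition touch a b : Prop := exists x, box_set (T a) x /\ box_set (T b) x.

Definition segp x y (t : R) : pt := (1 - t) *: x + t *: y.

Lemma near_sym e x y : near e x y -> near e y x.
Proof. by move=> h i; rewrite distrC. Qed.

Lemma near_refl e x : 0 < e -> near e x x.
Proof. by move=> h i; rewrite subrr normr0. Qed.

Lemma near_trans e r x y z : near e x y -> near r y z -> near (e + r) x z.
Proof. by move=> h1 h2 i; apply: (le_lt_trans (ler_distD (y 0 i) _ _)); rewrite ltrD. Qed.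

Lemma near_le e r x y : e <= r -> near e x y -> near r x y.
Proof. by move=> er h i; apply: lt_le_trans er. Qed.

Definition convex (S : set pt) : Prop :=
  forall x y t, S x -> S y -> 0 <= t <= 1 -> S (segp x y t).

Lemma convex_box G : convex (box_set G).
Proof.
move=> x y t Sx Sy /andP [t0 t1] i; move: (Sx i) (Sy i) => /andP [h1 h2] /andP [h3 h4].
by rewrite !mxE; apply/andP; split; nra.
Qed.

Lemma convexI S1 S2 : convex S1 -> convex S2 -> convex (S1 `&` S2).
Proof. by move=> c1 c2 x y t [? ?] [? ?] t01; split; [exact: c1|exact: c2]. Qed.

Lemma fine_steps e r : 0 < e -> exists n : nat, (0 < n)%N /\
  forall x y, near r x y -> forall k : nat, near e (segp x y (k%:R / n%:R)) (segp x y (k.+1%:R / n%:R)).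
Proof.
move=> e0; exists (Num.bound (r / e)).+1; split=> // x y xy k i.
set n := (Num.bound _).+1; have n0 : 0 < n%:R :> R by rewrite ltr0n.
have -> : segp x y (k%:R / n%:R) 0 i - segp x y (k.+1%:R / n%:R) 0 i
    = (x 0 i - y 0 i) / n%:R.
  by rewrite !mxE -natr1; field; rewrite gt_eqF.
rewrite normrM [`|n%:R^-1|]gtr0_norm ?invr_gt0 // ltr_pdivrMr //.
apply: lt_le_trans (xy i) _; rewrite -ler_pdivrMl // mulrC.
have r0 : 0 <= r by apply: le_trans (ltW (xy i)).
have := archi_boundP (divr_ge0 r0 (ltW e0)) => /ltW /le_trans; apply.
by rewrite ler_nat leqnSn.
Qed.

Lemma frac01 (k n : nat) : (k <= n)%N -> 0 <= (k%:R / n%:R : R) <= 1.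
Proof.
move=> kn; rewrite divr_ge0 //=; case: n kn => [|n] kn; first by rewrite invr0 mulr0.
by rewrite ler_pdivrMr ?ltr0n // mul1r ler_nat.
Qed.

Lemma segp0 x y : segp x y 0 = x.
Proof. by rewrite /segp subr0 scale1r scale0r addr0. Qed.

Lemma segp1 x y : segp x y 1 = y.
Proof. by rewrite /segp subrr scale1r scale0r add0r. Qed.

Lemma near_bound x y : near (1 + \sum_i `|x 0 i - y 0 i|) x y.
Proof.
move=> i; rewrite (bigD1 i) //=.
have : 0 <= \sum_(j < 3 | j != i) `|x 0 j - y 0 j| by apply: sumr_ge0.
by move: (\sum_(_ < _ | _) _) => S; lra.
Qed.

(** The scale e is uniform, so x is joined to y by finitely many steps of size below e inside the
    convex set. *)
Lemma locally_constant (U : Type) (S : set pt) (f : pt -> U) e : 0 < e -> convex S ->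
  (forall x y, S x -> S y -> near e x y -> f x = f y) ->
  forall x y, S x -> S y -> f x = f y.
Proof.
move=> e0 cS fe x y Sx Sy.
have [n [n0 /(_ _ _ (@near_bound x y)) st]] := fine_steps (1 + \sum_i `|x 0 i - y 0 i|) e0.
have H (k : nat) : (k <= n)%N -> f (segp x y (k%:R / n%:R)) = f x.
  elim: k => [|k IH] kn; first by rewrite mul0r segp0.
  by rewrite -IH ?(ltnW kn) //; apply/esym/fe => //; apply: cS => //; apply: frac01 => //; exact: ltnW.
by rewrite -(H n) // divff ?segp1 // gt_eqF // ltr0n.
Qed.

Lemma segp_near e v x y t : 0 <= t <= 1 -> near e x y -> near e (segp v x t) (segp v y t).
Proof.
move=> /andP [t0 t1] xy i.
have -> : segp v x t 0 i - segp v y t 0 i = t * (x 0 i - y 0 i) by rewrite !mxE; ring.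
rewrite normrM (ger0_norm t0); apply: le_lt_trans (xy i).
by rewrite ler_piMl.
Qed.

(* The primitive is the sum of the cocycle along subdivided segments. *)
Lemma cocycle1_box (G : box R) (q : pt -> pt -> R) e : 0 < e ->
  (forall i, lo G 0 i <= hi G 0 i) ->
  (forall x y z, box_set G x -> box_set G y -> box_set G z ->
     near e x y -> near e x z -> near e y z -> q y z - q x z + q x y = 0) ->
  exists f : pt -> R, forall x y, box_set G x -> box_set G y -> near (e / 2) x y ->
    q x y = f y - f x.
Proof.
move=> e0 Gi qc; pose v := lo G; have Gv : box_set G v by move=> i; rewrite lexx Gi.
pose r := 1 + \sum_i (hi G 0 i - lo G 0 i).
have e2 : 0 < e / 2 by lra.
have [n [n0 st]] := fine_steps r e2.
have vr x : box_set G x -> near r v x.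
  move=> Gx i; move: (Gx i) => /andP [h1 h2].
  rewrite /r (bigD1 i) //= distrC ger0_norm ?subr_ge0 //.
  have : 0 <= \sum_(j < 3 | j != i) (hi G 0 j - lo G 0 j).
    by apply: sumr_ge0 => j _; rewrite subr_ge0.
  move: (\sum_(_ | _) _) => S S0; rewrite /v; lra.
exists (fun y => \sum_(k < n) q (segp v y (k%:R / n%:R)) (segp v y (k.+1%:R / n%:R))) => x y Gx Gy xy.
have xye : near e x y by apply: near_le xy; lra.
rewrite -sumrB.
have H (m : nat) : (m <= n)%N -> q (segp v x (m%:R / n%:R)) (segp v y (m%:R / n%:R)) =
    \sum_(k < m) (q (segp v y (k%:R / n%:R)) (segp v y (k.+1%:R / n%:R)) -
                  q (segp v x (k%:R / n%:R)) (segp v x (k.+1%:R / n%:R))).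
  elim: m => [|m IH] mn.
    rewrite big_ord0 mul0r !segp0.
    by have := qc v v v Gv Gv Gv (near_refl _ e0) (near_refl _ e0) (near_refl _ e0); lra.
  rewrite big_ord_recr /= -IH ?(ltnW mn) //.
  have i1 := frac01 (ltnW mn); have i2 := frac01 mn.
  set x1 := segp v x (m%:R / _); set x2 := segp v x (m.+1%:R / _).
  set y1 := segp v y (m%:R / _); set y2 := segp v y (m.+1%:R / _).
  have Gx1 : box_set G x1 by apply: convex_box.
  have Gx2 : box_set G x2 by apply: convex_box.
  have Gy1 : box_set G y1 by apply: convex_box.
  have Gy2 : box_set G y2 by apply: convex_box.
  have x12 : near (e / 2) x1 x2 by apply: st; apply: vr.
  have y12 : near (e / 2) y1 y2 by apply: st; apply: vr.
  have xy1 : near (e / 2) x1 y1 by apply: segp_near.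
  have xy2 : near (e / 2) x2 y2 by apply: segp_near.
  have hl x' y' : near (e / 2) x' y' -> near e x' y' by apply: near_le; lra.
  have hs : e = e / 2 + e / 2 by lra.
  (* The quadrilateral between two consecutive points of each path is cut along this diagonal into
     two triangles; working at scale e / 2 keeps the diagonal below e. *)
  have xy12 : near e x1 y2 by rewrite hs; apply: near_trans y12.
  have := qc x1 y1 y2 Gx1 Gy1 Gy2 (hl _ _ xy1) xy12 (hl _ _ y12).
  have := qc x1 x2 y2 Gx1 Gx2 Gy2 (hl _ _ x12) xy12 (hl _ _ xy2).
  lra.
have := H n (leqnn n); rewrite divff ?segp1 // gt_eqF // ltr0n //.
Qed.

(* A contraction of the mesh, read off on the cells: [g n x] is a cell containing
   the image of x at the n-th time step. *)
Definition cell_homotopy e (M : nat) (g : nat -> pt -> 'I_N) c0 : Prop :=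
  [/\ forall x, in_mesh x -> box_set (T (g 0%N x)) x,
      forall n x y, in_mesh x -> in_mesh y -> near e x y -> touch (g n x) (g n y),
      forall n x y, in_mesh x -> in_mesh y -> near e x y -> touch (g n x) (g n.+1 y)
    & forall x, in_mesh x -> g M x = c0].

Lemma touch_sym a b : touch a b -> touch b a.
Proof. by case=> x []; exists x. Qed.

Variables (e : R) (M : nat) (g : nat -> pt -> 'I_N) (c0 : 'I_N).
Hypothesis e_gt0 : 0 < e.
Hypothesis Tle : forall c i, lo (T c) 0 i <= hi (T c) 0 i.
Hypothesis gP : cell_homotopy e M g c0.

Let touch_refl a : touch a a.
Proof. by exists (lo (T a)); split=> i; rewrite lexx Tle. Qed.

(** Summing along the homotopy gives [B], a primitive at small scale of the cocycle pulled back to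
    points. On a cell c the function [B x - p c (g 0 x)] is locally constant, again by the cocycle
    relation, and its value is the required number for c. *)
Lemma cech1 (p : 'I_N -> 'I_N -> R) :
  (forall a b c, touch a b -> touch a c -> touch b c -> p b c - p a c + p a b = 0) ->
  exists r : 'I_N -> R, forall a b, touch a b -> p a b = r b - r a.
Proof.
move=> pc; have [g0 g1 g2 g3] := gP.
pose B x := - \sum_(n < M) p (g n x) (g n.+1 x).
have BP x y : in_mesh x -> in_mesh y -> near e x y -> p (g 0%N x) (g 0%N y) = B y - B x.
  move=> Kx Ky xy.
  have H (n : nat) : p (g n x) (g n y) - p (g 0%N x) (g 0%N y) =
     \sum_(k < n) p (g k y) (g k.+1 y) - \sum_(k < n) p (g k x) (g k.+1 x).
    elim: n => [|n IH]; first by rewrite !big_ord0; lra.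
    rewrite !big_ord_recr /=.
    have nx := near_refl x e_gt0; have ny := near_refl y e_gt0.
    have := pc _ _ _ (g1 n _ _ Kx Ky xy) (g2 n _ _ Kx Ky xy) (g2 n _ _ Ky Ky ny).
    have := pc _ _ _ (g2 n _ _ Kx Kx nx) (g2 n _ _ Kx Ky xy) (g1 n.+1 _ _ Kx Ky xy).
    move: IH; lra.
  have := H M; rewrite !g3 // /B.
  have := pc _ _ _ (touch_refl c0) (touch_refl c0) (touch_refl c0); lra.
have inm c x : box_set (T c) x -> in_mesh x by exists c.
have tg c x : box_set (T c) x -> touch c (g 0%N x).
  by move=> cx; exists x; split=> //; apply/g0/inm/cx.
have fc c x y : box_set (T c) x -> box_set (T c) y ->
    B x - p c (g 0%N x) = B y - p c (g 0%N y).
  apply: (locally_constant (f := fun x => B x - p c (g 0%N x)) e_gt0); first exact: convex_box.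
  move=> {}x {}y cx cy xy; have := BP x y (inm _ _ cx) (inm _ _ cy) xy.
  have := pc _ _ _ (tg _ _ cx) (tg _ _ cy) (g1 0%N _ _ (inm _ _ cx) (inm _ _ cy) xy).
  lra.
exists (fun c => B (lo (T c)) - p c (g 0%N (lo (T c)))) => a b [x [ax bx]].
have lT c : box_set (T c) (lo (T c)) by move=> i; rewrite lexx Tle.
rewrite (fc a _ x) // (fc b _ x) //.
have ab : touch a b by exists x.
have := pc _ _ _ ab (tg _ _ ax) (tg _ _ bx); lra.
Qed.

(** One degree higher than [cech1]. The prism sum [q] is a primitive at small scale of the pulled
    back cocycle. On a cell c it differs from [p c] by a 1-cocycle at small scale, integrated by
    [cocycle1_box] to a function [b c]. On the convex intersection of two cells, [b d - b c] minus
    the term from [p c d] is locally constant, and these constants are, up to sign, the required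
    cochain. *)
Lemma cech2 (p : 'I_N -> 'I_N -> 'I_N -> R) :
  (forall a b c d, touch a b -> touch a c -> touch a d -> touch b c -> touch b d ->
     touch c d -> p b c d - p a c d + p a b d - p a b c = 0) ->
  exists r : 'I_N -> 'I_N -> R, forall a b c x, box_set (T a) x -> box_set (T b) x -> box_set (T c) x ->
    p a b c = r b c - r a c + r a b.
Proof.
move=> pc; have [g0 g1 g2 g3] := gP.
pose h n x y := p (g n x) (g n y) (g n.+1 y) - p (g n x) (g n.+1 x) (g n.+1 y).
(* At the end of the homotopy the degenerate value [p c0 c0 c0] remains. The cocycle relation does
   not make it zero, but a constant 1-cochain has that same constant as coboundary. *)
pose q x y := \sum_(n < M) h n x y + p c0 c0 c0.
have qP x y z : in_mesh x -> in_mesh y -> in_mesh z -> near e x y -> near e x z ->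
    near e y z -> p (g 0%N x) (g 0%N y) (g 0%N z) = q y z - q x z + q x y.
  move=> Kx Ky Kz xy xz yz.
  have nx := near_refl x e_gt0; have ny := near_refl y e_gt0; have nz := near_refl z e_gt0.
  have H (n : nat) : p (g 0%N x) (g 0%N y) (g 0%N z) - p (g n x) (g n y) (g n z) =
     \sum_(k < n) h k y z - \sum_(k < n) h k x z + \sum_(k < n) h k x y.
    elim: n => [|n IH]; first by rewrite !big_ord0; lra.
    rewrite !big_ord_recr /= /h.
    have := pc _ _ _ _ (g1 n _ _ Kx Ky xy) (g1 n _ _ Kx Kz xz) (g2 n _ _ Kx Kz xz)
      (g1 n _ _ Ky Kz yz) (g2 n _ _ Ky Kz yz) (g2 n _ _ Kz Kz nz).
    have := pc _ _ _ _ (g1 n _ _ Kx Ky xy) (g2 n _ _ Kx Ky xy) (g2 n _ _ Kx Kz xz)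
      (g2 n _ _ Ky Ky ny) (g2 n _ _ Ky Kz yz) (g1 n.+1 _ _ Ky Kz yz).
    have := pc _ _ _ _ (g2 n _ _ Kx Kx nx) (g2 n _ _ Kx Ky xy) (g2 n _ _ Kx Kz xz)
      (g1 n.+1 _ _ Kx Ky xy) (g1 n.+1 _ _ Kx Kz xz) (g1 n.+1 _ _ Ky Kz yz).
    move: IH; rewrite /h; lra.
  have := H M; rewrite !g3 // /q; lra.
have inm c x : box_set (T c) x -> in_mesh x by exists c.
have tg c x : box_set (T c) x -> touch c (g 0%N x).
  by move=> cx; exists x; split=> //; apply/g0/inm/cx.
have /choice [b bP] : forall c, exists f : pt -> R, forall x y, box_set (T c) x ->
    box_set (T c) y -> near (e / 2) x y ->
    q x y - p c (g 0%N x) (g 0%N y) = f y - f x.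
  move=> c; apply: cocycle1_box => // x y z cx cy cz xy xz yz.
  have := qP x y z (inm _ _ cx) (inm _ _ cy) (inm _ _ cz) xy xz yz.
  have := pc _ _ _ _ (tg _ _ cx) (tg _ _ cy) (tg _ _ cz)
    (g1 0%N _ _ (inm _ _ cx) (inm _ _ cy) xy) (g1 0%N _ _ (inm _ _ cx) (inm _ _ cz) xz)
    (g1 0%N _ _ (inm _ _ cy) (inm _ _ cz) yz).
  lra.
have e2 : 0 < e / 2 by rewrite divr_gt0.
have fc c d x y : (box_set (T c) `&` box_set (T d)) x -> (box_set (T c) `&` box_set (T d)) y ->
    b d x - b c x - p c d (g 0%N x) = b d y - b c y - p c d (g 0%N y).
  apply: (locally_constant (f := fun x => b d x - b c x - p c d (g 0%N x)) e2).
    by apply: convexI; exact: convex_box.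
  move=> {}x {}y [cx dx] [cy dy] xy.
  have xye : near e x y by apply: near_le xy; rewrite ler_pdivrMr // mulr_natr mulr2n lerDl ltW.
  have cd : touch c d by exists x.
  have := bP c x y cx cy xy; have := bP d x y dx dy xy.
  have := pc _ _ _ _ cd (tg _ _ cx) (tg _ _ cy) (tg _ _ dx) (tg _ _ dy)
    (g1 0%N _ _ (inm _ _ cx) (inm _ _ cy) xye).
  lra.
(* An arbitrary point of the intersection; the default 0 is taken only for cells that do not meet,
   where nothing is claimed. *)
pose v c d : pt := xget 0 (box_set (T c) `&` box_set (T d)).
have vP c d x : box_set (T c) x -> box_set (T d) x -> (box_set (T c) `&` box_set (T d)) (v c d).
  by move=> cx dx; apply: (@xgetI _ 0 _ x).
exists (fun c d => - (b d (v c d) - b c (v c d) - p c d (g 0%N (v c d)))) => c d f x cx dx fx.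
rewrite (fc d f (v d f) x) //; last exact: vP.
rewrite (fc c f (v c f) x) //; last exact: vP.
rewrite (fc c d (v c d) x) //; last exact: vP.
have cd : touch c d by exists x.
have cf : touch c f by exists x.
have df : touch d f by exists x.
have := pc _ _ _ _ cd cf (tg _ _ cx) df (tg _ _ dx) (tg _ _ fx).
lra.
Qed.

Lemma cech0 (U : Type) (p : 'I_N -> U) : (forall a b, touch a b -> p a = p b) ->
  forall a b, p a = p b.
Proof.
move=> pc; have [g0 g1 g2 g3] := gP.
have H x n : in_mesh x -> p (g n x) = p (g 0%N x).
  move=> Kx; elim: n => // n <-; apply/esym/pc/g2 => //; exact: near_refl.
have pa a : p a = p c0.
  have la : box_set (T a) (lo (T a)) by move=> i; rewrite lexx Tle.
  have Ka : in_mesh (lo (T a)) by exists a.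
  rewrite -(g3 _ Ka) H //; apply: pc; exists (lo (T a)); split=> //; exact: g0.
by move=> a b; rewrite !pa.
Qed.

End Cech.

(** * The contraction of the mesh *)

Section Contraction.
Variables (R : realType).
Notation pt := 'rV[R]_3.
Implicit Types (x y z v : pt) (e r : R).

Lemma ball_near e x y : 0 < e -> ball x e y <-> near e x y.
Proof.
move=> e0; rewrite /ball /= /mx_ball; split=> [[_ h] i|h]; first exact: h.
by split=> // i j; rewrite ord1; exact: h.
Qed.

Lemma nbhs_near x (A : set pt) : nbhs x A <-> exists2 e, 0 < e & forall y, near e x y -> A y.
Proof.
split=> [/nbhs_ballP [e e0 eA]|[e e0 eA]].
  by exists e => // y /(ball_near _ _ e0); apply: eA.
by apply/nbhs_ballP; exists e => // y /(ball_near _ _ e0); apply: eA.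
Qed.

Lemma normr_near e x y : 0 < e -> `|x - y| < e <-> near e x y.
Proof. by move=> e0; rewrite -ball_near // -ball_normE. Qed.

Lemma norm_rV_lt n (u : 'rV[R]_n) e : 0 < e -> (forall i, `|u 0 i| < e) -> `|u| < e.
Proof.
move=> e0 ue; suff : ball 0 e u by rewrite -ball_normE /= sub0r normrN.
by split=> // i j; rewrite ord1 -ball_normE /= !mxE sub0r normrN.
Qed.

Lemma compact_box (G : box R) : compact (box_set G).
Proof.
have -> : box_set G = [set v : pt | forall i, `[lo G 0 i, hi G 0 i]%classic (v 0 i)].
  by apply/seteqP; split=> x h i; have := h i; rewrite /= in_itv.
by apply: (@rV_compact R 3 (fun i => `[lo G 0 i, hi G 0 i]%classic)) => i; exact: segment_compact.
Qed.

(** Allowing [f x = x] lets a push act near one boundary point only. Since a point of Omega is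
    either fixed or sent into Omega, composing pushes never loses a point already inside. *)
Definition push (K Omega : set pt) e (f : pt -> pt) : Prop :=
  continuous f /\ forall x, K x -> near e x (f x) /\ (f x = x \/ Omega (f x)).

Lemma lipschitz_bound (g : 'rV[R]_2 -> R) : lipschitz g ->
  exists2 M, 0 <= M & forall u v : 'rV[R]_2, `|g u - g v| <= M * `|u - v|.
Proof.
move=> /pinfty_ex_gt0 [M M0 H]; exists M; first exact: ltW.
by move=> u v; exact: (H (u, v)).
Qed.


(** Near a boundary point Omega is a strict epigraph, so its closure lies in the closed epigraph;
    moving upwards by a positive amount then lands in Omega. A cutoff makes the motion continuous
    and supported near the boundary point. *)
Lemma local_push (Omega : set pt) x0 : open Omega -> lipschitz_boundary Omega ->
  closure Omega x0 ->
  exists2 r, 0 < r & forall e, 0 < e -> exists2 f, push (closure Omega) Omega e f &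
    forall x, closure Omega x -> near r x0 x -> Omega (f x).
Proof.
move=> oO lO cx0; have [Ox0|nOx0] := pselect (Omega x0).
  have /nbhs_near [r r0 rO] : nbhs x0 Omega by apply: open_nbhs_nbhs; split.
  exists r => // e e0; exists id; last by move=> x _ /rO.
  split; first by move=> x; exact: cvg_id.
  by move=> x Kx; split; [exact: near_refl|left].
have {lO} [|r [B [gamma [r0 BB lg rO]]]] := lO x0.
  by split=> // /interior_subset.
have [M M0 gM] := lipschitz_bound lg.
have r2 : 0 < r / 2 by rewrite divr_gt0.
exists (r / 2) => // e e0.
pose n : pt := delta_mx 0 ord_max *m B^T.
have nB : n *m B = delta_mx 0 ord_max.
  by rewrite /n -mulmxA (mulmx1C BB) mulmx1.
pose a x : R := r / 2 - `|x0 - x|.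
(* Twice the positive part of [a]: a continuous cutoff, positive exactly at distance less than r / 2
   from x0. *)
pose chi x : R := a x + `|a x|.
have chi_ge0 x : 0 <= chi x by rewrite /chi; have := ler_norm (- a x); rewrite normrN; lra.
have chi_gt0 x : 0 < a x -> 0 < chi x by move=> ax; rewrite /chi gtr0_norm // addr_gt0.
have chi_le x : 0 < a x -> chi x <= r.
  by move=> ax; rewrite /chi gtr0_norm // /a; have := normr_ge0 (x0 - x); lra.
have chi0 x : a x <= 0 -> chi x = 0 by move=> ax; rewrite /chi ler0_norm // subrr.
pose t := Num.min e (r / 2); have t0 : 0 < t by rewrite lt_min e0 r2.
have n0 : 0 < `|n| + 1 by rewrite ltr_pwDr.
(* As [chi] is at most r, the displacement is at most t |n| / (|n| + 1), which is below both e and r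
   / 2. *)
pose s := t / (r * (`|n| + 1)); have s0 : 0 < s by rewrite divr_gt0 // mulr_gt0.
pose f x : pt := x + (s * chi x) *: n.
have fd x : 0 < a x -> `|x - f x| < t.
  move=> ax; rewrite /f opprD addrA subrr add0r normrN normrZ ger0_norm; last first.
    by rewrite mulr_ge0 // ltW.
  apply: (@le_lt_trans _ _ (s * r * `|n|)).
    by rewrite ler_wpM2r // ler_wpM2l ?chi_le // ltW.
  rewrite /s -[X in _ < X]mulr1 -!mulrA ltr_pM2l // invfM !mulrA.
  have -> : r^-1 / (`|n| + 1) * r * `|n| = `|n| / (`|n| + 1).
    by field; rewrite !gt_eqF.
  rewrite ltr_pdivrMr // mul1r; lra.
have fid x : a x <= 0 -> f x = x by move=> ax; rewrite /f chi0 // mulr0 scale0r addr0.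
have fB x : f x *m B = x *m B + (s * chi x) *: delta_mx 0 ord_max.
  by rewrite /f mulmxDl -scalemxAl nB.
have fO x : closure Omega x -> 0 < a x -> Omega (f x).
  move=> Kx ax; have xr : `|x0 - x| < r / 2 by rewrite -subr_gt0.
  apply/(rO (f x)).
    apply/ball_near => //; apply/normr_near => //.
    have := fd x ax; have := ler_distD x x0 (f x); rewrite /t lt_min => h1 /andP [_ h2].
    lra.
  have -> : col' ord_max (f x *m B) = col' ord_max (x *m B).
    rewrite fB; move: (x *m B) (s * chi x) => y c; apply/rowP => j; rewrite !mxE eqxx /=.
    by rewrite eq_sym (negbTE (neq_lift _ _)) mulr0 addr0.
  have -> : (f x *m B) 0 ord_max = (x *m B) 0 ord_max + s * chi x.
    by rewrite fB; move: (x *m B) (s * chi x) => y c; rewrite !mxE !eqxx mulr1.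
  suff : gamma (col' ord_max (x *m B)) <= (x *m B) 0 ord_max.
    by move=> /le_lt_trans; apply; rewrite ltrDl mulr_gt0 // chi_gt0.
  rewrite leNgt; apply/negP => lt.
  pose y := x *m B; pose g := gamma (col' ord_max y) - y 0 ord_max.
  have g0 : 0 < g by rewrite subr_gt0.
  pose C := \sum_i \sum_j `|B i j| + 1.
  have C0 : 0 < C by rewrite ltr_pwDr // sumr_ge0 // => i _; rewrite sumr_ge0.
  (* Moving by less than d changes each coordinate in the frame by less than d C and gamma by at
     most M d C; the total is too small to close the gap g, so a point of Omega this close to x
     yields a contradiction. *)
  pose d := Num.min (r / 2) (g / (C * (M + 1))).
  have M1 : 0 < M + 1 by rewrite ltr_pwDr.
  have d0 : 0 < d by rewrite lt_min r2 divr_gt0 // mulr_gt0.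
  have : nbhs x [set x' | near d x x'] by apply/nbhs_near; exists d.
  move=> /Kx [x' [Ox' xx']].
  have dB j : `|(x *m B - x' *m B) 0 j| < d * C.
    rewrite -mulmxBl mxE; apply: (@le_lt_trans _ _ (\sum_i d * `|B i j|)).
      apply: le_trans (ler_norm_sum _ _ _) _; apply: ler_sum => i _.
      by rewrite normrM ler_wpM2r // !mxE ltW.
    rewrite -mulr_sumr ltr_pM2l // ltr_pwDr // exchange_big /=.
    by rewrite [leRHS](bigD1 j) //= lerDl sumr_ge0 // => k _; rewrite sumr_ge0.
  have dC : 0 < d * C by rewrite mulr_gt0.
  have h1 : `|gamma (col' ord_max y) - gamma (col' ord_max (x' *m B))| <= M * (d * C).
    apply: le_trans (gM _ _) _; rewrite ler_wpM2l // ltW //; apply: norm_rV_lt => // i.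
    by have := dB (lift ord_max i); rewrite !mxE.
  have h2 := dB ord_max.
  have h3 : d * C * (M + 1) <= g.
    by rewrite -mulrA -ler_pdivlMr ?mulr_gt0 // /d ge_min lexx orbT.
  have xr' : ball x0 r x'.
    apply/ball_near => //; apply/normr_near => //.
    have /normr_near -/(_ d0) := xx' => h5.
    have := ler_distD x x0 x'; have : d <= r / 2 by rewrite ge_min lexx.
    lra.
  have := (rO x' xr').1 Ox'.
  have E (u w : pt) : (u - w) 0 ord_max = u 0 ord_max - w 0 ord_max by rewrite !mxE.
  move: h1 h2 h3; rewrite -/y E ler_norml ltr_norml /g.
  move: (y 0 _) ((x' *m B) 0 _) (gamma _) (gamma _) => u1 u2 u3 u4.
  move=> /andP [h1 h1'] /andP [h2 h2'] h3 h4; nra.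
exists f; last first.
  by move=> x Kx /normr_near -/(_ r2) xr; apply: fO => //; rewrite subr_gt0.
split.
  have cchi x : {for x, continuous chi}.
    have ca : {for x, continuous a}.
      apply: (@continuousB _ _ _ (fun=> r / 2) (fun y => `|x0 - y|)).
        exact: cst_continuous.
      apply: (@continuous_comp _ _ _ (fun y => x0 - y) Num.norm); last exact: norm_continuous.
      by apply: (@continuousB _ _ _ (fun=> x0) id); [exact: cst_continuous|exact: cvg_id].
    apply: (@continuousD _ _ _ a (fun y => `|a y|)) => //.
    by apply: (@continuous_comp _ _ _ a Num.norm) => //; exact: norm_continuous.
  move=> x; apply: (@continuousD _ _ _ id (fun y => (s * chi y) *: n)); first exact: cvg_id.
  apply: continuousZr_tmp.
  by apply: (@continuousM _ _ (fun=> s) chi); [exact: cst_continuous|exact: cchi].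
move=> x Kx; have [ax|ax] := ltP 0 (a x).
  split; last by right; apply: fO.
  have := fd x ax; rewrite lt_min => /andP [h _]; exact/normr_near.
by rewrite fid //; split; [exact: near_refl|left].
Qed.

(** If the first push moves x it is already in Omega and stays there; if it fixes x, the pushes of
    the tail still apply to x itself. Half of the allowed displacement is left for the tail. *)
Lemma push_seq (Omega : set pt) (r : pt -> R) (s : seq pt) :
  (forall x0, x0 \in s -> forall e, 0 < e -> exists2 f, push (closure Omega) Omega e f &
    forall x, closure Omega x -> near (r x0) x0 x -> Omega (f x)) ->
  forall e, 0 < e -> exists2 f, push (closure Omega) Omega e f &
    forall x x0, closure Omega x -> x0 \in s -> near (r x0) x0 x -> Omega (f x).
Proof.
elim: s => [|x0 s IH] H e e0.
  exists id => //; split=> [x|x Kx]; first exact: cvg_id.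
  by split; [exact: near_refl|left].
have e2 : 0 < e / 2 by rewrite divr_gt0.
have [f1 [c1 p1] o1] := H x0 (mem_head _ _) _ e2.
have [|f2 [c2 p2] o2] := IH _ _ e2.
  by move=> x1 x1s; apply: H; rewrite inE x1s orbT.
have fK x : closure Omega x -> closure Omega (f1 x).
  by move=> Kx; have [_ [->|/subset_closure]] := p1 x Kx.
have stay x : closure Omega x -> Omega (f1 x) -> Omega (f2 (f1 x)).
  by move=> Kx O1; have [_ [->|]] := p2 _ (fK _ Kx).
exists (f2 \o f1) => /=.
  split=> [x|x Kx]; first by apply: continuous_comp; [exact: c1|exact: c2].
  have [n1 h1] := p1 x Kx; have [n2 h2] := p2 _ (fK _ Kx); split=> /=.
    by apply: near_le (near_trans n1 n2); lra.
  case: h1 => [E|O1]; last by right; exact: stay.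
  by rewrite E in h2 *.
move=> x x1 Kx; rewrite inE => /orP [/eqP ->|x1s] nx; first by apply: stay => //; exact: o1.
have [_ [E|]] := p1 x Kx; last exact: stay.
by rewrite E; apply: o2 nx.
Qed.

Lemma global_push (Omega : set pt) : compact (closure Omega) -> open Omega ->
  lipschitz_boundary Omega -> forall e, 0 < e ->
  exists f : pt -> pt, [/\ continuous f,
    forall x, closure Omega x -> near e x (f x) &
    forall x, closure Omega x -> Omega (f x)].
Proof.
move=> cK oO lO e e0.
have /choice [r rP] : forall x0, exists r, closure Omega x0 -> 0 < r /\
    forall e, 0 < e -> exists2 f, push (closure Omega) Omega e f &
    forall x, closure Omega x -> near r x0 x -> Omega (f x).
  move=> x0; have [Kx|nK] := pselect (closure Omega x0); last by exists 0.
  by have [r r0 rP] := local_push oO lO Kx; exists r.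
move: cK; rewrite compact_cover => /(_ pt (closure Omega) (fun x => interior (ball x (r x)))).
case.
- by move=> x _; exact: open_interior.
- move=> x Kx; exists x => //; have [r0 _] := rP x Kx.
  by apply: nbhsx_ballx.
move=> D DK cov.
have [x0 x0D|f [cf pf] fO] := @push_seq Omega r (finmap.enum_fset D) _ _ e0.
  by have := DK x0 x0D; rewrite inE => /rP [].
exists f; split=> // x Kx; first by case: (pf x Kx).
have [x0 /= x0D /interior_subset bx] := cov x Kx.
have := DK x0 x0D; rewrite inE => /rP [r0 _].
by apply: (fO x x0) => //; apply/ball_near.
Qed.

(** H is continuous only over Omega, which is not compact. Composing with a map f that sends the
    compact K into Omega moves the question to the compact product of [0, 1] and K. *)
Lemma uniform_homotopy (K Omega : set pt) (H : R * pt -> pt) (f : pt -> pt) e :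
  compact K -> {within `[0, 1] `*` Omega, continuous H} -> continuous f ->
  (forall x, K x -> Omega (f x)) -> 0 < e ->
  exists2 d, 0 < d & forall t t' x x', 0 <= t <= 1 -> 0 <= t' <= 1 -> K x -> K x' ->
    `|t - t'| < d -> near d x x' -> near e (H (t, f x)) (H (t', f x')).
Proof.
move=> cK cH cf fO e0.
have e2 : 0 < e / 2 by rewrite divr_gt0.
have loc t x : 0 <= t <= 1 -> K x -> exists2 d, 0 < d & forall t' x', 0 <= t' <= 1 ->
    K x' -> `|t - t'| < d -> near d x x' -> near (e / 2) (H (t, f x)) (H (t', f x')).
  move=> t01 Kx.
  have inO : (`[0, 1] `*` Omega) (t, f x) by split; [rewrite /= in_itv|exact: fO].
  have /subspace_continuousP /(_ _ inO) := cH.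
  move=> /(_ [set y | near (e / 2) (H (t, f x)) y]).
  have /[swap] /[apply] : nbhs (H (t, f x)) [set y | near (e / 2) (H (t, f x)) y].
    by apply/nbhs_near; exists (e / 2).
  rewrite /= /within /= => -[[A B] /= [At Bx] AB].
  have /nbhs_near [d1 d10 d1P] : nbhs x (f @^-1` B) by exact: (cf x).
  have /nbhs_ballP [d2 d20 d2P] := At.
  exists (Num.min d1 d2); first by rewrite lt_min d10 d20.
  move=> t' x' t01' Kx' tt xx; apply: (AB (t', f x')) => /=; last first.
    by split; [rewrite /= in_itv|exact: fO].
  split.
    by apply: d2P; rewrite -ball_normE /=; apply: lt_le_trans tt _; rewrite ge_min lexx orbT.
  by apply: d1P; apply: near_le xx; rewrite ge_min lexx.
have cIK : compact ([set` `[(0 : R), 1]] `*` K) by apply: compact_setX => //; exact: segment_compact.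
have /compact_near_coveringP := cIK.
move=> /(_ R 0^'+ (fun d p => forall t' x', ([set` `[(0 : R), 1]] `*` K) p -> 0 <= t' <= 1 ->
   K x' -> `|p.1 - t'| < d -> near d p.2 x' -> near e (H (p.1, f p.2)) (H (t', f x')))).
case.
  move=> [t x] [/= + Kx]; rewrite in_itv /= => t01.
  have [d d0 dP] := loc t x t01 Kx.
  exists (ball t (d / 2) `*` ball x (d / 2), [set d' | d' < d / 2]) => /=.
    split; last by apply: nbhs_right_lt; rewrite divr_gt0.
    by exists (ball t (d / 2), ball x (d / 2)) => //=; split; apply: nbhsx_ballx; rewrite divr_gt0.
  move=> [[t1 x1] d'] [/= [tt xx] d'd] t' x' [/= + Kx1] t01' Kx' t1t' x1x'.
  rewrite in_itv /= => t101.
  move: tt xx; rewrite -ball_normE /= => tt /ball_near; rewrite divr_gt0 // => /(_ isT) xx.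
  have -> : e = e / 2 + e / 2 by lra.
  apply: (@near_trans _ _ _ _ (H (t, f x))).
    apply/near_sym/dP => //; first by lra.
    by apply: near_le xx; lra.
  apply: dP => //.
    have := ler_distD t1 t t'; lra.
  by apply: near_le (near_trans xx x1x'); lra.
move=> d /= d0 dP.
have d20 : 0 < d / 2 by rewrite divr_gt0.
exists (d / 2) => // t t' x x' t01 t01' Kx Kx' tt xx.
have dd : ball_ Num.norm 0 d (d / 2) by rewrite /= sub0r normrN gtr0_norm //; lra.
by apply: (dP _ dd d20 (t, x)) => //; split=> //=; rewrite in_itv.
Qed.


Lemma min1_dist (a b : R) : 0 <= b -> `|Num.min a 1 - Num.min (a + b) 1| <= b.
Proof.
move=> b0; rewrite ler_norml !minEle.
by case: (leP a 1) => ?; case: (leP (a + b) 1) => ?; apply/andP; split; lra.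
Qed.

Lemma finite_positive (I : finType) (P : I -> R -> Prop) :
  (forall i e e', 0 < e' <= e -> P i e -> P i e') ->
  (forall i, exists2 e, 0 < e & P i e) -> exists2 e, 0 < e & forall i, P i e.
Proof.
move=> mono ex; suff [e e0 eP] : exists2 e, 0 < e & forall i, i \in enum I -> P i e.
  by exists e => // i; apply: eP; rewrite mem_enum.
elim: (enum I) => [|i s [e e0 IH]]; first by exists 1.
have [e' e0' e'P] := ex i.
exists (Num.min e e'); first by rewrite lt_min e0.
move=> j; rewrite inE => /orP [/eqP ->|/IH].
  by apply: mono e'P; rewrite lt_min e0 e0' ge_min lexx orbT.
by apply: mono; rewrite lt_min e0 e0' ge_min lexx.
Qed.

Section Mesh.
Variables (Omega : set pt) (N : nat) (T : 'I_N -> box R).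
Hypothesis hT : cuboid_mesh Omega T.

Lemma mesh_le c i : lo (T c) 0 i <= hi (T c) 0 i.
Proof. by case: hT => h _ _ _; rewrite ltW. Qed.

Lemma in_meshE x : closure Omega x <-> in_mesh T x.
Proof.
case: hT => _ -> _ _; split=> [[c _ cx]|[c cx]]; by exists c.
Qed.

Lemma touchP a b : (forall i, lo (T a) 0 i <= hi (T b) 0 i /\ lo (T b) 0 i <= hi (T a) 0 i) ->
  touch T a b.
Proof.
move=> H; exists (\row_i Num.max (lo (T a) 0 i) (lo (T b) 0 i)).
split=> i; rewrite mxE le_max ge_max lexx ?orbT /=; have [h1 h2] := H i;
  by rewrite ?h1 ?h2 ?mesh_le.
Qed.

(** Two cells that do not touch are separated by a gap in some coordinate, and there are finitely
    many pairs. *)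
Lemma touch_near : exists2 e, 0 < e &
  forall a b x y, box_set (T a) x -> box_set (T b) y -> near e x y -> touch T a b.
Proof.
have [e e0 eP] : exists2 e, 0 < e & forall p : 'I_N * 'I_N,
    forall x y, box_set (T p.1) x -> box_set (T p.2) y -> near e x y -> touch T p.1 p.2.
  apply: finite_positive => [p e e' /andP [_ le] H x y ax bx /near_le xy|[a b] /=].
    by apply: (H x y) => //; apply: xy.
  have [H|/existsNP [i H]] := pselect (forall i, lo (T a) 0 i <= hi (T b) 0 i /\
      lo (T b) 0 i <= hi (T a) 0 i).
    by exists 1 => // x y _ _ _; apply: touchP.
  have [h|h] : hi (T b) 0 i < lo (T a) 0 i \/ hi (T a) 0 i < lo (T b) 0 i.
    rewrite !ltNge; case: (boolP (_ <= _)) => h1 /=; last by left.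
    by right; apply/negP => h2; apply: H.
  - exists (lo (T a) 0 i - hi (T b) 0 i); first by rewrite subr_gt0.
    move=> x y /(_ i) /andP [h1 _] /(_ i) /andP [_ h2] /(_ i).
    by rewrite ltr_norml => /andP [_ h3]; exfalso; lra.
  - exists (lo (T b) 0 i - hi (T a) 0 i); first by rewrite subr_gt0.
    move=> x y /(_ i) /andP [_ h1] /(_ i) /andP [h2 _] /(_ i).
    by rewrite ltr_norml => /andP [h3 _]; exfalso; lra.
by exists e => // a b x y ax bx xy; apply: (eP (a, b) x y).
Qed.

Lemma closure_compact : compact (closure Omega).
Proof.
case: hT => _ -> _ _.
have -> : \bigcup_c box_set (T c) = \big[setU/set0]_(c <- enum 'I_N) box_set (T c).
  rewrite -bigcup_seq; congr bigcup; apply/seteqP; split=> c //= _.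
  by rewrite mem_enum.
by apply: bigsetU_compact => c _; exact: compact_box.
Qed.

Lemma mesh_contraction : contractible_lipschitz_domain Omega ->
  exists e M g c0, 0 < e /\ cell_homotopy T e M g c0.
Proof.
move=> [oO _ [x0 [H [Ox0 cH HO H0 H1]]] lO].
have [e e0 eT] := touch_near.
have e2 : 0 < e / 2 by rewrite divr_gt0.
have [f [cf fe fO]] := global_push closure_compact oO lO e2.
have [d d0 dP] := uniform_homotopy closure_compact cH cf fO e0.
have KO x : Omega x -> in_mesh T x by move=> /subset_closure /in_meshE.
have [c1 _] := KO _ Ox0.
have /choice [rho rhoP] : forall x, exists c, in_mesh T x -> box_set (T c) x.
  move=> x; have [[c cx]|nx] := pselect (in_mesh T x); first by exists c.
  by exists c1.
pose n := (Num.bound d^-1).+1.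
have n0 : 0 < n%:R :> R by rewrite ltr0n.
have nd : n%:R^-1 < d.
  rewrite invf_plt //; apply: lt_trans (archi_boundP _) _; first by rewrite invr_ge0 ltW.
  by rewrite ltr_nat.
pose t m : R := Num.min (m%:R / n%:R) 1.
have t01 m : 0 <= t m <= 1.
  by rewrite le_min divr_ge0 // ler01 ge_min lexx orbT.
have tS m : `|t m - t m.+1| < d.
  apply: le_lt_trans nd; rewrite /t -natr1 mulrDl mul1r.
  by apply: min1_dist; rewrite invr_ge0 ltW.
(* At time 0 the cell must contain x itself, so neither f nor H is applied; the next time already
   uses f x, and the shift by one absorbs this jump. *)
pose g m x : 'I_N := if m is m'.+1 then rho (H (t m', f x)) else rho x.
have Hmesh m x : in_mesh T x -> in_mesh T (H (t m, f x)).
  by move=> /in_meshE Kx; apply/KO/HO/fO.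
have rT x y : in_mesh T x -> in_mesh T y -> near e x y -> touch T (rho x) (rho y).
  by move=> Kx Ky; apply: eT; apply: rhoP.
(* The bound d controls the homotopy in space and time. The other bound e / 2 adds to the
   displacement e / 2 of f in the first step, so that the two points stay within the distance e at
   which cells touch. *)
exists (Num.min d (e / 2)), n.+1, g, (rho x0); split; first by rewrite lt_min d0.
have dd r x y : near (Num.min d (e / 2)) x y -> near d x y by apply: near_le; rewrite ge_min lexx.
have de x y : near (Num.min d (e / 2)) x y -> near (e / 2) x y.
  by apply: near_le; rewrite ge_min lexx orbT.
split=> [x Kx|m x y Kx Ky xy|m x y Kx Ky xy|x Kx].
- exact: rhoP.
- case: m => [|m] /=; apply: rT; [done|done| |exact: Hmesh|exact: Hmesh|].
    by apply: near_le (de _ _ xy); lra.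
  apply: dP => //; [exact/in_meshE|exact/in_meshE|by rewrite subrr normr0|exact: dd].
- case: m => [|m] /=; apply: rT; [done|exact: Hmesh| |exact: Hmesh|exact: Hmesh|].
    have t0 : t 0%N = 0 by rewrite /t mul0r minEle ler01.
    have Ky' : closure Omega y by apply/in_meshE.
    rewrite t0 H0; last exact: fO.
    have -> : e = e / 2 + e / 2 by lra.
    by apply: near_trans (de _ _ xy) _; exact: fe.
  apply: dP => //; [exact/in_meshE|exact/in_meshE|exact: dd].
- have tn : t n = 1 by rewrite /t divff ?gt_eqF // minEle lexx.
  by rewrite /= tn H1 //; apply/fO/in_meshE.
Qed.

End Mesh.
End Contraction.

(** * Hermite extension *)

Section Extension.
Variable R : realType.
Notation pol := (mpoly 3 R).
Notation pt := 'rV[R]_3.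
Implicit Types (p q f g u w : pol) (i j l d e : 'I_3) (G T : box R) (x y v : pt) (a b : R).

Definition jet0 f x : Prop := forall m, peval (jet m f) x = 0.

Lemma jetD m f g : jet m (f + g) = jet m f + jet m g.
Proof. by rewrite /jet; case: (m 0); case: (m 1); case: (m 2); rewrite //= !mderivD. Qed.
Lemma jetN m f : jet m (- f) = - jet m f.
Proof. by rewrite /jet; case: (m 0); case: (m 1); case: (m 2); rewrite //= !mderivN. Qed.
Lemma jetB m f g : jet m (f - g) = jet m f - jet m g.
Proof. by rewrite jetD jetN. Qed.

Lemma jet0D f g x : jet0 f x -> jet0 g x -> jet0 (f + g) x.
Proof. by move=> hf hg m; rewrite jetD pevalD hf hg addr0. Qed.
Lemma jet0N f x : jet0 f x -> jet0 (- f) x.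
Proof. by move=> hf m; rewrite jetN pevalN hf oppr0. Qed.
Lemma jet0B f g x : jet0 f x -> jet0 g x -> jet0 (f - g) x.
Proof. by move=> hf hg; apply: jet0D => //; apply: jet0N. Qed.

Lemma jet_off m d f : jet m f =
  jet (fun e => (e != d) && m e) (iter (m d) (mderiv d) f).
Proof.
move: d; elim/ord3P; rewrite /jet /=; case: (m 0); case: (m 1); case: (m 2) => //=;
  by rewrite ?(mderiv_comm 0 2) ?(mderiv_comm 0 1) ?(mderiv_comm 1 2).
Qed.

Lemma jet_esub m d a h f : m d = false -> (forall e, e != d -> mderiv e h = 0) ->
  jet m (h * esub d a f) = h * esub d a (jet m f).
Proof.
move=> md hh.
have M e q : e != d -> mderiv e (h * esub d a q) = h * esub d a (mderiv e q).
  by move=> ed; rewrite mderivM hh // mul0r add0r esub_mderiv // eq_sym.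
by move: d md hh M; elim/ord3P => md hh M; rewrite /jet md /=;
  case: (m 0); case: (m 1); case: (m 2) => //=; rewrite ?M.
Qed.

Definition affine d a b : pol := (a - b)^-1 *: (mpolyX R (mnm1 d) - mpolyC 3 b).
(** With t the affine function equal to 1 on x_d = a and 0 on x_d = b, this and [hermite1] are the
    cubic Hermite basis functions at a: value and slope (1, 0) and (0, 1) there, and (0, 0) at b. *)
Definition hermite0 d a b : pol := affine d a b ^+ 2 * (3%:R - 2%:R * affine d a b).
Definition hermite1 d a b : pol := (a - b) *: (affine d a b ^+ 2 * (affine d a b - 1)).

(* Cubic Hermite extension of the 1-jet on x_d = a, with zero 1-jet on x_d = b. *)
Definition extend d a b f : pol :=
  hermite0 d a b * esub d a f + hermite1 d a b * esub d a (mderiv d f).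

Lemma affine_mderiv d e a b :
  mderiv e (affine d a b) = (a - b)^-1 *: mpolyC 3 (e == d)%:R.
Proof. by rewrite mderivZ mderiv_linear. Qed.

Lemma affine_at d a b x : a != b ->
  (x 0 d = a -> peval (affine d a b) x = 1) /\ (x 0 d = b -> peval (affine d a b) x = 0).
Proof.
move=> ab; rewrite /affine /peval mevalZ -/(peval _ x) !pevalE.
split=> ->; last by rewrite subrr mulr0.
by rewrite mulVf // subr_eq0.
Qed.

Lemma hermite_other d e a b : e != d ->
  mderiv e (hermite0 d a b) = 0 /\ mderiv e (hermite1 d a b) = 0.
Proof.
move=> ed; have tE : mderiv e (affine d a b) = 0.
  by rewrite affine_mderiv (negbTE ed) mpolyC0 scaler0.
have n0 n : mderiv e (n%:R : pol) = 0 by rewrite -mpolyC_nat mderivC.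
rewrite /hermite0 /hermite1 mderivZ !expr2.
rewrite !(mderivM, mderivB) !tE !n0 (n0 1%N) !(mul0r, mulr0, subr0, addr0); split=> //.
by rewrite scaler0.
Qed.

Lemma hermite_at d a b x : a != b -> x 0 d = a ->
  [/\ peval (hermite0 d a b) x = 1, peval (mderiv d (hermite0 d a b)) x = 0,
      peval (hermite1 d a b) x = 0 & peval (mderiv d (hermite1 d a b)) x = 1].
Proof.
move=> ab /(affine_at d x ab).1 t1.
have t' : peval (mderiv d (affine d a b)) x = (a - b)^-1.
  by rewrite affine_mderiv eqxx /peval mevalZ mevalC mulr1.
have n0 n : mderiv d (n%:R : pol) = 0 by rewrite -mpolyC_nat mderivC.
rewrite /hermite0 /hermite1 mderivZ /peval !mevalZ -!/(peval _ x) !expr2.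
rewrite !(mderivM, mderivB) !n0 (n0 1%N) !pevalE !t1 !t'.
have : a - b != 0 by rewrite subr_eq0.
by move=> ab0; split; rewrite ?mulr2n ?mulrS; field.
Qed.

Lemma hermite_far d a b x : a != b -> x 0 d = b ->
  [/\ peval (hermite0 d a b) x = 0, peval (mderiv d (hermite0 d a b)) x = 0,
      peval (hermite1 d a b) x = 0 & peval (mderiv d (hermite1 d a b)) x = 0].
Proof.
move=> ab /(affine_at d x ab).2 t0.
rewrite /hermite0 /hermite1 mderivZ /peval !mevalZ -!/(peval _ x) !expr2.
by rewrite !(mderivM, mderivB) !pevalE !t0; split; ring.
Qed.

(** Each summand of [extend] is a function of x_d alone times one independent of x_d, so a mixed
    derivative splits between the two factors. *)
Lemma jet_extend m d a b f x : peval (jet m (extend d a b f)) x =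
  peval (iter (m d) (mderiv d) (hermite0 d a b)) x
    * peval (jet (fun e => (e != d) && m e) f) (upd x d a) +
  peval (iter (m d) (mderiv d) (hermite1 d a b)) x
    * peval (jet (fun e => (e == d) || m e) f) (upd x d a).
Proof.
rewrite (jet_off m d); set m0 := fun e => _.
have m0d : m0 d = false by rewrite /m0 eqxx.
have -> : jet (fun e => (e == d) || m e) f = jet m0 (mderiv d f).
  rewrite (jet_off _ d) eqxx /= /jet /m0.
  by do 3![congr iter; first by case: (_ == d)].
have H h : (forall e, e != d -> mderiv e h = 0) -> forall e, e != d ->
    mderiv e (iter (m d) (mderiv d) h) = 0.
  move=> hh e ed; case: (m d) => /=; last exact: hh.
  by rewrite mderiv_comm hh // mderiv0.
have -> : iter (m d) (mderiv d) (extend d a b f) =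
    iter (m d) (mderiv d) (hermite0 d a b) * esub d a f +
    iter (m d) (mderiv d) (hermite1 d a b) * esub d a (mderiv d f).
  by case: (m d) => //=; rewrite mderivD !mderivM !mderiv_esub !mulr0 !addr0.
rewrite jetD !jet_esub //; last first.
- by apply: H => e ed; case: (hermite_other a b ed).
- by apply: H => e ed; case: (hermite_other a b ed).
by rewrite !pevalE !peval_esub.
Qed.

Lemma extend_near d a b f x : jet0 f (upd x d a) -> jet0 (extend d a b f) x.
Proof. by move=> f0 m; rewrite jet_extend !f0 !mulr0 addr0. Qed.

Lemma extend_far d a b f x : a != b -> x 0 d = b -> jet0 (extend d a b f) x.
Proof.
move=> ab xb m; rewrite jet_extend; have [h1 h2 h3 h4] := hermite_far ab xb.
by case: (m d); rewrite /= ?h1 ?h2 ?h3 ?h4 !mul0r addr0.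
Qed.

Lemma extend_same d a b f m x : a != b -> x 0 d = a ->
  peval (jet m (extend d a b f)) x = peval (jet m f) x.
Proof.
move=> ab xa; rewrite jet_extend upd_idE //; have [h1 h2 h3 h4] := hermite_at ab xa.
case md: (m d); rewrite /= ?h1 ?h2 ?h3 ?h4 !mul0r !mul1r ?add0r ?addr0; congr (peval _ _);
  rewrite /jet; do 3?[congr iter]; by [case: eqVneq => // ->; rewrite md|case: eqVneq => //= ->; rewrite md].
Qed.

Lemma extend_deg k d a b f : (3 <= k)%N -> U_deg k f -> U_deg k (extend d a b f).
Proof.
move=> k3 fk e; have k0 : (3 : int) <= k%:Z by lia.
have c1 n : degle e 0 (n%:R : pol) by rewrite -mpolyC_nat; exact: degleC.
have cZ (c : int) z (p : pol) : degle e c p -> degle e c (z *: p).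
  by move=> pc m' /msuppZ_le; apply: pc.
have cb (n : bool) : (0 : int) <= n by case: n.
have ta : degle e (e == d)%:Z (affine d a b).
  apply/cZ/degleB; [exact: degleX|by apply: degle_le (@degleC R e b)].
have h0 : degle e (3 * (e == d)%:Z) (hermite0 d a b).
  rewrite (_ : 3 * _ = (e == d)%:Z + (e == d)%:Z + (0 + (e == d)%:Z)); last by lia.
  rewrite /hermite0 expr2; apply: degleM; first exact: degleM.
  apply: degleB; first by apply: degle_le (c1 _); rewrite add0r.
  exact: degleM.
have h1 : degle e (3 * (e == d)%:Z) (hermite1 d a b).
  rewrite (_ : 3 * _ = (e == d)%:Z + (e == d)%:Z + (e == d)%:Z); last by lia.
  rewrite /hermite1 expr2; apply/cZ/degleM; first exact: degleM.
  by apply: degleB => //; apply: degle_le (c1 1%N).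
(* After substitution nothing depends on x_d, which leaves room for the cubic factor exactly because
   k is at least 3. *)
have E q : degle e k%:Z q -> degle e (k%:Z - 3 * (e == d)%:Z) (esub d a q).
  case: eqVneq => [->|ed] qk; last by rewrite mulr0 subr0; apply: degle_esub => //; right.
  rewrite /= mulr1 => m' /msupp_mono_map [m'' _ ->]; rewrite mnmE eqxx; lia.
rewrite /extend (_ : k%:Z = 3 * (e == d)%:Z + (k%:Z - 3 * (e == d)%:Z)); last by lia.
apply: degleD; apply: degleM => //; apply: E => //; exact: degle_mderiv.
Qed.

(** Where a subentity G of T is degenerate it sits at one end of T; this is the opposite end, at
    which the extension is made to vanish. *)
Definition far T G d : R := if lo G 0 d == lo T 0 d then hi T 0 d else lo T 0 d.

Definition extend_step T G d f := if par G d then f else extend d (lo G 0 d) (far T G d) f.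

Definition extend_box T G f := extend_step T G 0 (extend_step T G 1 (extend_step T G 2 f)).

Lemma extend_box_deg k T G f : (3 <= k)%N -> U_deg k f -> U_deg k (extend_box T G f).
Proof.
move=> k3 fk; have S d g : U_deg k g -> U_deg k (extend_step T G d g).
  by rewrite /extend_step; case: par => //; exact: extend_deg.
exact/S/S/S.
Qed.

Section Box.
Variables T G : box R.
Hypothesis Tlt : forall i, lo T 0 i < hi T 0 i.
Hypothesis sG : subentity T G.

Let farP d : lo G 0 d != far T G d.
Proof.
by rewrite /far; case: (eqVneq (lo G 0 d) (lo T 0 d)) => // ->; rewrite lt_eqF.
Qed.

Lemma extend_box_same f m x : box_set G x ->
  peval (jet m (extend_box T G f)) x = peval (jet m f) x.
Proof.
move=> Gx; have S d g : peval (jet m (extend_step T G d g)) x = peval (jet m g) x.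
  rewrite /extend_step; case: (boolP (par G d)) => // nG; apply: extend_same => //.
  have /andP [h1 h2] := Gx d; apply/eqP; rewrite eq_le h1 andbT.
  by apply: le_trans h2 _; rewrite leNgt.
by rewrite !S.
Qed.

Definition onto d (x : pt) : pt := if par G d then x else upd x d (lo G 0 d).

Lemma onto_other d e x : e != d -> onto d x 0 e = x 0 e.
Proof. by rewrite /onto => ed; case: par => //; rewrite upd_other. Qed.

Lemma extend_box_zero f (x : pt) :
  ((forall d, ~~ par G d -> x 0 d != far T G d) -> jet0 f (onto 2 (onto 1 (onto 0 x)))) ->
  jet0 (extend_box T G f) x.
Proof.
move=> H.
have S d g y : ((~~ par G d -> y 0 d != far T G d) -> jet0 g (onto d y)) ->
    jet0 (extend_step T G d g) y.
  rewrite /extend_step /onto; case: par => /= h; first by apply: h.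
  have [yf|yf] := eqVneq (y 0 d) (far T G d); first exact: extend_far.
  by apply: extend_near; apply: h.
apply: (S 0) => h0; apply: (S 1) => h1; apply: (S 2) => h2; apply: H.
by elim/ord3P => // nd; [move: (h1 nd)|move: (h2 nd)]; rewrite !onto_other.
Qed.

End Box.

(* The data are added one at a time: what is missing on a new subentity vanishes
   on the previous ones, and so does its Hermite extension. *)
Lemma extend_family k T (I : eqType) (s : seq I) (G : I -> box R) (f : I -> pol) :
  (3 <= k)%N -> (forall i, lo T 0 i < hi T 0 i) ->
  (forall i : I, i \in s -> subentity T (G i) /\ U_deg k (f i)) ->
  (forall (i j : I) x, i \in s -> j \in s -> box_set (G i) x -> box_set (G j) x -> jet0 (f i - f j) x) ->
  exists2 u, U_deg k u & forall (i : I) x, i \in s -> box_set (G i) x -> jet0 (u - f i) x.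
Proof.
move=> k3 Tlt; elim: s => [|i s IH] sG fG; first by exists 0 => // d; exact: degle0.
have [||u uk us] := IH.
- by move=> j js; apply: sG; rewrite inE js orbT.
- by move=> j l x js ls; apply: fG; rewrite inE ?js ?ls orbT.
have [sGi fi] := sG i (mem_head _ _).
exists (u + extend_box T (G i) (f i - u)).
  have H : U_deg k (f i - u) by move=> e; apply: degleB.
  by move=> d; apply: degleD => //; exact: (@extend_box_deg k T (G i) _ k3 H d).
move=> j x; rewrite inE => /orP [/eqP ->|js] Gx.
  move=> m; rewrite addrAC jetD jetB pevalD pevalB (extend_box_same Tlt) //.
  by rewrite jetB pevalB; ring.
rewrite addrAC; apply: jet0D; first exact: us.
have [|sGj _] := sG j; first by rewrite inE js orbT.
apply: (extend_box_zero Tlt) => nf; set y := onto _ _ _.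
have yE d : y 0 d = if par (G i) d then x 0 d else lo (G i) 0 d.
  by move: d; elim/ord3P; rewrite /y /onto; case: (par (G i) 0); case: (par (G i) 1);
    case: (par (G i) 2); rewrite ?mxE.
(* The point y is the projection of x to [G i]. In a direction where [G i] is degenerate, [G j]
   cannot be the opposite end alone, because x lies in [G j] and avoids that end; so [G j] contains
   the end carrying [G i]. *)
have Gjy : box_set (G j) y.
  move=> d; rewrite yE; case: (boolP (par (G i) d)) => [_|nd]; first exact: Gx.
  move: (nf d nd) (Gx d) (sGi d) (sGj d) (nd) (Tlt d); rewrite /far /par.
  have pt (c z : R) : c <= z <= c -> z = c by move=> h; apply/eqP; rewrite eq_le andbC.
  move=> xf xj si sj {}nd lt; move: xf xj nd.
  case: si => -[-> ->]; case: sj => -[-> ->]; rewrite ?eqxx ?(gt_eqF lt) ?ltxx ?lexx ?(ltW lt) ?lt //;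
    by move=> /eqP xf /pt.
have Giy : box_set (G i) y.
  move=> d; rewrite yE; case: (boolP (par (G i) d)) => nd; last first.
    rewrite lexx /=; case: (sGi d) => -[-> ->] //; exact: ltW.
  have [-> ->] := subentity_par sGi nd.
  by apply: (subentity_set _ sGj) => // e; exact: ltW.
rewrite -[f i - u]opprK; apply: jet0N; rewrite opprB.
rewrite -(subrK (f j) u) -addrA; apply: jet0D; first exact: us.
by apply: fG => //; rewrite ?mem_head // inE js orbT.
Qed.
End Extension.

(** * Degrees of freedom and traces *)

Section Moments.
Variable R : realType.
Notation pol := (mpoly 3 R).
Notation pt := 'rV[R]_3.
Implicit Types (p q f g u w : pol) (i j l d e : 'I_3) (G : box R) (x y v : pt) (a b : R) (P : {poly R}).

(** The integral in x_i from a to b as a polynomial in the other variables. Moments become algebra,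
    and Lebesgue integrals enter only through [int1_line]. *)
Definition lint i a b f : pol := esub i b (pint i a f).

Lemma lintB i a b f g : lint i a b (f - g) = lint i a b f - lint i a b g.
Proof. by rewrite /lint pintD pintN esubD esubN. Qed.

Lemma lint_mderiv i j a b f : i != j -> mderiv j (lint i a b f) = lint i a b (mderiv j f).
Proof. by move=> ij; rewrite /lint esub_mderiv // pint_mderiv. Qed.

Lemma lint_mul i a b f g : mderiv i g = 0 -> lint i a b (f * g) = lint i a b f * g.
Proof.
move=> g0; have gE c : esub i c g = g.
  apply: (@eq_mderiv_sub _ i c); first by rewrite mderiv_esub.
  by move=> x xc; rewrite peval_esub upd_idE.
rewrite /lint; have -> : pint i a (f * g) = pint i a f * g.
  apply: (@eq_mderiv_sub _ i a); first by rewrite mderivM g0 mulr0 addr0 !mderiv_pint.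
  by move=> x xa; rewrite pevalM !peval_pint // mul0r.
by apply: peval_inj => x; rewrite /lint peval_esub !(pevalM, peval_esub) -(peval_esub i b g) gE.
Qed.

Lemma lint_zero i a b f x : (forall t, peval f (upd x i t) = 0) -> peval (lint i a b f) x = 0.
Proof.
move=> f0; rewrite /lint peval_esub (@const_seg _ i _ x 0 1 ltr01 _ _ a).
  by rewrite peval_pint // upd_same.
by move=> t _; rewrite mderiv_pint.
Qed.

Lemma int1_line i a b f x : a < b ->
  int1 a b (fun t => peval f (upd x i t)) = peval (lint i a b f) x.
Proof.
move=> ab; rewrite /int1 lt_eqF // /Rintegral.
under eq_integral do rewrite -slice_horner.
rewrite (@continuous_FTC2 _ _ (horner (slice i x (pint i a f)))) //.
- rewrite -EFinB /= !slice_horner /lint peval_esub.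
  by rewrite [X in _ - X]peval_pint ?upd_same // subr0.
- by apply: continuous_subspaceT; exact: continuous_horner.
- split=> [t _||]; first exact: derivable_horner.
  + by apply: cvg_at_right_filter; exact: continuous_horner.
  + by apply: cvg_at_left_filter; exact: continuous_horner.
- by move=> t _; rewrite -derivE slice_deriv mderiv_pint.
Qed.

Lemma poly_factor P a : P.[a] = 0 -> exists Q0, P = Q0 * ('X - a%:P).
Proof. by move=> /eqP/factor_theorem. Qed.

Lemma poly_factor2 P a b m : a != b -> (m <= 2)%N ->
  (forall r, (r < m)%N -> P^`(r).[a] = 0 /\ P^`(r).[b] = 0) ->
  exists Q0, P = Q0 * (('X - a%:P) * ('X - b%:P)) ^+ m.
Proof.
move=> ab; have ba0 : b - a != 0 by rewrite subr_eq0 eq_sym.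
have ab0 : a - b != 0 by rewrite subr_eq0.
case: m => [|[|[|//]]] _ H; first by exists P; rewrite expr0 mulr1.
  have [] := H 0%N isT; rewrite derivn0 => Pa Pb; have [Q1 E1] := poly_factor Pa.
  move: Pb; rewrite E1 !hornerE => /eqP; rewrite mulf_eq0 (negbTE ba0) orbF => /eqP.
  by move=> /poly_factor [Q2 ->]; exists Q2; rewrite expr1; ring.
have [] := H 0%N isT; rewrite derivn0 => Pa Pb; have [] := H 1%N isT; rewrite derivn1 => Pa' Pb'.
have [Q1 E1] := poly_factor Pa.
move: Pa'; rewrite E1 !poly.derivE !hornerE subrr mulr0 add0r => /poly_factor [Q2 E2].
move: Pb; rewrite E1 E2 !hornerE => /eqP; rewrite !mulf_eq0 (negbTE ba0) !orbF.
move=> /eqP /poly_factor [Q3 E3].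
move: Pb'; rewrite E1 E2 E3 !poly.derivE !hornerE !subrr !(mulr0, mul0r, addr0, add0r, mulr1).
move=> /eqP; rewrite !mulf_eq0 (negbTE ba0) !orbF => /eqP /poly_factor [Q4 ->].
by exists Q4; rewrite expr2; ring.
Qed.

Lemma deriv_ge0_const P a b : a < b -> P.[a] = P.[b] ->
  (forall t, a <= t <= b -> 0 <= P^`().[t]) -> P^`() = 0.
Proof.
move=> ab Pab P0; have cP : {within `[a, b], continuous (horner P)}.
  by apply: continuous_subspaceT; exact: continuous_horner.
have H : {in `[a, b] &, {homo horner P : x y / x <= y}}.
  apply: (@ger0_derive1_le_cc _ (horner P) a b _ _ cP) => x; first by move=> _; exact: derivable_horner.
  by rewrite in_itv /= -derivE => /andP [h1 h2]; apply: P0; rewrite !ltW.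
suff -> : P = (P.[a])%:P by rewrite derivC.
apply/eqP; rewrite -subr_eq0; apply/eqP; apply: (poly_itv0 ab) => t /andP [h1 h2].
rewrite hornerD hornerN hornerC; apply/eqP; rewrite subr_eq0 eq_le.
have la : a \in `[a, b] by rewrite in_itv /= lexx ltW.
have lb : b \in `[a, b] by rewrite in_itv /= lexx ltW.
have lt : t \in `[a, b] by rewrite in_itv /= h1 h2.
by rewrite {1}Pab !H.
Qed.

Definition uni i P : pol := \sum_(n < size P) P`_n *: mpolyX R (mnm_muln (mnm1 i) n).

Lemma peval_uni i P x : peval (uni i P) x = P.[x 0 i].
Proof.
rewrite /uni peval_sum horner_coef; apply: eq_bigr => n _.
rewrite /peval mevalZ mevalX (bigD1 i) //= big1 ?mulr1 => [|j ji].
  by rewrite mulmnE mnm1E eqxx mul1n.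
by rewrite mulmnE mnm1E eq_sym (negbTE ji) mul0n expr0.
Qed.

Lemma msupp_uni i P m : m \in msupp (uni i P) ->
  (m i < size P)%N /\ forall j, j != i -> m j = 0%N.
Proof.
move=> /msupp_sum_le /flattenP [_ /mapP [n _ ->]] /msuppZ_le.
rewrite msuppX inE => /eqP ->; split=> [|j ji].
  by rewrite mulmnE mnm1E eqxx mul1n.
by rewrite mulmnE mnm1E eq_sym (negbTE ji) mul0n.
Qed.

Lemma mderiv_uni i j P : i != j -> mderiv j (uni i P) = 0.
Proof.
move=> ij; apply: peval_inj => x; rewrite peval0 -[x](upd_id _ j).
rewrite (@eq_mderiv_line _ j _ (mpolyC 3 P.[x 0 i]) _ 0).
  by rewrite mderivC peval0.
by move=> t; rewrite peval_uni pevalC upd_other.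
Qed.

(* If f = r w with w = ((t - a)(t - b))^m of constant sign, testing against r gives
   0 = int w r^2. *)
Lemma line_unisolve i x a b (n m : nat) f : a < b -> (m <= 2)%N -> degle i n%:Z f ->
  (forall r, (r < m)%N -> peval (iter r (mderiv i) f) (upd x i a) = 0 /\
                          peval (iter r (mderiv i) f) (upd x i b) = 0) ->
  (forall P, (size P + 2 * m <= n.+1)%N -> peval (lint i a b (f * uni i P)) x = 0) ->
  forall t, peval f (upd x i t) = 0.
Proof.
move=> ab m2 fn fv fm t; rewrite -slice_horner.
suff -> : slice i x f = 0 by rewrite horner0.
have dn r : (slice i x f)^`(r) = slice i x (iter r (mderiv i) f).
  by elim: r => [|r IH]; rewrite ?derivn0 // derivnS IH slice_deriv.
have ab' : a != b by rewrite lt_eqF.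
have [|Q0 fE] := @poly_factor2 (slice i x f) a b m ab' m2.
  by move=> r rm; rewrite dn !slice_horner; exact: fv.
have [Q00|Q0n] := eqVneq Q0 0; first by rewrite fE Q00 mul0r.
have am : ('X - a%:P) * ('X - b%:P) \is monic by rewrite monicMl monicXsubC.
have sQ : (size Q0 + 2 * m <= n.+1)%N.
  have := size_slice x fn; rewrite fE size_Mmonic ?rpredX //.
  have := size_exp (('X - a%:P) * ('X - b%:P)) m.
  rewrite size_mul ?polyXsubC_eq0 // !size_XsubC -[((2 + 2).-1).-1]/2%N.
  have : (0 < size ((('X - a%:P) * ('X - b%:P)) ^+ m))%N.
    by rewrite size_poly_gt0 expf_neq0 // monic_neq0.
  by case: (size ((('X - a%:P) * ('X - b%:P)) ^+ m)) => // z _ /= ->; rewrite addnS.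
(* A primitive of w r^2 vanishing at a, and at b by the moment against r. Being monotone it is
   constant, hence r = 0. The sign of w is positive for m = 0 or 2 and negative for m = 1, whence
   the three cases at the end. *)
pose A := slice i x (pint i a (f * uni i Q0)).
have A' : A^`() = (Q0 ^+ 2) * (('X - a%:P) * ('X - b%:P)) ^+ m.
  rewrite /A slice_deriv mderiv_pint.
  apply/eqP; rewrite -subr_eq0; apply/eqP; apply: (@poly_itv0 _ _ 0 1) => // s _.
  rewrite hornerD hornerN slice_horner pevalM peval_uni upd_same -slice_horner fE.
  by rewrite !hornerM; ring.
have Aa : A.[a] = 0 by rewrite slice_horner peval_pint // upd_same.
have Ab : A.[b] = 0 by rewrite slice_horner -peval_esub; exact: fm.
suff A0 : A^`() = 0.
  move: A0; rewrite A' => /eqP; rewrite mulf_eq0 !expf_eq0 (negbTE Q0n).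
  by rewrite (negbTE (monic_neq0 am)) !andbF.
have wab s : a <= s <= b -> (s - a) * (s - b) <= 0.
  by move=> /andP [h1 h2]; rewrite mulr_ge0_le0 // ?subr_ge0 ?subr_le0.
case: m m2 {fv fm sQ fE} A' => [|[|[|//]]] _ A'.
- apply: (deriv_ge0_const ab); first by rewrite Aa Ab.
  by move=> s _; rewrite A' expr0 mulr1 hornerE sqr_ge0.
- apply/eqP; rewrite -oppr_eq0 -derivN; apply/eqP; apply: (deriv_ge0_const ab).
    by rewrite !hornerN Aa Ab.
  move=> s /wab h; rewrite derivN A' expr1 hornerN !(hornerM, horner_exp, hornerXsubC) oppr_ge0.
  by rewrite mulr_ge0_le0 // sqr_ge0.
- apply: (deriv_ge0_const ab); first by rewrite Aa Ab.
  by move=> s _; rewrite A' !(hornerM, horner_exp) mulr_ge0 // ?sqr_ge0 // -expr2 sqr_ge0.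
Qed.

(** Unisolvence on segments is used twice: first in x_j on each line, where the moments to be killed
    are functions of x_i; these functions inherit degree and end conditions, and vanish by the same
    result in x_i. *)
Lemma face_unisolve i j x a b (c d' : R) (n1 m1 n2 m2 : nat) f : i != j ->
  a < b -> c < d' -> (m1 <= 2)%N -> (m2 <= 2)%N ->
  degle i n1%:Z f -> degle j n2%:Z f ->
  (forall r t, (r < m1)%N -> peval (iter r (mderiv i) f) (upd (upd x i a) j t) = 0 /\
                             peval (iter r (mderiv i) f) (upd (upd x i b) j t) = 0) ->
  (forall r s, (r < m2)%N -> peval (iter r (mderiv j) f) (upd (upd x i s) j c) = 0 /\
                             peval (iter r (mderiv j) f) (upd (upd x i s) j d') = 0) ->
  (forall P1 P2, (size P1 + 2 * m1 <= n1.+1)%N -> (size P2 + 2 * m2 <= n2.+1)%N ->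
     peval (lint i a b (lint j c d' (f * (uni i P1 * uni j P2)))) x = 0) ->
  forall s t, peval f (upd (upd x i s) j t) = 0.
Proof.
move=> ij ab cd m1_2 m2_2 f1 f2 e1 e2 fm s.
have ji : j != i by rewrite eq_sym.
apply: (line_unisolve cd m2_2 f2) => [r rm|P2 sP2]; first exact: e2.
pose g := lint j c d' (f * uni j P2).
apply: (@line_unisolve i x a b n1 m1 g ab m1_2) => [|r rm|P1 sP1].
- have H : degle i n1%:Z (f * uni j P2).
    rewrite -[n1%:Z]addr0; apply: degleM => // m /msupp_uni [_ ->] //.
  by apply: degle_esub; [right|apply: degle_pint_other].
- have gE : iter r (mderiv i) g = lint j c d' (iter r (mderiv i) f * uni j P2).
    elim: r {rm} => //= r ->; rewrite lint_mderiv // mderivM (mderiv_uni P2 ji).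
    by rewrite mulr0 addr0.
  rewrite gE; split; apply: lint_zero => t; rewrite pevalM.
    by have [-> _] := e1 r t rm; rewrite mul0r.
  by have [_ ->] := e1 r t rm; rewrite mul0r.
- rewrite /g -lint_mul; last exact: mderiv_uni.
  by rewrite -mulrA [uni j _ * _]mulrC; apply: fm.
Qed.

End Moments.

(** * Unisolvence on the edges and faces of a box *)

Section Dofs.
Variable R : realType.
Notation pol := (mpoly 3 R).
Notation pt := 'rV[R]_3.
Implicit Types (p q f g u w : pol) (i j l d e : 'I_3) (G H : box R) (x y v : pt) (a b : R).

Definition valid G : Prop := forall d, lo G 0 d <= hi G 0 d.

Lemma npar_hi G d : valid G -> ~~ par G d -> hi G 0 d = lo G 0 d.
Proof. by move=> vG; rewrite /par -leNgt => h; apply/eqP; rewrite eq_le h vG. Qed.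

Lemma npar_at G d x : ~~ par G d -> box_set G x -> x 0 d = lo G 0 d.
Proof.
rewrite /par -leNgt => h /(_ d) /andP [h1 h2]; apply/eqP; rewrite eq_le h1 andbT.
exact: le_trans h2 h.
Qed.

Lemma box_lo G : valid G -> box_set G (lo G).
Proof. by move=> vG d; rewrite lexx vG. Qed.

Lemma subentity_trans G H K : subentity G H -> subentity H K -> subentity G K.
Proof.
move=> s1 s2 d; case: (s1 d) (s2 d) => -[-> ->] [] [-> ->];
  by [constructor 1|constructor 2|constructor 3].
Qed.

Lemma subentity_valid G H : valid G -> subentity G H -> valid H.
Proof. by move=> vG s d; have := vG d; case: (s d) => -[-> ->]. Qed.

Definition slab G i a : box R := Box (upd (lo G) i a) (upd (hi G) i a).

Lemma par_slab G i a d : par (slab G i a) d = (d != i) && par G d.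
Proof. by rewrite /par !mxE; case: eqP => //= _; rewrite ltxx. Qed.

Lemma slab_sub G i a : a = lo G 0 i \/ a = hi G 0 i -> subentity G (slab G i a).
Proof.
move=> h d; rewrite /= !mxE; case: eqP => [->|_]; last by constructor 1.
by case: h => ->; [constructor 2|constructor 3].
Qed.

Lemma slab_set G i x : box_set G x -> box_set (slab G i (x 0 i)) x.
Proof. by move=> Gx d; rewrite /= !mxE; case: eqP => [->|//]; rewrite lexx. Qed.

Lemma parallel0 G : parallel [::] G <-> forall d, ~~ par G d.
Proof. by split=> H d; [rewrite /par H|apply/negbTE/H]. Qed.

Lemma par_cases G : [\/ parallel [::] G, exists i, parallel [:: i] G,
   exists i j l, uniq [:: i; j; l] /\ parallel [:: i; j] G | forall d, par G d].
Proof.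
rewrite /parallel -/(par G _).
case p0 : (par G 0); case p1 : (par G 1); case p2 : (par G 2).
- by constructor 4; elim/ord3P.
- by constructor 3; exists 0, 1, 2; split=> //; elim/ord3P; rewrite -/(par G _) ?p0 ?p1 ?p2.
- by constructor 3; exists 0, 2, 1; split=> //; elim/ord3P; rewrite -/(par G _) ?p0 ?p1 ?p2.
- by constructor 2; exists 0; elim/ord3P; rewrite -/(par G _) ?p0 ?p1 ?p2.
- by constructor 3; exists 1, 2, 0; split=> //; elim/ord3P; rewrite -/(par G _) ?p0 ?p1 ?p2.
- by constructor 2; exists 1; elim/ord3P; rewrite -/(par G _) ?p0 ?p1 ?p2.
- by constructor 2; exists 2; elim/ord3P; rewrite -/(par G _) ?p0 ?p1 ?p2.
- by constructor 1; elim/ord3P; rewrite -/(par G _) ?p0 ?p1 ?p2.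
Qed.

Lemma vertex_eq G x : parallel [::] G -> box_set G x -> x = lo G.
Proof.
by move=> /parallel0 nG Gx; apply/rowP => d; apply: npar_at.
Qed.

Lemma int1_pt a (F : R -> R) : int1 a a F = F a.
Proof. by rewrite /int1 eqxx. Qed.

Lemma box_int_edge G i g : valid G -> parallel [:: i] G ->
  box_int G (peval g) = peval (lint i (lo G 0 i) (hi G 0 i) g) (lo G).
Proof.
move=> vG pG; have pi : lo G 0 i < hi G 0 i by have := pG i; rewrite inE eqxx.
have nd d : d != i -> hi G 0 d = lo G 0 d.
  by move=> di; apply: npar_hi => //; rewrite /par pG inE (negbTE di).
rewrite -int1_line // /box_int; move: i pi nd {pG}; elim/ord3P => pi nd.
- rewrite (nd 1 isT) (nd 2 isT); congr (int1 _ _ _); apply/funext => t; rewrite !int1_pt.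
  by congr peval; apply/rowP; elim/ord3P; rewrite !mxE.
- rewrite (nd 0 isT) (nd 2 isT) int1_pt; congr (int1 _ _ _); apply/funext => t; rewrite !int1_pt.
  by congr peval; apply/rowP; elim/ord3P; rewrite !mxE.
- rewrite (nd 0 isT) (nd 1 isT) !int1_pt; congr (int1 _ _ _); apply/funext => t.
  by congr peval; apply/rowP; elim/ord3P; rewrite !mxE.
Qed.

Lemma box_int_face G i j g : valid G -> (i < j)%N -> parallel [:: i; j] G ->
  box_int G (peval g) =
  peval (lint i (lo G 0 i) (hi G 0 i) (lint j (lo G 0 j) (hi G 0 j) g)) (lo G).
Proof.
move=> vG ij pG.
have pi : lo G 0 i < hi G 0 i by have := pG i; rewrite inE eqxx.
have pj : lo G 0 j < hi G 0 j by have := pG j; rewrite !inE eqxx orbT.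
have nd d : d != i -> d != j -> hi G 0 d = lo G 0 d.
  by move=> di dj; apply: npar_hi => //; rewrite /par pG !inE (negbTE di) (negbTE dj).
rewrite -int1_line //; under [in RHS]eq_fun do rewrite -int1_line //.
have : [\/ i = 0 /\ j = 1, i = 0 /\ j = 2 | i = 1 /\ j = 2].
  move: i j ij {pG pi pj nd}; elim/ord3P; elim/ord3P => // _;
    by [constructor 1|constructor 2|constructor 3].
rewrite /box_int => -[] [E1 E2]; subst i j.
- rewrite (nd 2 isT isT); congr (int1 _ _ _); apply/funext => s; congr (int1 _ _ _).
  apply/funext => t; rewrite int1_pt.
  by congr peval; apply/rowP; elim/ord3P; rewrite !mxE.
- rewrite (nd 1 isT isT); congr (int1 _ _ _); apply/funext => s; rewrite int1_pt; congr (int1 _ _ _).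
  apply/funext => t.
  by congr peval; apply/rowP; elim/ord3P; rewrite !mxE.
- rewrite (nd 0 isT isT) int1_pt; congr (int1 _ _ _); apply/funext => s; congr (int1 _ _ _).
  apply/funext => t.
  by congr peval; apply/rowP; elim/ord3P; rewrite !mxE.
Qed.

Lemma eq_int1 a b (F F' : R -> R) : a <= b -> (forall t, a <= t <= b -> F t = F' t) ->
  int1 a b F = int1 a b F'.
Proof.
move=> ab H; rewrite /int1; case: eqVneq => [_|_]; first by rewrite H // lexx.
by apply: eq_Rintegral => t; rewrite inE /= in_itv => /H.
Qed.

Lemma eq_box_int G (F F' : pt -> R) : valid G -> (forall x, box_set G x -> F x = F' x) ->
  box_int G F = box_int G F'.
Proof.
move=> vG H; rewrite /box_int; do 3![apply: eq_int1; [exact: vG|move=> ? ?]].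
by apply: H; elim/ord3P; rewrite !mxE.
Qed.

Lemma all_line i a b f x : a < b -> (forall t, a <= t <= b -> peval f (upd x i t) = 0) ->
  forall t, peval f (upd x i t) = 0.
Proof.
move=> ab H t; rewrite -slice_horner (@poly_itv0 _ (slice i x f) a b ab) ?horner0 //.
by move=> s /H; rewrite slice_horner.
Qed.

Definition at_end G i x : Prop := x 0 i = lo G 0 i \/ x 0 i = hi G 0 i.

(** Here n is the degree along the edge and m the number of derivatives known at both ends. All edge
    degrees of freedom are instances: m = 2 against degree n - 4, m = 1 against n - 2, m = 0 against
    n. A negative bound means no moments, the end data being enough. *)
Lemma edge_zero (n m : nat) i G f f' : valid G -> parallel [:: i] G -> (m <= 2)%N ->
  degle i n%:Z (f - f') ->
  (forall r x, (r < m)%N -> box_set G x -> at_end G i x ->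
     peval (iter r (mderiv i) (f - f')) x = 0) ->
  (forall p, Q [:: (i, n%:Z - (2 * m)%:Z)] p ->
     box_int G (fun x => peval f x * peval p x) = box_int G (fun x => peval f' x * peval p x)) ->
  zero_on G (f - f').
Proof.
move=> vG pG m2 fn e0 fm x Gx.
have Gi : lo G 0 i < hi G 0 i by have := pG i; rewrite inE eqxx.
have -> : x = upd (lo G) i (x 0 i).
  apply/rowP => d; rewrite mxE; case: eqVneq => [->//|di]; apply: npar_at => //.
  by rewrite /par pG inE (negbTE di).
have Gb a : lo G 0 i <= a <= hi G 0 i -> box_set G (upd (lo G) i a).
  by move=> h; apply: box_upd => //; exact: box_lo.
apply: (line_unisolve Gi m2 fn) => [r rm|P sP].
  split; apply: e0 => //; try (by apply: Gb; rewrite lexx vG).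
    by left; rewrite upd_same.
  by right; rewrite upd_same.
have Qp : Q [:: (i, n%:Z - (2 * m)%:Z)] (uni i P).
  move=> mu /msupp_uni [h1 h2]; split=> [d|d]; rewrite inE; last exact: h2.
  by move=> /eqP -> /=; lia.
have := fm _ Qp; rewrite -[LHS]/(box_int G _) => E.
have {}E : box_int G (peval (f * uni i P)) = box_int G (peval (f' * uni i P)).
  have P' g : peval (g * uni i P) = (fun x => peval g x * peval (uni i P) x).
    by apply/funext => y; rewrite pevalM.
  by rewrite !P'.
move: E; rewrite !(box_int_edge _ vG pG) => E.
rewrite mulrBl (lintB i) pevalB.
by apply/eqP; rewrite subr_eq0; apply/eqP.
Qed.

Lemma face_zero (n1 m1 n2 m2 : nat) i j G f f' : valid G -> i != j ->
  parallel [:: i; j] G -> (m1 <= 2)%N -> (m2 <= 2)%N ->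
  degle i n1%:Z (f - f') -> degle j n2%:Z (f - f') ->
  (forall r x, (r < m1)%N -> box_set G x -> at_end G i x ->
     peval (iter r (mderiv i) (f - f')) x = 0) ->
  (forall r x, (r < m2)%N -> box_set G x -> at_end G j x ->
     peval (iter r (mderiv j) (f - f')) x = 0) ->
  (forall p, Q [:: (i, n1%:Z - (2 * m1)%:Z); (j, n2%:Z - (2 * m2)%:Z)] p ->
     box_int G (fun x => peval f x * peval p x) = box_int G (fun x => peval f' x * peval p x)) ->
  zero_on G (f - f').
Proof.
(* Only to match the fixed order of integration in [box_int]; the moment space is symmetric in the
   two variables. *)
move=> vG; wlog ij : i j n1 m1 n2 m2 / (i < j)%N.
  move=> W ij pG h1 h2 f1 f2 e1 e2 fm; move: (ij); rewrite neq_ltn => /orP [lt|lt].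
    exact: (W i j n1 m1 n2 m2 lt ij pG h1 h2 f1 f2 e1 e2 fm).
  have ji : j != i by rewrite eq_sym.
  have pG' : parallel [:: j; i] G by move=> d; rewrite pG !inE orbC.
  apply: (W j i n2 m2 n1 m1 lt ji pG' h2 h1 f2 f1 e2 e1) => p Qp.
  apply: fm => mu /Qp [q1 q2]; split=> d; rewrite !inE => h.
    by apply: q1; rewrite !inE orbC.
  by apply: q2; rewrite !inE orbC.
move=> nij pG h1 h2 f1 f2 e1 e2 fm x Gx.
have Gi : lo G 0 i < hi G 0 i by have := pG i; rewrite inE eqxx.
have Gj : lo G 0 j < hi G 0 j by have := pG j; rewrite !inE eqxx orbT.
have nji : j != i by rewrite eq_sym.
have -> : x = upd (upd (lo G) i (x 0 i)) j (x 0 j).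
  apply/rowP => d; rewrite !mxE; case: eqVneq => [->//|dj]; case: eqVneq => [->//|di].
  by apply: npar_at => //; rewrite /par pG !inE (negbTE di) (negbTE dj).
have Gb a b : lo G 0 i <= a <= hi G 0 i -> lo G 0 j <= b <= hi G 0 j ->
    box_set G (upd (upd (lo G) i a) j b).
  by move=> ha hb; apply: box_upd => //; apply: box_upd => //; exact: box_lo.
have ll d : lo G 0 d <= lo G 0 d <= hi G 0 d by rewrite lexx vG.
have hh d : lo G 0 d <= hi G 0 d <= hi G 0 d by rewrite lexx vG.
apply: (face_unisolve nij Gi Gj h1 h2 f1 f2) => [r t rm|r s rm|P1 P2 s1 s2].
- split; apply: (all_line Gj) => {}t tj; apply: e1 => //; try exact: Gb.
    by left; rewrite upd_other // upd_same.
  by right; rewrite upd_other // upd_same.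
- split; rewrite updC //; apply: (all_line Gi) => {}s sj; rewrite -updC //; apply: e2 => //;
    try exact: Gb.
    by left; rewrite upd_same.
  by right; rewrite upd_same.
set p := uni i P1 * uni j P2.
have Qp : Q [:: (i, n1%:Z - (2 * m1)%:Z); (j, n2%:Z - (2 * m2)%:Z)] p.
  move=> mu /msuppM_le /allpairsP [[mu1 mu2] [/= /msupp_uni [a1 a2] /msupp_uni [b1 b2] ->]].
  split=> d; rewrite !inE.
    by case/orP => /eqP -> /=; rewrite mnmDE ?(b2 i) // ?(a2 j) //; lia.
  by rewrite negb_or => /andP [di dj]; rewrite mnmDE a2 // b2.
have := fm _ Qp => E.
have {}E : box_int G (peval (f * p)) = box_int G (peval (f' * p)).
  have P' g : peval (g * p) = (fun x => peval g x * peval p x).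
    by apply/funext => y; rewrite pevalM.
  by rewrite !P'.
move: E; rewrite !(box_int_face _ vG ij pG) => E.
rewrite mulrBl (lintB j) (lintB i) pevalB.
by apply/eqP; rewrite subr_eq0; apply/eqP.
Qed.

End Dofs.

(** * Membership in [U_h] in terms of traces *)

Section Spaces.
Variable R : realType.
Notation pol := (mpoly 3 R).
Notation pt := 'rV[R]_3.
Implicit Types (p q f g u w : pol) (i j l d e : 'I_3) (G H : box R) (x y v : pt) (a b : R).

Lemma mderivm3 (m : multinom 3) p : mderivm m p =
  iter (m 0) (mderiv 0) (iter (m 1) (mderiv 1) (iter (m 2) (mderiv 2) p)).
Proof.
rewrite /mderivm; have -> : enum 'I_3 = [:: 0; 1; 2].
  by apply: (inj_map val_inj); rewrite val_enum_ord.
by [].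
Qed.

Lemma uniq3_rot i j l : uniq [:: i; j; l] -> uniq [:: j; l; i].
Proof. by rewrite -[[:: j; l; i]]/(rot 1 [:: i; j; l]) rot_uniq. Qed.

Lemma uniq3_swap i j l : uniq [:: i; j; l] -> uniq [:: j; i; l].
Proof. by move=> /uniq3P [ij il jl [ji li lj]]; rewrite /= !inE negb_or ji jl il. Qed.

Lemma U_trace0_edge G i j l w : uniq [:: i; j; l] -> par G i -> zero_on G w ->
  zero_on G (mderiv j w) -> zero_on G (mderiv l w) -> zero_on G (mderiv j (mderiv l w)) ->
  U_trace0 G w.
Proof.
move=> u Gi w0 wj wl wjl; apply: U_trace0I => //.
- by move=> d; case: (uniq3 u d) => -> //; exact: zero_on_mderiv.
- move=> d e de; move: de; case: (uniq3 u d) => ->; case: (uniq3 u e) => -> //; rewrite ?eqxx // => _;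
  do 1?[exact: zero_on_mderiv|rewrite mderiv_comm; exact: zero_on_mderiv|by rewrite mderiv_comm].
- by rewrite -(mderiv3_perm w u); exact: zero_on_mderiv.
Qed.

Lemma U_trace0_face G i j l w : uniq [:: i; j; l] -> par G i -> par G j ->
  zero_on G w -> zero_on G (mderiv l w) -> U_trace0 G w.
Proof.
move=> u Gi Gj w0 wl; apply: (U_trace0_edge u Gi) => //; exact: zero_on_mderiv.
Qed.

Variables (N : nat) (T : 'I_N -> box R).
Hypothesis Tlt : forall c i, lo (T c) 0 i < hi (T c) 0 i.
Hypothesis Tinj : forall c c' G, subentity (T c) G -> subentity (T c') G ->
  (forall d, par G d) -> c = c'.

Lemma Tvalid c G : subentity (T c) G -> valid G.
Proof. by apply: subentity_valid => i; exact: ltW. Qed.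

Definition shared c c' G : Prop := subentity (T c) G /\ subentity (T c') G.

Lemma shared_sub c c' G H : shared c c' G -> subentity G H -> shared c c' H.
Proof. by move=> [s1 s2] sH; split; apply: subentity_trans sH. Qed.

Lemma shared_slab c c' G i x : shared c c' G -> at_end G i x -> shared c c' (slab G i (x 0 i)).
Proof. by move=> s e; apply: shared_sub s _; exact: slab_sub. Qed.

Lemma moment_dofI s (P : set pol) (u : sfield R N) :
  (forall c c' G, shared c c' G -> parallel s G -> zero_on G (u c - u c')) ->
  moment_dof T s P u.
Proof.
move=> H c c' G pG s1 s2 p Pp; apply: eq_box_int; first exact: Tvalid s1.
move=> x Gx; congr (_ * _); apply/eqP; rewrite -subr_eq0 -pevalB; apply/eqP.
exact: (H c c' G (conj s1 s2) pG).
Qed.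

Lemma vertex_dofE (u : sfield R N) : vertex_dof T u <->
  (forall c c' G, shared c c' G -> parallel [::] G -> zero_on G (u c - u c')).
Proof.
split=> [H c c' G [s1 s2] pG x Gx|H c c' G pG s1 s2].
  by rewrite (vertex_eq pG Gx) pevalB (H c c' G) // subrr.
apply/eqP; rewrite -subr_eq0 -pevalB; apply/eqP; apply: (H c c' G (conj s1 s2) pG).
by apply: box_lo; exact: Tvalid s1.
Qed.

Lemma edge_agree (n m : nat) i (z : int) (u : sfield R N) c c' G : shared c c' G ->
  parallel [:: i] G -> (m <= 2)%N -> degle i n%:Z (u c - u c') -> z = n%:Z - (2 * m)%:Z ->
  moment_dof T [:: i] (Q [:: (i, z)]) u ->
  (forall r H, (r < m)%N -> shared c c' H -> parallel [::] H -> zero_on H (iter r (mderiv i) (u c - u c'))) ->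
  zero_on G (u c - u c').
Proof.
move=> sG pG m2 dn -> md e0; have [s1 s2] := sG.
apply: (edge_zero (Tvalid s1) pG m2 dn) => [r x rm Gx ex|p Qp]; last exact: md.
apply: (e0 r (slab G i (x 0 i))) => //; [exact: shared_slab| |exact: slab_set].
by move=> d; rewrite -/(par _ d) par_slab /par pG inE; case: eqP.
Qed.

Lemma face_agree (n1 m1 n2 m2 : nat) i j (z1 z2 : int) (u : sfield R N) c c' G :
  shared c c' G -> i != j -> parallel [:: i; j] G -> (m1 <= 2)%N -> (m2 <= 2)%N ->
  degle i n1%:Z (u c - u c') -> degle j n2%:Z (u c - u c') ->
  z1 = n1%:Z - (2 * m1)%:Z -> z2 = n2%:Z - (2 * m2)%:Z ->
  moment_dof T [:: i; j] (Q [:: (i, z1); (j, z2)]) u ->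
  (forall r H, (r < m1)%N -> shared c c' H -> parallel [:: j] H ->
     zero_on H (iter r (mderiv i) (u c - u c'))) ->
  (forall r H, (r < m2)%N -> shared c c' H -> parallel [:: i] H ->
     zero_on H (iter r (mderiv j) (u c - u c'))) ->
  zero_on G (u c - u c').
Proof.
move=> sG ij pG h1 h2 d1 d2 -> -> md e1 e2; have [s1 s2] := sG.
apply: (face_zero (Tvalid s1) ij pG h1 h2 d1 d2) => [r x rm Gx ex|r x rm Gx ex|p Qp]; last exact: md.
- apply: (e1 r (slab G i (x 0 i))) => //; [exact: shared_slab| |exact: slab_set].
  move=> d; rewrite -/(par _ d) par_slab /par pG !inE; case: eqP => //= ->.
  by rewrite (negbTE ij).
- apply: (e2 r (slab G j (x 0 j))) => //; [exact: shared_slab| |exact: slab_set].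
  move=> d; rewrite -/(par _ d) par_slab /par pG !inE; case: (eqVneq d j) => [->|] /=.
    by rewrite eq_sym (negbTE ij).
  by rewrite orbF.
Qed.

Section Uspace.
Variable k : nat.
Hypothesis k3 : (3 <= k)%N.

(** Agreement climbs from vertices to edges to faces, each level providing the end conditions for
    the next. On an edge the function and its derivatives across the edge are treated separately,
    derivatives along it being automatic; on a face only the function and its normal derivative are
    left. A shared subentity of full dimension means that both cells are the same. *)
Lemma U_hP (u : sfield R N) : U_h T k u <->
  (forall c, U_deg k (u c)) /\ forall c c' G, shared c c' G -> U_trace0 G (u c - u c').
Proof.
have u012 : uniq [:: 0; 1; 2 : 'I_3] by [].
have kE : k%:Z - 4 = k%:Z - (2 * 2)%:Z by [].
have parE s G d : parallel s G -> par G d = (d \in s) by move=> /(_ d).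
split.
  move=> [sh Vd Ed Fd].
  have dg c : U_deg k (u c).
    have [h0 h1 h2] := (Q3E _ _ _ _ u012).1 (sh c).
    by move=> d; move: d; elim/ord3P.
  split=> // c c'.
  have V G : shared c c' G -> parallel [::] G -> U_trace0 G (u c - u c').
    move=> sG pG b.
    pose al : multinom 3 := Multinom [tuple (b i : nat) | i < 3].
    have alE i : al i = b i by rewrite mnmE.
    have al1 i : (al i <= 1)%N by rewrite alE; case: (b i).
    have := (vertex_dofE _).1 (Vd al al1) c c' G sG pG.
    by rewrite !ffunE !mderivm3 !alE -!/(jet b _) -jetB.
  have E G i : shared c c' G -> parallel [:: i] G -> U_trace0 G (u c - u c').
    move=> sG pG; have u3 := uniq3_next i.
    have [m1 m2 m3 m4] := Ed _ _ _ u3.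
    have Gi : par G i by rewrite (parE _ _ _ pG) inE.
    have VH H (sH : shared c c' H) (pH : parallel [::] H) := U_trace0E (V H sH pH).
    have key D (w : sfield R N) : (forall f g, D (f - g) = D f - D g) ->
        (forall c, w c = D (u c)) -> moment_dof T [:: i] (Q [:: (i, k%:Z - 4)]) w ->
        degle i k%:Z (D (u c - u c')) ->
        (forall H, shared c c' H -> parallel [::] H ->
           zero_on H (D (u c - u c')) /\ zero_on H (mderiv i (D (u c - u c')))) ->
        zero_on G (D (u c - u c')).
      move=> DB wE mw dw w0; rewrite DB -!wE.
      apply: (@edge_agree k 2 i (k%:Z - 4) w) => //; rewrite !wE -DB //.
      by move=> [|[|//]] H _ sH pH; case: (w0 H sH pH).
    have dD : U_deg k (u c - u c') by move=> d; apply: degleB; apply: dg.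
    have [ij il jl [ji li lj]] := uniq3P u3.
    apply: (U_trace0_edge u3 Gi).
    - apply: (key id u (fun _ _ => erefl) (fun _ => erefl) m1 (dD i)).
      by move=> H sH pH; have [h0 h1 _ _] := VH H sH pH.
    - apply: (key (mderiv (i + 1)) _ (mderivB (i + 1)) _ m2).
      + by move=> e; rewrite ffunE.
      + by apply: degle_mderiv; exact: dD.
      + by move=> H sH pH; have [h0 h1 h2 _] := VH H sH pH; split=> //; apply: h2.
    - apply: (key (mderiv (i + 2)) _ (mderivB (i + 2)) _ m3).
      + by move=> e; rewrite ffunE.
      + by apply: degle_mderiv; exact: dD.
      + by move=> H sH pH; have [h0 h1 h2 _] := VH H sH pH; split=> //; apply: h2.
    - apply: (key (fun f => mderiv (i + 1) (mderiv (i + 2) f)) _ _ _ m4).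
      + by move=> f g; rewrite !mderivB.
      + by move=> e; rewrite !ffunE.
      + by do 2!apply: degle_mderiv; exact: dD.
      + move=> H sH pH; have [h0 h1 h2 h3] := VH H sH pH; split=> //; first exact: h2.
        exact/h3/uniq3_rot.
  move=> G sG; have [pG|[i pG]|[i [j [l [u3 pG]]]]|pG] := par_cases G.
  - exact: V.
  - exact: (E G i).
  - have [ij il jl [ji li lj]] := uniq3P u3.
    have [m1 m2] := Fd _ _ _ u3.
    have Gi : par G i by rewrite (parE _ _ _ pG) inE eqxx.
    have Gj : par G j by rewrite (parE _ _ _ pG) !inE eqxx orbT.
    have EH H d (sH : shared c c' H) (pH : parallel [:: d] H) := U_trace0E (E H d sH pH).
    have dD : U_deg k (u c - u c') by move=> d; apply: degleB; apply: dg.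
    apply: (U_trace0_face u3 Gi Gj).
    + apply: (@face_agree k 2 k 2 i j _ _ u c c' G sG ij pG isT isT (dD i) (dD j) kE kE m1).
      * by move=> [|[|//]] H _ sH pH; have [h0 h1 _ _] := EH _ _ sH pH; [exact: h0|exact: h1].
      * by move=> [|[|//]] H _ sH pH; have [h0 h1 _ _] := EH _ _ sH pH; [exact: h0|exact: h1].
    + have wE (e : 'I_N) : (dd l u) e = mderiv l (u e) by rewrite ffunE.
      rewrite mderivB -!wE.
      have dE : (dd l u) c - (dd l u) c' = mderiv l (u c - u c') by rewrite !wE mderivB.
      have dd1 d : degle d k%:Z (dd l u c - dd l u c').
        by rewrite dE; apply: degle_mderiv; exact: dD.
      apply: (@face_agree k 2 k 2 i j _ _ _ c c' G sG ij pG isT isT (dd1 i) (dd1 j) kE kE m2);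
        rewrite dE.
      * move=> [|[|//]] H _ sH pH; have [_ h1 h2 _] := EH _ _ sH pH; first exact: h1.
        exact: h2.
      * move=> [|[|//]] H _ sH pH; have [_ h1 h2 _] := EH _ _ sH pH; first exact: h1.
        exact: h2.
  - by case: sG => s1 s2; rewrite (Tinj s1 s2 pG) subrr => b x _; rewrite /jet;
      case: (b 0); case: (b 1); case: (b 2); rewrite /= ?mderiv0 peval0.
move=> [dg tr].
have trE c c' G (sG : shared c c' G) := U_trace0E (tr c c' G sG).
split.
- by move=> c; apply/Q3E => //; split; exact: dg.
- move=> al al1; apply/vertex_dofE => c c' G sG pG x Gx.
  have alE i : al i = (al i != 0%N) :> nat by have := al1 i; case: (al i) => [|[]].
  have jE p : mderivm al p = jet (fun i => al i != 0%N) p by rewrite mderivm3 /jet -!alE.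
  rewrite !ffunE !jE -jetB.
  exact: (tr c c' G sG).
- move=> i j l u3; have [ij il jl [ji li lj]] := uniq3P u3; split; apply: moment_dofI => c c' G sG _;
    have [h0 h1 h2 h3] := trE _ _ _ sG; rewrite ?ffunE ?ffunE -?mderivB //; exact: h2.
- move=> i j l u3; have [ij il jl [ji li lj]] := uniq3P u3; split; apply: moment_dofI => c c' G sG _;
    have [h0 h1 h2 h3] := trE _ _ _ sG; rewrite ?ffunE -?mderivB //; exact: h1.
Qed.

End Uspace.
End Spaces.

(** * Membership in [Sigma_h] and [Xi_h] in terms of traces *)

Section MatrixSpaces.
Variable R : realType.
Notation pol := (mpoly 3 R).
Notation pt := 'rV[R]_3.
Implicit Types (p q f g u w : pol) (i j l d e : 'I_3) (G H : box R) (x y v : pt) (a b : R).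

Lemma parallel3 G i j l s : uniq [:: i; j; l] -> par G i = (i \in s) ->
  par G j = (j \in s) -> par G l = (l \in s) -> parallel s G.
Proof. by move=> u pi pj pl d; case: (uniq3 u d) => ->. Qed.

Lemma thin2 G i j : thin G -> i != j -> par G i -> par G j -> False.
Proof.
move=> [d dP] ij; case: (eqVneq i d) => [E|/dP/negbTE -> //].
by move=> _; rewrite -E in dP; rewrite (negbTE (dP j _)) // eq_sym.
Qed.

Lemma parallel_thin G s : (size s <= 1)%N -> parallel s G -> thin G.
Proof.
case: s => [|i [|//]] _ pG; first by exists 0 => d _; rewrite /par pG.
by exists i => d di; rewrite /par pG inE.
Qed.

Variables (N : nat) (T : 'I_N -> box R).
Hypothesis Tlt : forall c i, lo (T c) 0 i < hi (T c) 0 i.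
Hypothesis Tinj : forall c c' G, subentity (T c) G -> subentity (T c') G ->
  (forall d, par G d) -> c = c'.
Variable k : nat.
Hypothesis k3 : (3 <= k)%N.

Lemma matrix_shapeE (s : mfield R N) (n : 'I_3 -> 'I_3 -> 'I_3 -> int) :
  (forall i j l, uniq [:: i; j; l] ->
     shape (Q [:: (i, n i i i); (j, n i i j); (l, n i i l)]) (entry s i i) /\
     shape (Q [:: (i, n i j i); (j, n i j j); (l, n i j l)]) (entry s i j)) <->
  forall c i j d, degle d (n i j d) (s c i j).
Proof.
split=> [H c i j d|H i j l u]; last first.
  by split=> c; rewrite ffunE; apply/(Q3E _ _ _ _ u); split; exact: H.
case: (eqVneq i j) => [<-|/uniq3_third [l u]].
  have u := uniq3_next i; have [/(_ c) + _] := H _ _ _ u.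
  by rewrite ffunE => /(Q3E _ _ _ _ u) [h1 h2 h3]; case: (uniq3 u d) => ->.
have [_ /(_ c)] := H _ _ _ u.
by rewrite ffunE => /(Q3E _ _ _ _ u) [h1 h2 h3]; case: (uniq3 u d) => ->.
Qed.

Lemma Sigma_shapeE (s : mfield R N) : Sigma_shape k s <-> forall c, Sigma_deg k (s c).
Proof.
have H := matrix_shapeE s (fun i j d => k%:Z - (d == i)%:Z - (d == j)%:Z).
have E1 : k%:Z - 1 - 1 = k%:Z - 2 by lia.
split=> [S|/H S i j l u]; [apply/H => i j l u|]; have := S i j l u;
  have [ij il jl [ji li lj]] := uniq3P u;
  by rewrite !eqxx (negbTE ij) (negbTE ji) (negbTE li) (negbTE lj) !subr0 E1.
Qed.

Lemma Xi_shapeE (t : mfield R N) : Xi_shape k t <-> forall c, Xi_deg k (t c).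
Proof.
have H := matrix_shapeE t (fun i j d => k%:Z - 1 + (d == j)%:Z - (d == i)%:Z).
have E1 : k%:Z - 1 - 1 = k%:Z - 2 by lia.
split=> [S|/H S i j l u]; [apply/H => i j l u|]; have := S i j l u;
  have [ij il jl [ji li lj]] := uniq3P u;
  by rewrite !eqxx (negbTE ij) (negbTE ji) (negbTE li) (negbTE lj) !(addr0, subr0, addrK, subrK, E1).
Qed.

Lemma Q_shapeE (q : vfield R N) : Q_h k q <-> forall c, Q_deg k (q c).
Proof.
split=> [H c i d|H i j l u c].
  have u := uniq3_next i.
  have [ij il jl [ji li lj]] := uniq3P u.
  have := H _ _ _ u c; rewrite ffunE => /(Q3E _ _ _ _ u) [h1 h2 h3].
  case: (uniq3 u d) => ->; rewrite ?eqxx ?(negbTE ji) ?(negbTE li).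
  + by apply: degle_le h1; lia.
  + by apply: degle_le h2; lia.
  + by apply: degle_le h3; lia.
have [ij il jl [ji li lj]] := uniq3P u.
rewrite ffunE; apply/Q3E => //; split;
  [have h := H c i i|have h := H c i j|have h := H c i l];
  move: h; rewrite ?eqxx ?(negbTE ij) ?(negbTE ji) ?(negbTE li) ?(negbTE lj);
  apply: degle_le; lia.
Qed.

Lemma entryB (s : mfield R N) i j c c' : entry s i j c - entry s i j c' = (s c - s c') i j.
Proof. by rewrite !ffunE !mxE. Qed.

Lemma ddB (f : sfield R N) l c c' : dd l f c - dd l f c' = mderiv l (f c - f c').
Proof. by rewrite !ffunE mderivB. Qed.

(** Along x_i the test polynomials have the full degree k - 2, so no end values are needed (m = 0).
    Across a face the values on the two edges e_i are the end data (m = 1). *)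
Lemma Sigma_diag_trace (s : mfield R N) i c c' G : (forall c, Sigma_deg k (s c)) ->
  Sigma_diag_dof T k i (entry s i i) -> shared T c c' G -> par G i ->
  zero_on G ((s c - s c') i i).
Proof.
move=> dg [mE mF] sG Gi; rewrite -entryB.
have u := uniq3_next i.
have [ij il jl [ji li lj]] := uniq3P u.
have dD d : degle d (k%:Z - (d == i)%:Z - (d == i)%:Z) (entry s i i c - entry s i i c').
  by rewrite !ffunE; apply: degleB; exact: dg.
have d2 : degle i (k - 2)%N%:Z (entry s i i c - entry s i i c').
  by apply: degle_le (dD i); rewrite eqxx; clear -k3; lia.
have dk d : d != i -> degle d k%:Z (entry s i i c - entry s i i c').
  by move=> di; apply: degle_le (dD d); rewrite (negbTE di); clear -k3; lia.
have kE0 : k%:Z - 2 = (k - 2)%N%:Z - (2 * 0)%:Z by clear -k3; lia.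
have kE1 : k%:Z - 2 = k%:Z - (2 * 1)%:Z by clear -k3; lia.
have E H : shared T c c' H -> parallel [:: i] H -> zero_on H (entry s i i c - entry s i i c').
  move=> sH pH; exact: (@edge_agree _ _ _ Tlt (k - 2) 0 i _ _ _ _ _ sH pH isT d2 kE0 mE).
have F H j : j != i -> shared T c c' H -> parallel [:: i; j] H ->
    zero_on H (entry s i i c - entry s i i c').
  move=> nji sH pH; have nij : i != j by rewrite eq_sym.
  apply: (@face_agree _ _ _ Tlt (k - 2) 0 k 1 i j _ _ _ _ _ _ sH nij pH isT isT
    d2 (dk j nji) kE0 kE1 (mF j nji)) => //.
  by move=> [|//] H' _ sH' pH'; exact: E.
case pj : (par G (i + 1)); case pl : (par G (i + 2)).
- have [s1 s2] := sG; rewrite (Tinj s1 s2); first by rewrite subrr => x _; rewrite peval0.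
  by move=> d; case: (uniq3 u d) => ->; rewrite ?Gi ?pj ?pl.
- apply: (F _ (i + 1)) => //; apply: (parallel3 u);
    by rewrite !inE ?eqxx ?orbT ?(negbTE li) ?(negbTE lj).
- apply: (F _ (i + 2)) => //; apply: (parallel3 u);
    by rewrite !inE ?eqxx ?orbT ?(negbTE ji) ?(negbTE jl).
- apply: E => //; apply: (parallel3 u);
    by rewrite !inE ?eqxx ?orbT ?(negbTE ji) ?(negbTE li).
Qed.

(** The end data match the moments: along x_i and x_j the degree is k - 1 with values known at the
    ends, along x_l it is k with values and the derivative in x_l known. On F_il that derivative
    comes from the edges e_i, on an edge e_l from the vertices. *)
Lemma Sigma_off_trace (s : mfield R N) i j l c c' G : (forall c, Sigma_deg k (s c)) ->
  uniq [:: i; j; l] ->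
  Sigma_off_dof T k i j l (entry s i j) -> shared T c c' G ->
  zero_on G ((s c - s c') i j) /\ (thin G -> zero_on G (mderiv l ((s c - s c') i j))).
Proof.
move=> dg u [[v1 v2] [mi mi'] [mj mj'] ml [mij mil mjl]] sG; rewrite -entryB.
have [ij il jl [ji li lj]] := uniq3P u.
have dD d : degle d (k%:Z - (d == i)%:Z - (d == j)%:Z) (entry s i j c - entry s i j c').
  by rewrite !ffunE; apply: degleB; exact: dg.
set f := entry s i j in v1 v2 mi mi' mj mj' ml mij mil mjl dD *.
have fi : degle i (k - 1)%N%:Z (f c - f c').
  by apply: degle_le (dD i); rewrite eqxx (negbTE ij); clear -k3; lia.
have fj : degle j (k - 1)%N%:Z (f c - f c').
  by apply: degle_le (dD j); rewrite eqxx (negbTE ji); clear -k3; lia.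
have fl : degle l k%:Z (f c - f c').
  by apply: degle_le (dD l); rewrite (negbTE li) (negbTE lj); clear -k3; lia.
have kE3 : k%:Z - 3 = (k - 1)%N%:Z - (2 * 1)%:Z by clear -k3; lia.
have kE4 : k%:Z - 4 = k%:Z - (2 * 2)%:Z by clear -k3; lia.
have dl d : degle d (k - 1)%N%:Z (f c - f c') -> degle d (k - 1)%N%:Z (dd l f c - dd l f c').
  by rewrite ddB; apply: degle_mderiv.
have V H : shared T c c' H -> parallel [::] H ->
    zero_on H (f c - f c') /\ zero_on H (mderiv l (f c - f c')).
  move=> sH pH; split; first exact: ((vertex_dofE Tlt _).1 v1).
  by rewrite -ddB; exact: ((vertex_dofE Tlt _).1 v2).
have Ei H : shared T c c' H -> parallel [:: i] H ->
    zero_on H (f c - f c') /\ zero_on H (mderiv l (f c - f c')).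
  move=> sH pH; split.
    apply: (@edge_agree _ _ _ Tlt (k - 1) 1 i _ _ _ _ _ sH pH isT fi kE3 mi).
    by move=> [|//] K _ sK pK; case: (V K sK pK).
  rewrite -ddB; apply: (@edge_agree _ _ _ Tlt (k - 1) 1 i _ _ _ _ _ sH pH isT (dl _ fi) kE3 mi').
  by move=> [|//] K _ sK pK; rewrite /= ddB; case: (V K sK pK).
have Ej H : shared T c c' H -> parallel [:: j] H ->
    zero_on H (f c - f c') /\ zero_on H (mderiv l (f c - f c')).
  move=> sH pH; split.
    apply: (@edge_agree _ _ _ Tlt (k - 1) 1 j _ _ _ _ _ sH pH isT fj kE3 mj).
    by move=> [|//] K _ sK pK; case: (V K sK pK).
  rewrite -ddB; apply: (@edge_agree _ _ _ Tlt (k - 1) 1 j _ _ _ _ _ sH pH isT (dl _ fj) kE3 mj').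
  by move=> [|//] K _ sK pK; rewrite /= ddB; case: (V K sK pK).
have El H : shared T c c' H -> parallel [:: l] H -> zero_on H (f c - f c').
  move=> sH pH.
  apply: (@edge_agree _ _ _ Tlt k 2 l _ _ _ _ _ sH pH isT fl kE4 ml).
  by move=> [|[|//]] K _ sK pK; case: (V K sK pK).
case pi : (par G i); case pj : (par G j); case pl : (par G l).
- have [s1 s2] := sG; rewrite (Tinj s1 s2).
    by rewrite subrr mderiv0; split=> *; rewrite ?peval0 // => ? _; rewrite peval0.
  by move=> d; case: (uniq3 u d) => ->; rewrite ?pi ?pj ?pl.
- split; last by move=> tG; case: (thin2 tG ij).
  have pG : parallel [:: i; j] G by apply: (parallel3 u); rewrite !inE ?eqxx ?orbT ?(negbTE li) ?(negbTE lj).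
  apply: (@face_agree _ _ _ Tlt (k - 1) 1 (k - 1) 1 i j _ _ _ _ _ _ sG ij pG isT isT fi fj kE3 kE3 mij).
  + by move=> [|//] K _ sK pK; case: (Ej K sK pK).
  + by move=> [|//] K _ sK pK; case: (Ei K sK pK).
- split; last by move=> tG; case: (thin2 tG il).
  have pG : parallel [:: i; l] G by apply: (parallel3 u); rewrite !inE ?eqxx ?orbT ?(negbTE ji) ?(negbTE jl).
  apply: (@face_agree _ _ _ Tlt (k - 1) 1 k 2 i l _ _ _ _ _ _ sG il pG isT isT fi fl kE3 kE4 mil).
  + by move=> [|//] K _ sK pK; exact: (El K sK pK).
  + by move=> [|[|//]] K _ sK pK; case: (Ei K sK pK).
- have pG : parallel [:: i] G by apply: (parallel3 u); rewrite !inE ?eqxx ?(negbTE ji) ?(negbTE li).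
  by have [h1 h2] := Ei G sG pG; split.
- split; last by move=> tG; case: (thin2 tG jl).
  have pG : parallel [:: j; l] G by apply: (parallel3 u); rewrite !inE ?eqxx ?orbT ?(negbTE ij) ?(negbTE il).
  apply: (@face_agree _ _ _ Tlt (k - 1) 1 k 2 j l _ _ _ _ _ _ sG jl pG isT isT fj fl kE3 kE4 mjl).
  + by move=> [|//] K _ sK pK; exact: (El K sK pK).
  + by move=> [|[|//]] K _ sK pK; case: (Ej K sK pK).
- have pG : parallel [:: j] G by apply: (parallel3 u); rewrite !inE ?eqxx ?(negbTE ij) ?(negbTE lj).
  by have [h1 h2] := Ej G sG pG; split.
- have z : zero_on G (f c - f c').
    by apply: El => //; apply: (parallel3 u); rewrite !inE ?eqxx ?(negbTE il) ?(negbTE jl).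
  by split=> // _; exact: zero_on_mderiv.
- have pG : parallel [::] G by apply: (parallel3 u).
  by have [h1 h2] := V G sG pG; split.
Qed.

Lemma Sigma_hP (s : mfield R N) : Sigma_h T k s <->
  [/\ forall c, (s c)^T = s c, forall c, Sigma_deg k (s c) &
      forall c c' G, shared T c c' G -> Sigma_trace0 G (s c - s c')].
Proof.
split.
  move=> [sT /Sigma_shapeE dg sd so]; split=> // c c' G sG.
  have rE i j : (s c - s c') i j = (s c - s c') j i.
    by rewrite -[in LHS](sT c) -[in LHS](sT c') !mxE.
  have off i j l : uniq [:: i; j; l] -> zero_on G ((s c - s c') i j) /\
      (thin G -> zero_on G (mderiv l ((s c - s c') i j))).
    move=> u; have [ij _ _ _] := uniq3P u; move: (ij); rewrite neq_ltn => /orP [lt|lt].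
      exact: (Sigma_off_trace dg u (so i j l u lt) sG).
    rewrite rE; have u' := uniq3_swap u.
    exact: (Sigma_off_trace dg u' (so j i l u' lt) sG).
  split=> [i Gi|i j ij|tG i j l u].
  - exact: (Sigma_diag_trace dg (sd i) sG Gi).
  - by have [l u] := uniq3_third ij; case: (off i j l u).
  - by case: (off i j l u) => _; apply.
move=> [sT dg tr]; split; [exact: sT|apply/Sigma_shapeE; exact: dg| |].
- have parE (S : seq 'I_3) G d : parallel S G -> d \in S -> par G d by move=> pG dS; rewrite /par pG.
  move=> i; split=> [|j ji]; apply: (moment_dofI Tlt) => c c' G sG pG; rewrite entryB;
    case: (tr c c' G sG) => h _ _; apply: h; apply: (parE _ _ _ pG); by rewrite inE eqxx.
- move=> i j l u _; have [ij il jl [ji li lj]] := uniq3P u.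
  have z1 c c' G : shared T c c' G -> zero_on G (entry s i j c - entry s i j c').
    by move=> sG; rewrite entryB; case: (tr c c' G sG) => _ + _; apply.
  have z2 (S : seq 'I_3) c c' G : (size S <= 1)%N -> shared T c c' G -> parallel S G ->
      zero_on G (dd l (entry s i j) c - dd l (entry s i j) c').
    move=> S1 sG pG; rewrite ddB entryB; case: (tr c c' G sG) => _ _; apply => //.
    exact: parallel_thin pG.
  split; [split| split|split| |split].
  + by apply/(vertex_dofE Tlt) => c c' G sG _; exact: z1.
  + by apply/(vertex_dofE Tlt) => c c' G sG pG; exact: (z2 [::]).
  + by apply: (moment_dofI Tlt) => c c' G sG _; exact: z1.
  + by apply: (moment_dofI Tlt) => c c' G sG pG; exact: (z2 [:: i]).
  + by apply: (moment_dofI Tlt) => c c' G sG _; exact: z1.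
  + by apply: (moment_dofI Tlt) => c c' G sG pG; exact: (z2 [:: j]).
  + by apply: (moment_dofI Tlt) => c c' G sG _; exact: z1.
  + by apply: (moment_dofI Tlt) => c c' G sG _; exact: z1.
  + by apply: (moment_dofI Tlt) => c c' G sG _; exact: z1.
  + by apply: (moment_dofI Tlt) => c c' G sG _; exact: z1.
Qed.

(** The entry ij is determined on F_il by its moments alone, since the test space has the full
    degrees there. The diagonal climbs from vertices to edges to the faces normal to its index, with
    values as end data. *)
Lemma Xi_hP (t : mfield R N) : Xi_h T k t <->
  [/\ forall c, \tr (t c) = 0, forall c, Xi_deg k (t c) &
      forall c c' G, shared T c c' G -> Xi_trace0 G (t c - t c')].
Proof.
have parE (S : seq 'I_3) G d : parallel S G -> d \in S -> par G d by move=> pG dS; rewrite /par pG.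
split; last first.
  move=> [t0 dg tr]; split; [exact: t0|apply/Xi_shapeE; exact: dg| |].
  - move=> i; split=> [|m|j l u].
    + apply/(vertex_dofE Tlt) => c c' G sG pG; rewrite entryB.
      by case: (tr c c' G sG) => + _ _; apply; exact: parallel_thin pG.
    + apply: (moment_dofI Tlt) => c c' G sG pG; rewrite entryB.
      by case: (tr c c' G sG) => + _ _; apply; exact: parallel_thin pG.
    + apply: (moment_dofI Tlt) => c c' G sG pG; rewrite entryB.
      by case: (tr c c' G sG) => _ + _; apply; first exact: u;
        apply: (parE _ _ _ pG); rewrite !inE eqxx ?orbT.
  - move=> i j l u; apply: (moment_dofI Tlt) => c c' G sG pG; rewrite entryB.
    by case: (tr c c' G sG) => _ _; apply; first exact: u; apply: (parE _ _ _ pG); rewrite !inE eqxx ?orbT.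
move=> [t0 /Xi_shapeE dg td to]; split=> // c c' G sG.
have dD i j d : degle d (k%:Z - 1 + (d == j)%:Z - (d == i)%:Z) (entry t i j c - entry t i j c').
  by rewrite !ffunE; apply: degleB; exact: dg.
have dii i d : degle d (k - 1)%N%:Z (entry t i i c - entry t i i c').
  by apply: degle_le (dD i i d); clear -k3; lia.
have kE3 : k%:Z - 3 = (k - 1)%N%:Z - (2 * 1)%:Z by clear -k3; lia.
have kE2 : k%:Z - 2 = (k - 2)%N%:Z - (2 * 0)%:Z by clear -k3; lia.
have kE1 : k%:Z - 1 = (k - 1)%N%:Z - (2 * 0)%:Z by clear -k3; lia.
have V H i : shared T c c' H -> parallel [::] H -> zero_on H (entry t i i c - entry t i i c').
  by move=> sH pH; have [v1 _ _] := td i; exact: ((vertex_dofE Tlt _).1 v1).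
have E H i m : shared T c c' H -> parallel [:: m] H -> zero_on H (entry t i i c - entry t i i c').
  move=> sH pH; have [_ /(_ m) v2 _] := td i.
  apply: (@edge_agree _ _ _ Tlt (k - 1) 1 m _ _ _ _ _ sH pH isT (dii i m) kE3 v2).
  by move=> [|//] K _ sK pK; exact: V.
have cell i j l : uniq [:: i; j; l] -> par G i -> par G j -> par G l -> t c - t c' = 0.
  move=> u pi pj pl; have [s1 s2] := sG; rewrite (Tinj s1 s2) ?subrr //.
  by move=> d; case: (uniq3 u d) => ->.
split.
- move=> tG i; rewrite -entryB; have [pG|[m pG]|[a [b [l [u pG]]]]|pG] := par_cases G.
  + exact: V.
  + exact: (E G i m).
  + have [ab _ _ _] := uniq3P u.
    by case: (thin2 tG ab); apply: (parE _ _ _ pG); rewrite !inE eqxx ?orbT.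
  + by case: (@thin2 G 0 1 tG).
- move=> i j l u pj pl; have [ij il jl [ji li lj]] := uniq3P u.
  case: (boolP (par G i)) => pi; first by rewrite (cell i j l) // mxE => x _; rewrite peval0.
  have pG : parallel [:: j; l] G.
    apply: (parallel3 u); rewrite ?(negbTE pi) ?pj ?pl !inE ?eqxx ?orbT //.
    by rewrite (negbTE ij) (negbTE il).
  rewrite -entryB; have [_ _ /(_ j l u) v3] := td i.
  apply: (@face_agree _ _ _ Tlt (k - 1) 1 (k - 1) 1 j l _ _ _ _ _ _ sG jl pG isT isT
    (dii i j) (dii i l) kE3 kE3 v3).
  + by move=> [|//] K _ sK pK; exact: (E K i l).
  + by move=> [|//] K _ sK pK; exact: (E K i j).
- move=> i j l u pi pl; have [ij il jl [ji li lj]] := uniq3P u.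
  case: (boolP (par G j)) => pj; first by rewrite (cell i j l) // mxE => x _; rewrite peval0.
  have pG : parallel [:: i; l] G.
    apply: (parallel3 u); rewrite ?(negbTE pj) ?pi ?pl !inE ?eqxx ?orbT //.
    by rewrite (negbTE ji) (negbTE jl).
  have d1 : degle i (k - 2)%N%:Z (entry t i j c - entry t i j c').
    by have := dD i j i; rewrite eqxx (negbTE ij) => h; apply: (degle_le _ h); clear -k3; lia.
  have d2 : degle l (k - 1)%N%:Z (entry t i j c - entry t i j c').
    by have := dD i j l; rewrite (negbTE li) (negbTE lj) => h; apply: (degle_le _ h); clear -k3; lia.
  rewrite -entryB.
  exact: (@face_agree _ _ _ Tlt (k - 2) 0 (k - 1) 0 i l _ _ _ _ _ _ sG il pG isT isT
    d1 d2 kE2 kE1 (to i j l u)).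
Qed.

End MatrixSpaces.

(** * Geometry of the mesh *)

Section Geometry.
Variable R : realType.
Notation pt := 'rV[R]_3.
Implicit Types (i j l d e : 'I_3) (G H : box R) (x y v : pt).

Definition meet G H : box R :=
  Box (\row_d Num.max (lo G 0 d) (lo H 0 d)) (\row_d Num.min (hi G 0 d) (hi H 0 d)).

Lemma meet_set G H x : box_set (meet G H) x <-> box_set G x /\ box_set H x.
Proof.
split=> [h|[h1 h2] d].
  by split=> d; have := h d; rewrite !mxE ge_max le_min => /andP [/andP [h1 h2] /andP [h3 h4]]; apply/andP.
by rewrite !mxE ge_max le_min; have /andP [-> ->] := h1 d; have /andP [-> ->] := h2 d.
Qed.

Lemma box_hi G : valid G -> box_set G (hi G).
Proof. by move=> vG d; rewrite lexx vG. Qed.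

Lemma box_ext G H d : valid G -> valid H -> box_set G = box_set H ->
  lo G 0 d = lo H 0 d /\ hi G 0 d = hi H 0 d.
Proof.
move=> vG vH E.
have h1 : box_set H (lo G) by rewrite -E; exact: box_lo.
have h2 : box_set H (hi G) by rewrite -E; exact: box_hi.
have h3 : box_set G (lo H) by rewrite E; exact: box_lo.
have h4 : box_set G (hi H) by rewrite E; exact: box_hi.
move: (h1 d) (h2 d) (h3 d) (h4 d) => /andP [? ?] /andP [? ?] /andP [? ?] /andP [? ?].
by split; apply/eqP; rewrite eq_le; apply/andP; split.
Qed.

Lemma box_interior G x : (forall d, lo G 0 d < x 0 d < hi G 0 d) -> interior (box_set G) x.
Proof.
move=> h; apply/nbhs_near; exists (\big[Num.min/1]_d Num.min (x 0 d - lo G 0 d) (hi G 0 d - x 0 d)).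
  by apply: lt_bigmin => // d _; have /andP [h1 h2] := h d; rewrite lt_min !subr_gt0 h1.
move=> y ny d; have := ny d.
have /= le1 := @bigmin_le_cond _ _ _ 1 d predT (fun d => Num.min (x 0 d - lo G 0 d) (hi G 0 d - x 0 d)) isT.
move=> lt1; have := lt_le_trans lt1 le1; rewrite lt_min ltr_norml.
by rewrite ltr_norml => /andP [/andP [? ?] /andP [? ?]]; apply/andP; split; lra.
Qed.

Definition adj (a a' b b' : R) : Prop := [\/ a = b /\ a' = b', a' = b | b' = a].

(** Among three intervals that pairwise coincide or abut, two must coincide; so the common part is a
    whole interval or an end of it. *)
Lemma ends3 (a a' b b' c c' : R) : a < a' -> b < b' -> c < c' ->
  adj a a' b b' -> adj a a' c c' -> adj b b' c c' ->
  [\/ Num.max (Num.max a b) c = a /\ Num.min (Num.min a' b') c' = a',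
      Num.max (Num.max a b) c = a /\ Num.min (Num.min a' b') c' = a |
      Num.max (Num.max a b) c = a' /\ Num.min (Num.min a' b') c' = a'].
Proof.
move=> m1 m2 m3 ab ac bc.
have [l1 l2 l3] : [/\ a <= a', b <= b' & c <= c'] by rewrite !ltW.
case: ab => [[E E']|E|E]; [rewrite -E -E' maxxx minxx|rewrite -E|].
- case: ac => [[E2 E2']|E2|E2]; rewrite -?E2 -?E2' ?maxxx ?minxx; first exact: Or31.
    by apply: Or33; rewrite (max_r l1) min_l // E2.
  by apply: Or32; rewrite E2 (min_r l1) max_l // -E2.
- have le : a' <= b' by rewrite E.
  rewrite (max_r l1) (min_l le); apply: Or33.
  case: ac => [[E2 E2']|E2|E2]; rewrite -?E2 -?E2' ?maxxx ?minxx ?(max_l l1) //; first by rewrite min_l // E2.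
  by exfalso; case: bc => [[? ?]|?|?]; lra.
- have le : b <= a by rewrite -E.
  have le' : b' <= a' by rewrite E.
  rewrite (max_l le) (min_r le'); apply: Or32.
  rewrite E; case: ac => [[E2 E2']|E2|E2].
  + by rewrite -E2 -E2' maxxx min_l.
  + by exfalso; case: bc => [[? ?]|?|?]; lra.
  + by rewrite E2 minxx max_l // -E2.
Qed.

Variables (Omega : set pt) (N : nat) (T : 'I_N -> box R).
Hypothesis hT : cuboid_mesh Omega T.
Implicit Types (a b c : 'I_N).

Lemma mesh_lt c i : lo (T c) 0 i < hi (T c) 0 i.
Proof. by case: hT. Qed.

Lemma mesh_valid c : valid (T c).
Proof. by move=> i; exact/ltW/mesh_lt. Qed.

Lemma subentity_self G : subentity G G.
Proof. by move=> d; apply: Or31. Qed.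

(** The face-to-face condition read one coordinate at a time. The intersection of the cells is a
    subentity of both; comparing its ends with theirs leaves only equal or abutting intervals, since
    cells are nondegenerate. *)
Lemma touch_dir c c' d : touch T c c' ->
  [\/ lo (T c) 0 d = lo (T c') 0 d /\ hi (T c) 0 d = hi (T c') 0 d,
      hi (T c) 0 d = lo (T c') 0 d | hi (T c') 0 d = lo (T c) 0 d].
Proof.
case: (eqVneq c c') => [<- _|cc]; first exact: Or31.
move=> [x [x1 x2]]; case: hT => _ _ _ /(_ _ _ cc) [E|[G [s1 s2 E]]].
  by have : (box_set (T c) `&` box_set (T c')) x by []; rewrite E.
have vG : valid G := subentity_valid (@mesh_valid c) s1.
have vM : valid (meet (T c) (T c')).
  by move=> e; have /andP [] := (meet_set (T c) (T c') x).2 (conj x1 x2) e; apply: le_trans.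
have EM : box_set G = box_set (meet (T c) (T c')).
  by rewrite -E; apply/seteqP; split=> y /meet_set.
have [] := box_ext d vG vM EM; rewrite !mxE => E1 E2.
move: (s1 d) (s2 d); rewrite E1 E2; clear E1 E2.
case=> [[F1 F2]|[F1 F2]|[F1 F2]]; case=> [[H1 H2]|[H1 H2]|[H1 H2]].
- by apply: Or31; rewrite -F1 -F2.
- by apply: Or32; rewrite -F2.
- by apply: Or33; rewrite -F1.
- by apply: Or33; rewrite -F2.
- have : lo (T c) 0 d < Num.min (hi (T c) 0 d) (hi (T c') 0 d).
    by rewrite lt_min mesh_lt -F1 H1 mesh_lt.
  by rewrite F2 ltxx.
- by apply: Or33; rewrite -F1.
- by apply: Or32; rewrite -F1.
- by apply: Or32; rewrite -F1.
- have : Num.max (lo (T c) 0 d) (lo (T c') 0 d) < hi (T c) 0 d.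
    by rewrite gt_max mesh_lt -F2 H2 mesh_lt.
  by rewrite F1 ltxx.
Qed.

Lemma meet_dir c c' d : touch T c c' -> let M := meet (T c) (T c') in
  [\/ [/\ lo (T c) 0 d = lo (T c') 0 d, hi (T c) 0 d = hi (T c') 0 d,
          lo M 0 d = lo (T c) 0 d & hi M 0 d = hi (T c) 0 d],
      [/\ hi (T c) 0 d = lo (T c') 0 d, lo M 0 d = hi (T c) 0 d & hi M 0 d = hi (T c) 0 d] |
      [/\ hi (T c') 0 d = lo (T c) 0 d, lo M 0 d = lo (T c) 0 d & hi M 0 d = lo (T c) 0 d]].
Proof.
move=> /(touch_dir d) t M; rewrite !mxE; have m := mesh_lt c d; have m' := mesh_lt c' d.
case: t => [[E1 E2]|E|E].
- by apply: Or31; rewrite -E1 -E2 maxxx minxx.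
- apply: Or32; rewrite -E; split=> //; first by apply: max_r; exact: ltW.
  by apply: min_l; rewrite E; exact: ltW.
- apply: Or33; rewrite -E; split=> //; first by apply: max_l; rewrite E -?E; exact: ltW.
  by apply: min_r; rewrite E; exact: ltW.
Qed.

Lemma meet_sub c c' : touch T c c' ->
  subentity (T c) (meet (T c) (T c')) /\ subentity (T c') (meet (T c) (T c')).
Proof.
move=> t; split=> d; case: (meet_dir d t) => [[E1 E2 -> ->]|[E -> ->]|[E -> ->]].
- exact: Or31.
- exact: Or33.
- exact: Or32.
- by rewrite E1 E2; apply: Or31.
- by rewrite E; apply: Or32.
- by rewrite -E; apply: Or33.
Qed.

Lemma shared_touch c c' G : shared T c c' G -> touch T c c'.
Proof.
move=> [s1 s2]; exists (lo G).
by split; apply: subentity_set; [exact: mesh_valid|exact: s1| |exact: mesh_valid|exact: s2|];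
  apply: box_lo; apply: subentity_valid s1; exact: mesh_valid.
Qed.

Lemma shared_meet c c' G : shared T c c' G -> subentity (meet (T c) (T c')) G.
Proof.
move=> sG d; have t := shared_touch sG; case: sG => s1 s2.
move: (s1 d) (s2 d) (mesh_lt c d) (mesh_lt c' d).
case: (meet_dir d t) => [[E1 E2 -> ->]|[E -> ->]|[E -> ->]]; first by [];
  case=> [[-> ->]|[-> ->]|[-> ->]]; case=> [[? ?]|[? ?]|[? ?]] *;
  first [exfalso; lra|apply: Or31; split; lra].
Qed.

Lemma sub_shared c c' G : touch T c c' -> subentity (meet (T c) (T c')) G -> shared T c c' G.
Proof. by move=> /meet_sub [h1 h2] s; split; apply: subentity_trans s. Qed.

Lemma meet3_sub a b c : touch T a b -> touch T a c -> touch T b c ->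
  let G := meet (meet (T a) (T b)) (T c) in
  [/\ subentity (T a) G, subentity (T b) G & subentity (T c) G].
Proof.
move=> ab ac bc G; split=> d; rewrite /G /meet /= !mxE; last rewrite maxC minC;
  [|rewrite [Num.max (lo (T a) 0 d) _]maxC [Num.min (hi (T a) 0 d) _]minC|rewrite maxA minA].
- exact: ends3 (mesh_lt a d) (mesh_lt b d) (mesh_lt c d) (touch_dir d ab) (touch_dir d ac) (touch_dir d bc).
- exact: ends3 (mesh_lt b d) (mesh_lt a d) (mesh_lt c d) (touch_dir d (touch_sym ab))
    (touch_dir d bc) (touch_dir d ac).
- exact: ends3 (mesh_lt c d) (mesh_lt a d) (mesh_lt b d) (touch_dir d (touch_sym ac))
    (touch_dir d (touch_sym bc)) (touch_dir d ab).
Qed.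

(** Overlap in every direction excludes abutting, so all intervals coincide and the centre would be
    interior to two distinct cells. *)
Lemma overlap_eq c c' : (forall d, lo (T c) 0 d < hi (T c') 0 d /\ lo (T c') 0 d < hi (T c) 0 d) ->
  c = c'.
Proof.
move=> h; apply/eqP/negPn/negP => cc.
have t : touch T c c' by apply: (touchP hT) => d; have [h1 h2] := h d; split; exact: ltW.
pose x : pt := \row_d ((lo (T c) 0 d + hi (T c) 0 d) / 2).
have xc : interior (box_set (T c)) x.
  by apply: box_interior => d; rewrite mxE; have := mesh_lt c d => ?; apply/andP; split; lra.
have xc' : interior (box_set (T c')) x.
  apply: box_interior => d; rewrite mxE; have := mesh_lt c d => ?; have [? ?] := h d.
  by case: (touch_dir d t) => [[? ?]|?|?]; apply/andP; split; lra.
case: hT => _ _ /(_ _ _ cc) E _.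
by have : (interior (box_set (T c)) `&` interior (box_set (T c'))) x by []; rewrite E.
Qed.

Lemma mesh_inj c c' G : subentity (T c) G -> subentity (T c') G -> (forall d, par G d) -> c = c'.
Proof.
move=> s1 s2 pG; apply: overlap_eq => d.
have [<- <-] := subentity_par s1 (pG d); have [h1 h2] := subentity_par s2 (pG d).
by split; [rewrite -h2|rewrite -h1]; exact: pG.
Qed.

Definition common (s : seq 'I_N) x : Prop := forall c, c \in s -> box_set (T c) x.

(** Helly's theorem for boxes: in each coordinate the largest lower end is below every upper end. It
    turns pairwise touching cells into cells with a common point, where cocycle relations are
    evaluated. *)
Lemma helly (s : seq 'I_N) : s != [::] ->
  (forall a b, a \in s -> b \in s -> touch T a b) -> exists x, common s x.
Proof.
case: s => // c0 s _ h; exists (\row_d \big[Num.max/lo (T c0) 0 d]_(c <- s) lo (T c) 0 d).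
move=> c cs d; rewrite mxE; apply/andP; split.
  move: cs; rewrite inE => /orP [/eqP ->|cs]; first by exact: bigmax_ge_id.
  by apply: le_bigmax_seq cs _.
have le a : a \in c0 :: s -> lo (T a) 0 d <= hi (T c) 0 d.
  move=> /h /(_ cs) [x [/(_ d) /andP [h1 _] /(_ d) /andP [_ h2]]]; exact: le_trans h1 h2.
rewrite big_seq; apply: bigmax_le; first by apply: le; rewrite mem_head.
by move=> a as_; apply: le; rewrite inE as_ orbT.
Qed.

Definition adjacent d c c' : Prop := hi (T c) 0 d = lo (T c') 0 d /\
  forall e, e != d -> lo (T c) 0 e = lo (T c') 0 e /\ hi (T c) 0 e = hi (T c') 0 e.

Lemma adjacent_injr d c c1 c2 : adjacent d c c1 -> adjacent d c c2 -> c1 = c2.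
Proof.
move=> [h1 h1'] [h2 h2']; apply: overlap_eq => e; have m1 := mesh_lt c1 e; have m2 := mesh_lt c2 e.
have m := mesh_lt c e.
case: (eqVneq e d) => [E|ed]; first by subst e; split; lra.
by have [? ?] := h1' e ed; have [? ?] := h2' e ed; split; lra.
Qed.

Lemma adjacent_injl d c c1 c2 : adjacent d c1 c -> adjacent d c2 c -> c1 = c2.
Proof.
move=> [h1 h1'] [h2 h2']; apply: overlap_eq => e; have m1 := mesh_lt c1 e; have m2 := mesh_lt c2 e.
have m := mesh_lt c e.
case: (eqVneq e d) => [E|ed]; first by subst e; split; lra.
by have [? ?] := h1' e ed; have [? ?] := h2' e ed; split; lra.
Qed.

Lemma shared_adjacent d c c' G : c != c' -> shared T c c' G -> (forall e, e != d -> par G e) ->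
  [/\ lo G 0 d = hi G 0 d & (adjacent d c c' /\ lo G 0 d = hi (T c) 0 d) \/
                             (adjacent d c' c /\ lo G 0 d = lo (T c) 0 d)].
Proof.
move=> cc sG pG; have t := shared_touch sG; have M := shared_meet sG.
case: sG => s1 s2.
have E e : e != d -> lo (T c) 0 e = lo (T c') 0 e /\ hi (T c) 0 e = hi (T c') 0 e.
  by move=> /pG pe; have [<- <-] := subentity_par s1 pe; have [] := subentity_par s2 pe.
have m := mesh_lt c d; have m' := mesh_lt c' d.
case: (meet_dir d t) => [[h1 h2 _ _]|[h E1 E2]|[h E1 E2]].
- exfalso; move/eqP: cc; apply; apply: overlap_eq => e; have := mesh_lt c e; have := mesh_lt c' e.
  by case: (eqVneq e d) => [->|/E [-> ->]]; [rewrite h1 h2|].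
- have mh : lo G 0 d = hi (T c) 0 d /\ hi G 0 d = hi (T c) 0 d.
    by case: (M d) => [[-> ->]|[-> ->]|[-> ->]]; rewrite ?E1 ?E2.
  by case: mh => -> ->; split=> //; left.
- have mh : lo G 0 d = lo (T c) 0 d /\ hi G 0 d = lo (T c) 0 d.
    by case: (M d) => [[-> ->]|[-> ->]|[-> ->]]; rewrite ?E1 ?E2.
  case: mh => -> ->; split=> //; right; split=> //; split=> // e /E [-> ->] //.
Qed.

Lemma adjacent_shared d c c' : adjacent d c c' ->
  shared T c c' (slab (T c) d (hi (T c) 0 d)).
Proof.
move=> [h h']; split; first by apply: slab_sub; right.
move=> e; case: (eqVneq e d) => [->|ed]; first by rewrite !upd_same; apply: Or32.
by rewrite !upd_other //; apply: Or31; exact: h'.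
Qed.

Lemma open_step d x (s : bool) : open Omega -> Omega x -> forall e : R, 0 < e ->
  exists2 r : R, 0 < r < e & Omega (upd x d (x 0 d + (-1) ^+ s * r)).
Proof.
move=> oO Ox e e0; have /nbhs_near [r r0 nr] : nbhs x Omega by apply: open_nbhs_nbhs.
have m0 : 0 < Num.min r e by rewrite lt_min r0.
have mr : Num.min r e <= r by rewrite ge_min lexx.
have me : Num.min r e <= e by rewrite ge_min lexx orbT.
exists (Num.min r e / 2); first by apply/andP; split; lra.
apply: nr => i; rewrite mxE; case: eqP => [->|_]; last by rewrite subrr normr0.
rewrite opprD addNKr normrN normrM normrX normrN1 expr1n mul1r ger0_norm; lra.
Qed.

(** A short step out of c through the face stays in Omega, hence lands in some cell, which touches c
    if the step is small. In the other directions x is strictly inside, so the intervals of the two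
    cells must coincide there. *)
Lemma inside_adjacent d c x : open Omega -> Omega x ->
  (forall e, e != d -> lo (T c) 0 e < x 0 e < hi (T c) 0 e) ->
  (x 0 d = hi (T c) 0 d -> exists c', adjacent d c c') /\
  (x 0 d = lo (T c) 0 d -> exists c', adjacent d c' c).
Proof.
move=> oO Ox ins; have [e e0 te] := touch_near hT.
have m := mesh_lt c d.
have cx : x 0 d = hi (T c) 0 d \/ x 0 d = lo (T c) 0 d -> box_set (T c) x.
  move=> h i; case: (eqVneq i d) => [->|/ins /andP [? ?]]; first by case: h => ->; rewrite lexx ltW.
  by rewrite !ltW.
have step (s : bool) : x 0 d = hi (T c) 0 d \/ x 0 d = lo (T c) 0 d ->
  exists c' r, [/\ 0 < r, box_set (T c') (upd x d (x 0 d + (-1) ^+ s * r)), touch T c c' &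
    forall i, i != d -> lo (T c) 0 i = lo (T c') 0 i /\ hi (T c) 0 i = hi (T c') 0 i].
  move=> h; have [r /andP [r0 re] Or] := open_step d s oO Ox e0.
  have /(in_meshE hT) [c' yc'] := subset_closure Or.
  have t : touch T c c'.
    apply: (te _ _ x _ (cx h) yc') => i; rewrite mxE; case: eqP => [->|_]; last by rewrite subrr normr0.
    by rewrite opprD addNKr normrN normrM normrX normrN1 expr1n mul1r ger0_norm // ltW.
  exists c', r; split=> // i id'; have /andP [? ?] := ins i id'.
  by have := yc' i; rewrite upd_other // => /andP [? ?]; case: (touch_dir i t) => [//|?|?]; exfalso; lra.
split=> h.
- have [|c' [r [r0 yc' t E]]] := step false; first by left.
  exists c'; split=> //; have := yc' d; rewrite upd_same expr0 mul1r => /andP [? ?].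
  have ? := mesh_lt c' d.
  by case: (touch_dir d t) => [[? ?]|//|?]; exfalso; lra.
- have [|c' [r [r0 yc' t E]]] := step true; first by right.
  exists c'; split; last by move=> i /E [-> ->].
  have := yc' d; rewrite upd_same expr1 mulN1r => /andP [? ?].
  have ? := mesh_lt c' d.
  by case: (touch_dir d t) => [[? ?]|?|//]; exfalso; lra.
Qed.

End Geometry.

(** * Exactness *)

Section Affine.
Variable R : realType.
Notation pol := (mpoly 3 R).
Notation pt := 'rV[R]_3.
Implicit Types (p q f g u w : pol) (i j l d e : 'I_3) (G H : box R) (x y v : pt) (s t : 'M[pol]_3).

(** [None] indexes the constant term. Affine functions are handled by their coefficients, so that
    the real-valued Cech lemmas apply to one coefficient at a time. *)
Definition coefs := option 'I_3 -> R.

Definition aff (c : coefs) : pol :=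
  mpolyC 3 (c None) + \sum_d mpolyC 3 (c (Some d)) * mpolyX R (mnm1 d).

Lemma peval_aff c x : peval (aff c) x = c None + \sum_d c (Some d) * x 0 d.
Proof.
by rewrite pevalD pevalC peval_sum; congr (_ + _); apply: eq_bigr => d _; rewrite pevalM pevalC pevalX.
Qed.

Lemma mderiv_aff c d : mderiv d (aff c) = mpolyC 3 (c (Some d)).
Proof.
have X e : mderiv d (mpolyX R (mnm1 e)) = mpolyC 3 (d == e)%:R.
  by rewrite -(mderiv_linear d e 0) mpolyC0 subr0.
rewrite mderivD mderivC add0r raddf_sum (bigD1 d) //= big1 ?addr0 => [|e ed];
  rewrite mderivM mderivC mul0r add0r X ?eqxx ?mulr1 //.
by rewrite eq_sym (negbTE ed) mulr0.
Qed.

Lemma hess1_aff c : hess1 (aff c) = 0.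
Proof. by apply/matrixP => i j; rewrite !mxE mderiv_aff mderivC. Qed.

Lemma affB c c' : aff (fun o => c o - c' o) = aff c - aff c'.
Proof.
apply: peval_inj => x; rewrite pevalB !peval_aff opprD addrACA -sumrB; congr (_ + _).
by apply: eq_bigr => d _; rewrite mulrBl.
Qed.

Lemma affD c c' : aff (fun o => c o + c' o) = aff c + aff c'.
Proof.
apply: peval_inj => x; rewrite pevalD !peval_aff addrACA -big_split; congr (_ + _).
by apply: eq_bigr => d _; rewrite mulrDl.
Qed.

Lemma aff_deg k c : (1 <= k)%N -> U_deg k (aff c).
Proof.
move=> k1 d; rewrite /aff; apply: degleD.
  by apply: (degle_le _ (@degleC R d (c None))); lia.
apply: degle_sum => e _; apply: (degle_le _ (degleM (@degleC R d (c (Some e))) (@degleX R d e))).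
by case: eqP; lia.
Qed.

Lemma U_trace0P G w : U_trace0 G w <-> forall x, box_set G x -> jet0 w x.
Proof. by split=> [h x Gx b|h b x Gx]; [exact: h|exact: h]. Qed.

Lemma jet0E w x : jet0 w x -> peval w x = 0 /\ forall d, peval (mderiv d w) x = 0.
Proof.
move=> h; pose G := Box x x.
have Gx : box_set G x by move=> d; rewrite !lexx.
have /U_trace0E [h0 h1 _ _] : U_trace0 G w.
  move=> b y Gy; suff -> : y = x by exact: h.
  by apply/rowP => d; apply/eqP; rewrite eq_le andbC; exact: Gy.
by split=> [|d]; [exact: h0|exact: h1].
Qed.

Lemma aff_jet0 c x : jet0 (aff c) x -> forall o, c o = 0.
Proof.
move=> /jet0E [h0 h1].
have h d : c (Some d) = 0 by have := h1 d; rewrite mderiv_aff pevalC.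
case=> [d|]; first exact: h.
by move: h0; rewrite peval_aff big1 ?addr0 // => d _; rewrite h mul0r.
Qed.

(** The first-order Taylor polynomial of w at x, expanded about the origin. *)
Definition taylor x w : coefs := fun o =>
  if o is Some d then peval (mderiv d w) x
  else peval w x - \sum_d peval (mderiv d w) x * x 0 d.

Lemma taylorP x w : peval (w - aff (taylor x w)) x = 0 /\
  forall d, peval (mderiv d (w - aff (taylor x w))) x = 0.
Proof.
by split=> [|d]; rewrite ?mderivB pevalB ?mderiv_aff ?pevalC ?subrr // peval_aff /= subrK subrr.
Qed.

Lemma hess0_aff w : hess1 w = 0 -> exists c, w = aff c.
Proof.
move=> h; exists (taylor 0 w); apply/eqP; rewrite -subr_eq0; apply/eqP.
have [h0 h1] := taylorP 0 w.
have r0 : hess1 (w - aff (taylor 0 w)) = 0 by rewrite hess1B h hess1_aff subrr.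
apply: peval_inj => x; rewrite peval0.
(* Any box containing both 0 and x serves; on it w minus its Taylor polynomial at 0 vanishes by
   [hess_trace_inj]. *)
pose G : box R := Box (\row_d - `|x 0 d|) (\row_d `|x 0 d|).
have G0 : box_set G 0 by move=> d; rewrite !mxE oppr_le0 !normr_ge0.
have Gx : box_set G x by move=> d; rewrite !mxE -ler_norml.
have S0 : Sigma_trace0 G (hess1 (w - aff (taylor 0 w))).
  by rewrite r0; split=> *; rewrite mxE ?mderiv0; move=> y _; rewrite peval0.
by have /U_trace0P /(_ x Gx) /jet0E [] := hess_trace_inj S0 G0 h0 h1.
Qed.

Lemma P1E p : P1 p <-> forall m, m \in msupp p -> (mdeg m <= 1)%N.
Proof.
rewrite /P1 /= mmeasureE; split=> [/bigmax_leqP_seq h m mp|h]; first by have := h m mp isT.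
by apply/bigmax_leqP_seq => m mp _; exact: h.
Qed.

Lemma P1_aff p : P1 p <-> exists c, p = aff c.
Proof.
rewrite P1E; split=> [h|[c ->]].
  apply: hess0_aff; apply/matrixP => i j; rewrite !mxE; apply/mpolyP => m.
  rewrite !mcoeff_mderiv mcoeff0.
  suff /eqP -> : mcoeff (mnm_add (mnm_add m (mnm1 i)) (mnm1 j)) p == 0 by rewrite !mul0rn.
  by rewrite mcoeff_eq0; apply/negP => /h; rewrite !mdegD !mdeg1; lia.
move=> m; apply: contraTT; rewrite -ltnNge => h; rewrite -mcoeff_eq0 mcoeffD mcoeffC raddf_sum /= big1.
  have /negbTE -> : m != mnm0 by apply: contraTneq h => ->; rewrite mdeg0.
  by rewrite mulr0 addr0.
move=> d _; rewrite mcoeffCM mcoeffX.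
have /negbTE -> : mnm1 d != m by apply: contraTneq h => <-; rewrite mdeg1.
by rewrite mulr0.
Qed.

Lemma Sigma_trace0D G s t : Sigma_trace0 G s -> Sigma_trace0 G t -> Sigma_trace0 G (s + t).
Proof.
move=> [s1 s2 s3] [t1 t2 t3]; split=> [i Gi|i j ij|tG i j l u] x Gx; rewrite mxE ?mderivD pevalD.
- by rewrite s1 ?t1 ?addr0.
- by rewrite s2 ?t2 ?addr0.
- by rewrite (s3 tG _ _ _ u) // (t3 tG _ _ _ u) // addr0.
Qed.

Lemma Sigma_trace0N G s : Sigma_trace0 G s -> Sigma_trace0 G (- s).
Proof.
move=> [s1 s2 s3]; split=> [i Gi|i j ij|tG i j l u] x Gx; rewrite mxE ?mderivN pevalN.
- by rewrite s1 ?oppr0.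
- by rewrite s2 ?oppr0.
- by rewrite (s3 tG _ _ _ u) // oppr0.
Qed.

Lemma Xi_trace00 G : Xi_trace0 G 0.
Proof. by split=> *; rewrite mxE; move=> y _; rewrite peval0. Qed.

Lemma U_trace00 G : U_trace0 G 0.
Proof.
apply: U_trace0I; first by move=> x _; rewrite peval0.
- by move=> d x _; rewrite mderiv0 peval0.
- by move=> i j _ x _; rewrite !mderiv0 peval0.
- by move=> x _; rewrite !mderiv0 peval0.
Qed.

Lemma zero_on_full G f : (forall d, par G d) -> zero_on G f -> f = 0.
Proof.
move=> pG h.
have h2 x : (forall d, d != 2 -> lo G 0 d <= x 0 d <= hi G 0 d) -> peval f x = 0.
  move=> hx; rewrite -(upd_id x 2); apply: (all_line (pG 2)) => t tG; apply: h => d.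
  by rewrite mxE; case: eqVneq => [->|/hx].
have h1 x : lo G 0 0 <= x 0 0 <= hi G 0 0 -> peval f x = 0.
  move=> hx; rewrite -(upd_id x 1); apply: (all_line (pG 1)) => r rG; apply: h2 => d.
  by rewrite mxE; case: eqVneq => [->|]; elim/ord3P: d.
apply: peval_inj => x; rewrite peval0 -(upd_id x 0).
by apply: (all_line (pG 0)) => t tG; apply: h1; rewrite upd_same.
Qed.

Lemma hess_potential_full k G s : (3 <= k)%N -> (forall d, par G d) -> s^T = s -> Sigma_deg k s ->
  curl1 s = 0 -> exists2 u, U_deg k u & s = hess1 u.
Proof.
move=> k3 pG sT dg s0; have lh d : lo G 0 d <= hi G 0 d := ltW (pG d).
have [|u [du hu]] := hess_potential k3 lh sT dg.
  by move=> G' _; rewrite s0; exact: Xi_trace00.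
exists u => //; apply/eqP; rewrite -subr_eq0; apply/eqP/matrixP => i j; rewrite [RHS]mxE.
have [h1 h2 _] := hu G (@subentity_self _ G).
by case: (eqVneq i j) => [<-|ij]; apply: (zero_on_full pG); [exact: h1|exact: h2].
Qed.

Lemma hess_aff_trace G w x : Sigma_trace0 G (hess1 w) -> box_set G x ->
  U_trace0 G (w - aff (taylor x w)).
Proof.
move=> h Gx; have [h0 h1] := taylorP x w.
by apply: (hess_trace_inj _ Gx h0 h1); rewrite hess1B hess1_aff subr0.
Qed.

Lemma hess_deg k u : U_deg k u -> Sigma_deg k (hess1 u).
Proof.
move=> dg i j d; rewrite hess1E.
have := degle_mderivE (i := i) (degle_mderivE (i := j) (dg d)).
by apply: degle_le; lia.
Qed.

Lemma curl_deg k s : Sigma_deg k s -> Xi_deg k (curl1 s).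
Proof.
(* The directions j, j + 1, j + 2 exhaust all three, so the two terms of the curl have the same
   degrees. *)
move=> dg i j d; have E : (d == j)%:Z + (d == j + 1)%:Z + (d == j + 2)%:Z = 1 :> int.
  by move: j d; elim/ord3P; elim/ord3P.
rewrite mxE; apply: degleB.
  have := degle_mderivE (i := j + 1) (dg i (j + 2) d); apply: degle_le.
  by lia.
have := degle_mderivE (i := j + 2) (dg i (j + 1) d); apply: degle_le.
lia.
Qed.

Lemma curl_trace_free s : s^T = s -> \tr (curl1 s) = 0.
Proof.
move=> sT; have E i j : s i j = s j i by rewrite -[in LHS]sT mxE.
have [[c00 _ _] [_ c11 _] [_ _ c22]] := curl1E s.
by rewrite trace3 c00 c11 c22 (E 1 0) (E 2 0) (E 2 1); ring.
Qed.

Lemma div_curl s : div1 (curl1 s) = 0.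
Proof.
have [[c00 c01 c02] [c10 c11 c12] [c20 c21 c22]] := curl1E s.
apply/rowP; elim/ord3P; rewrite div1E ?c00 ?c01 ?c02 ?c10 ?c11 ?c12 ?c20 ?c21 ?c22 !mderivB mxE;
  rewrite (mderiv_comm 1 0) (mderiv_comm 2 0) (mderiv_comm 2 1); ring.
Qed.

Lemma div_deg k t : Xi_deg k t -> Q_deg k (div1 t).
Proof.
move=> dg i d; rewrite mxE; apply: degle_sum => j _.
by apply: degle_le (degle_mderivE (i := j) (dg i j d)); lia.
Qed.

End Affine.

Lemma choice2 (A B C : Type) (P : A -> B -> C -> Prop) :
  (forall a b, exists c, P a b c) -> exists f, forall a b, P a b (f a b).
Proof.
move=> h; have [f fP] := choice (fun ab : A * B => h ab.1 ab.2).
by exists (fun a b => f (a, b)) => a b; exact: (fP (a, b)).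
Qed.

Lemma choice3 (A B C D : Type) (P : A -> B -> C -> D -> Prop) :
  (forall a b c, exists d, P a b c d) -> exists f, forall a b c, P a b c (f a b c).
Proof.
move=> h; have [f fP] := choice (fun t : A * B * C => h t.1.1 t.1.2 t.2).
by exists (fun a b c => f (a, b, c)) => a b c; exact: (fP (a, b, c)).
Qed.

(** * The three kernels, by gluing local potentials *)

Section Exactness.
Variable R : realType.
Notation pol := (mpoly 3 R).
Notation pt := 'rV[R]_3.
Variables (Omega : set pt) (N : nat) (T : 'I_N -> box R) (k : nat).
Hypothesis hOmega : contractible_lipschitz_domain Omega.
Hypothesis hT : cuboid_mesh Omega T.
Hypothesis k3 : (3 <= k)%N.
Implicit Types (p q f g : pol) (i j l d e : 'I_3) (G H : box R) (x y v : pt) (a b c : 'I_N).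
Implicit Types (u : sfield R N) (s t : mfield R N).

Let Tlt := mesh_lt hT.
Let Tinj := @mesh_inj _ _ _ _ hT.

Let touch_refl a : touch T a a.
Proof. by exists (lo (T a)); split; exact/box_lo/(mesh_valid hT). Qed.

(** The intersection of two touching cells is itself a shared subentity, so agreement on all shared
    subentities can be tested pointwise. *)
Lemma U_jetP u : U_h T k u <-> (forall a, U_deg k (u a)) /\
  forall a b x, box_set (T a) x -> box_set (T b) x -> jet0 (u a - u b) x.
Proof.
rewrite (U_hP Tlt Tinj k); split=> [[dg h]|[dg h]]; split=> //.
  move=> a b x ax bx; have t : touch T a b by exists x.
  have /U_trace0P := h a b _ (meet_sub hT t); apply; exact/meet_set.
move=> a b G sG; apply/U_trace0P => x Gx.
by apply: h; [apply: (subentity_set _ sG.1 Gx)|apply: (subentity_set _ sG.2 Gx)] => d; exact/ltW/Tlt.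
Qed.

Lemma global_U p : P1 p -> U_h T k (global N p).
Proof.
move=> /P1_aff [c ->]; apply/U_jetP; split=> [a|a b x _ _]; rewrite !ffunE.
  by apply: aff_deg; lia.
by rewrite subrr => m; move: (@U_trace00 R (Box x x) m x); apply => d; rewrite !lexx.
Qed.

Lemma hess_Sigma u : U_h T k u -> Sigma_h T k (hess u).
Proof.
move=> /(U_hP Tlt Tinj k) [dg h]; apply/(Sigma_hP Tlt Tinj k3); split=> [c|c|a b G sG]; rewrite !ffunE.
- exact: hess1T.
- exact: hess_deg.
- by rewrite -hess1B; apply: hess_trace; exact: h.
Qed.

Lemma curl_Xi s : Sigma_h T k s -> Xi_h T k (curl s).
Proof.
move=> /(Sigma_hP Tlt Tinj k3) [sT dg h]; apply/(Xi_hP Tlt Tinj k3); split=> [c|c|a b G sG]; rewrite !ffunE.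
- exact: curl_trace_free.
- exact: curl_deg.
- by rewrite -curl1B; apply: curl_trace (h a b G sG); rewrite raddfB /= !sT.
Qed.

Lemma div_Q t : Xi_h T k t -> Q_h k (divm t).
Proof.
move=> /(Xi_hP Tlt Tinj k3) [_ dg _]; apply/(Q_shapeE k3) => c; rewrite ffunE; exact: div_deg.
Qed.

Lemma hess_kernel u : U_h T k u -> hess u = 0 -> exists2 p, P1 p & u = global N p.
Proof.
move=> /U_jetP [dg h] /ffunP u0.
have /choice [r rP] c : exists r, u c = aff r.
  by apply: hess0_aff; have := u0 c; rewrite !ffunE.
have [e [M [g [c0 [e0 hg]]]]] := mesh_contraction hT hOmega.
have Tle c i : lo (T c) 0 i <= hi (T c) 0 i by exact/ltW/Tlt.
have rE : forall a b, r a = r b.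
  apply: (cech0 e0 Tle hg) => a b [x [ax bx]]; apply/funext => o; apply/eqP.
  rewrite -subr_eq0; apply/eqP; have := h a b x ax bx; rewrite !rP -affB => /aff_jet0; exact.
exists (u c0); first by apply/P1_aff; exists (r c0).
by apply/ffunP => c; rewrite !ffunE !rP (rE c c0).
Qed.

Lemma aff_deg3 (r : coefs R) : U_deg k (aff r).
Proof. by apply: aff_deg; lia. Qed.

Lemma jet0_aff_unique x (w1 w2 : pol) (c : coefs R) :
  jet0 w1 x -> jet0 w2 x -> w1 - w2 = aff c -> forall o, c o = 0.
Proof. by move=> h1 h2 E; apply: (@aff_jet0 _ c x); rewrite -E; exact: jet0B. Qed.

(** Two cell potentials differ on the intersection of their cells by an affine function, up to a
    vanishing jet, because their Hessians have the same trace there. These affine functions form a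
    1-cocycle; writing it as a coboundary corrects the potentials. *)
Lemma curl_kernel s : Sigma_h T k s -> curl s = 0 -> exists2 u, U_h T k u & s = hess u.
Proof.
move=> /(Sigma_hP Tlt Tinj k3) [sT dg h] /ffunP s0.
have /choice [u0 uP] c : exists w, U_deg k w /\ s c = hess1 w.
  have [||w wd wE] := hess_potential_full (G := T c) k3 _ (sT c) (dg c); first exact: Tlt.
    by have := s0 c; rewrite !ffunE.
  by exists w.
have pE a b : exists r, touch T a b -> forall x, box_set (T a) x -> box_set (T b) x ->
    jet0 (u0 b - u0 a - aff r) x.
  case: (pselect (touch T a b)) => [t|nt]; last by exists (fun=> 0).
  have [x [ax bx]] := t; exists (taylor x (u0 b - u0 a)) => _.
  have sm := meet_sub hT (touch_sym t).
  have /hess_aff_trace : Sigma_trace0 (meet (T b) (T a)) (hess1 (u0 b - u0 a)).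
    by rewrite hess1B -(uP a).2 -(uP b).2; apply: h.
  move=> /(_ x ((meet_set _ _ _).2 (conj bx ax))) /U_trace0P H y ay b_y; apply: H; exact/meet_set.
have [p pP] := choice2 pE.
have [e [M [g [c0 [e0 hg]]]]] := mesh_contraction hT hOmega.
have Tle c i : lo (T c) 0 i <= hi (T c) 0 i by exact/ltW/Tlt.
have /choice [r rP] o : exists r : 'I_N -> R, forall a b, touch T a b -> p a b o = r b - r a.
  apply: (cech1 e0 Tle hg (p := fun a b => p a b o)) => a b c ab ac bc.
  have [|x cx] := @helly _ _ T [:: a; b; c] isT.
    by move=> ? ?; rewrite !inE => /or3P [] /eqP -> /or3P [] /eqP -> //;
      do 1?[exact: touch_sym]; exact: touch_refl.
  have [ax bx cx'] : [/\ box_set (T a) x, box_set (T b) x & box_set (T c) x].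
    by split; apply: cx; rewrite !inE eqxx ?orbT.
  have J1 := pP a b ab x ax bx; have J2 := pP a c ac x ax cx'; have J3 := pP b c bc x bx cx'.
  have := jet0_aff_unique (c := fun o => p b c o - p a c o + p a b o) J2 (jet0D J1 J3).
  by apply; rewrite affD affB; ring.
pose u : sfield R N := [ffun c => u0 c - aff (fun o => r o c)].
exists u.
  apply/U_jetP; split=> [a|a b x ax bx]; rewrite !ffunE.
    by move=> d; apply: degleB; [exact: (uP a).1|exact: aff_deg3].
  have t : touch T b a by exists x.
  have -> : u0 a - aff (r ^~ a) - (u0 b - aff (r ^~ b)) = u0 a - u0 b - aff (p b a).
    have -> : p b a = fun o => r o a - r o b by apply/funext => o; exact: rP.
    by rewrite affB; ring.
  exact: (pP b a t).
by apply/ffunP => c; rewrite !ffunE hess1B hess1_aff subr0; exact: (uP c).2.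
Qed.

(* Cell by cell: on a new cell the values are prescribed on its intersections
   with the previous ones, and the cocycle condition makes them compatible. *)
Lemma extend_cocycle (w : 'I_N -> 'I_N -> pol) :
  (forall a b, U_deg k (w a b)) ->
  (forall a b c x, box_set (T a) x -> box_set (T b) x -> box_set (T c) x ->
     jet0 (w a b + w b c - w a c) x) ->
  exists u : 'I_N -> pol, (forall a, U_deg k (u a)) /\
    forall a b x, box_set (T a) x -> box_set (T b) x -> jet0 (u b - u a - w a b) x.
Proof.
move=> dg coc.
have waa a x : box_set (T a) x -> jet0 (w a a) x.
  by move=> ax; have := coc a a a x ax ax ax; rewrite addrK.
have wab a b x : box_set (T a) x -> box_set (T b) x -> jet0 (w a b + w b a) x.
  move=> ax bx; rewrite -(subrK (w a a) (w a b + w b a)).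
  by apply: jet0D; [exact: coc|exact: waa].
suff [u [ud uP]] : exists u : 'I_N -> pol, (forall a, U_deg k (u a)) /\
    forall a b x, a \in enum 'I_N -> b \in enum 'I_N -> box_set (T a) x -> box_set (T b) x ->
    jet0 (u b - u a - w a b) x.
  by exists u; split=> // a b x; apply: uP; rewrite mem_enum.
elim: (enum 'I_N) => [|a s [u [ud uP]]].
  by exists (fun=> 0); split=> // a d; exact: degle0.
case: (boolP (a \in s)) => as_.
  exists u; split=> // b c x; rewrite !inE => /orP bs /orP cs.
  by apply: uP; [case: bs => [/eqP ->|]|case: cs => [/eqP ->|]].
pose nb := [seq b <- s | `[< touch T b a >]].
have nbP b : b \in nb -> b \in s /\ touch T b a.
  by rewrite mem_filter => /andP [/asboolP].
have [|b c x /nbP [bs _] /nbP [cs _] /meet_set [ax bx] /meet_set [_ cx]|ua uad uaP] :=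
  extend_family (T := T a) (s := nb) (G := fun b => meet (T a) (T b)) (f := fun b => u b + w b a) k3 (Tlt a).
- move=> b /nbP [_ t]; split; first exact: (meet_sub hT (touch_sym t)).1.
  by move=> d; apply: degleD; [exact: ud|exact: dg].
- have -> : u b + w b a - (u c + w c a) =
    w b a - w c a - w b c - (u c - u b - w b c) by ring.
  apply: jet0B (uP b c x bs cs bx cx).
  have -> : w b a - w c a - w b c = (w c a + w a c) - (w b c + w c a - w b a) - (w c a + w a c) by ring.
  by apply: jet0B (wab _ _ _ cx ax); apply: jet0B; [exact: wab|exact: coc].
- pose v b := if b == a then ua else u b.
  have vs b : b \in s -> v b = u b.
    by rewrite /v => bs; case: eqP => // E; move: as_; rewrite -E bs.
  have key b x : b \in s -> box_set (T b) x -> box_set (T a) x -> jet0 (ua - u b - w b a) x.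
    move=> bs bx ax; rewrite -addrA -opprD; apply: uaP; last exact/meet_set.
    by rewrite mem_filter bs andbT; apply/asboolP; exists x.
  exists v; split=> [b|b c x]; first by rewrite /v; case: eqP.
  rewrite !inE => /predU1P [->|bs] /predU1P [->|cs] bx cx.
  + by rewrite subrr add0r; apply/jet0N/waa.
  + rewrite (vs c) // /v eqxx.
    have -> : u c - ua - w a c = - (ua - u c - w c a) - (w c a + w a c) by ring.
    by apply: jet0B (wab _ _ _ cx bx); apply/jet0N/key.
  + by rewrite (vs b) // /v eqxx; apply: key.
  + by rewrite !vs //; exact: uP.
Qed.

(** For cell potentials s_a, the curl of s_b - s_a has vanishing trace on the common part of the
    cells, so s_b - s_a has there the trace of some [hess1 (w a b)]. The defect of w on triple
    intersections is affine up to vanishing jets and forms a 2-cocycle. Once it is removed,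
    [extend_cocycle] writes w as differences of cell polynomials, whose Hessians are subtracted
    without changing the curl. *)
Lemma div_kernel t : Xi_h T k t -> divm t = 0 -> exists2 s, Sigma_h T k s & t = curl s.
Proof.
move=> /(Xi_hP Tlt Tinj k3) [t0 dg h] /ffunP td.
have /choice [s0 sP] c : exists s1 : 'M[pol]_3, [/\ s1^T = s1, curl1 s1 = t c & Sigma_deg k s1].
  by apply: curl_potential => //; have := td c; rewrite !ffunE.
have wE a b : exists w, U_deg k w /\ (touch T a b -> forall G, shared T a b G ->
    Sigma_trace0 G (s0 b - s0 a - hess1 w)).
  case: (pselect (touch T a b)) => [tab|nt]; last by exists 0; split=> // d; exact: degle0.
  have [sa ca da] := sP a; have [sb cb db] := sP b; have [x [ax bx]] := tab.
  have [||||w [wd wP]] := @hess_potential _ k (meet (T a) (T b)) (s0 b - s0 a) k3.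
  - by move=> d; have /andP [] := (meet_set (T a) (T b) x).2 (conj ax bx) d; apply: le_trans.
  - by rewrite raddfB /= sa sb.
  - by move=> i j d; rewrite !mxE; apply: degleB; [exact: db|exact: da].
  - move=> G' sG; rewrite curl1B ca cb; apply: h; apply: (sub_shared hT (touch_sym tab)).
    by move=> d; have := sG d; rewrite !mxE ![Num.max (lo (T b) 0 d) _]maxC ![Num.min (hi (T b) 0 d) _]minC.
  by exists w; split=> // _ G /(shared_meet hT) sG; exact: wP.
have [w wP] := choice2 wE.
have touchI a b x : box_set (T a) x -> box_set (T b) x -> touch T a b by move=> ? ?; exists x.
have pE a b c : exists r, forall x, box_set (T a) x -> box_set (T b) x -> box_set (T c) x ->
    jet0 (w a b + w b c - w a c - aff r) x.
  case: (pselect (exists x, [/\ box_set (T a) x, box_set (T b) x & box_set (T c) x]));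
    last by move=> nx; exists (fun=> 0) => x ax bx cx; case: nx; exists x.
  move=> [x [ax bx cx]]; exists (taylor x (w a b + w b c - w a c)).
  have ab := touchI _ _ _ ax bx; have ac := touchI _ _ _ ax cx; have bc := touchI _ _ _ bx cx.
  have [sa sb sc] := meet3_sub hT ab ac bc.
  set G := meet _ _ in sa sb sc.
  have S0 : Sigma_trace0 G (hess1 (w a b + w b c - w a c)).
    have -> : hess1 (w a b + w b c - w a c) = - (s0 b - s0 a - hess1 (w a b))
        + - (s0 c - s0 b - hess1 (w b c)) + (s0 c - s0 a - hess1 (w a c)).
      rewrite hess1B hess1D; move: (hess1 (w a b)) (hess1 (w b c)) (hess1 (w a c)) => hab hbc hac.
      by apply/matrixP => i j; rewrite !mxE; ring.
    by apply: Sigma_trace0D; [apply: Sigma_trace0D; apply: Sigma_trace0N|];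
      [apply: (wP a b).2|apply: (wP b c).2|apply: (wP a c).2].
  have Gx : box_set G x by apply/meet_set; split=> //; apply/meet_set.
  move=> y ay b_y cy; have /U_trace0P := hess_aff_trace S0 Gx; apply.
  by apply/meet_set; split=> //; apply/meet_set.
have [p pP] := choice3 pE.
have [e [M [g [c0 [e0 hg]]]]] := mesh_contraction hT hOmega.
have Tle c i : lo (T c) 0 i <= hi (T c) 0 i by exact/ltW/Tlt.
have /choice [r rP] o : exists r : 'I_N -> 'I_N -> R, forall a b c x,
    box_set (T a) x -> box_set (T b) x -> box_set (T c) x -> p a b c o = r b c - r a c + r a b.
  apply: (cech2 e0 Tle hg (p := fun a b c => p a b c o)) => a b c d ab ac ad bc bd cd.
  have [|x cx] := @helly _ _ T [:: a; b; c; d] isT.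
    by move=> ? ?; rewrite !inE => /or4P [] /eqP -> /or4P [] /eqP -> //;
      do 1?[exact: touch_sym]; exact: touch_refl.
  have [ax bx cx' dx] : [/\ box_set (T a) x, box_set (T b) x, box_set (T c) x & box_set (T d) x].
    by split; apply: cx; rewrite !inE eqxx ?orbT.
  have J1 := pP b c d x bx cx' dx; have J2 := pP a c d x ax cx' dx.
  have J3 := pP a b d x ax bx dx; have J4 := pP a b c x ax bx cx'.
  have := jet0_aff_unique (c := fun o => p b c d o - p a c d o + p a b d o - p a b c o)
    (jet0D J2 J4) (jet0D J1 J3).
  by apply; rewrite affB affD affB; ring.
pose rr a b : coefs R := fun o => r o a b.
have pr a b c x : box_set (T a) x -> box_set (T b) x -> box_set (T c) x ->
    aff (p a b c) = aff (rr b c) - aff (rr a c) + aff (rr a b).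
  by move=> ax bx cx; rewrite -affB -affD; congr aff; apply/funext => o; exact: rP cx.
have [||u [ud uP]] := @extend_cocycle (fun a b => w a b - aff (rr a b)).
- by move=> a b d; apply: degleB; [exact: (wP a b).1|exact: aff_deg3].
- move=> a b c x ax bx cx; have := pP a b c x ax bx cx; rewrite (pr _ _ _ x) //.
  by congr jet0; ring.
exists [ffun c => s0 c - hess1 (u c)].
  apply/(Sigma_hP Tlt Tinj k3); split=> [c|c|a b G sG]; rewrite !ffunE.
  + by have [sc _ _] := sP c; rewrite raddfB /= sc hess1T.
  + by have [_ _ dc] := sP c => i j d; rewrite !mxE; apply: degleB;
      [exact: dc|rewrite -hess1E; exact: (hess_deg (ud c))].
  + have sG' : shared T b a G by case: sG.
    have -> : s0 a - hess1 (u a) - (s0 b - hess1 (u b)) =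
      (s0 a - s0 b - hess1 (w b a)) - hess1 (u a - u b - (w b a - aff (rr b a))).
      rewrite (hess1B (u a - u b)) (hess1B (w b a)) hess1_aff subr0 hess1B.
      move: (hess1 (u a)) (hess1 (u b)) (hess1 (w b a)) => ha hb W.
      by apply/matrixP => i j; rewrite !mxE; ring.
    apply: Sigma_trace0D; first exact: ((wP b a).2 (shared_touch hT sG') G sG').
    apply/Sigma_trace0N/hess_trace/U_trace0P => x Gx.
    by apply: uP; [apply: (subentity_set _ sG'.1 Gx)|apply: (subentity_set _ sG'.2 Gx)] => d; exact/ltW/Tlt.
apply/ffunP => c; rewrite !ffunE curl1B curl1_hess subr0.
by have [_ -> _] := sP c.
Qed.

Lemma hess_curl u : curl (hess u) = 0.
Proof. by apply/ffunP => c; rewrite !ffunE curl1_hess. Qed.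

Lemma curl_div s : divm (curl s) = 0.
Proof. by apply/ffunP => c; rewrite !ffunE div_curl. Qed.

End Exactness.

(** * Surjectivity of the divergence *)

Section Onto.
Variable R : realType.
Notation pol := (mpoly 3 R).
Notation pt := 'rV[R]_3.
Variables (Omega : set pt) (N : nat) (T : 'I_N -> box R) (k : nat).
Hypothesis hT : cuboid_mesh Omega T.
Hypothesis k3 : (3 <= k)%N.
Implicit Types (p q f g : pol) (i j l d e : 'I_3) (G H : box R) (x y v : pt) (a b c : 'I_N).

Let Tlt := mesh_lt hT.
Let Tinj := @mesh_inj _ _ _ _ hT.

Definition before j c : option 'I_N := [pick b | `[< adjacent T j b c >]].

Lemma beforeP j c b : adjacent T j b c -> before j c = Some b.
Proof.
move=> h; rewrite /before; case: pickP => [b' /asboolP h'|/(_ b)].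
  by congr Some; exact: (adjacent_injl hT h' h).
by move=> /asboolP.
Qed.

Lemma before_lt j c b : before j c = Some b -> lo (T b) 0 j < lo (T c) 0 j.
Proof.
rewrite /before; case: pickP => // b' /asboolP [h _] [<-].
by rewrite -h; exact: Tlt.
Qed.

Definition column_step j (f g : 'I_N -> pol) c : pol :=
  pint j (lo (T c) 0 j) (f c) + oapp (fun b => esub j (lo (T c) 0 j) (g b)) 0 (before j c).

(* The value at the lower face of a cell is the one at the upper face of the cell
   before it in its column. *)
Lemma column_primitive j (f : 'I_N -> pol) (n : 'I_3 -> int) :
  (forall d, 0 <= n d) -> (forall c d, degle d (n d - (d == j)%:Z) (f c)) ->
  exists g : 'I_N -> pol,
  [/\ forall c, mderiv j (g c) = f c, forall c d, degle d (n d) (g c) &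
      forall b c x, adjacent T j b c -> x 0 j = lo (T c) 0 j -> peval (g c) x = peval (g b) x].
Proof.
move=> n0 df; pose S := column_step j f.
(* The number of cells starting lower in direction j: it increases strictly along a column and stays
   below N, so N iterations of [S] reach a fixed point. *)
pose rank c := #|[pred b | lo (T b) 0 j < lo (T c) 0 j]|.
have rank_lt b c : lo (T b) 0 j < lo (T c) 0 j -> (rank b < rank c)%N.
  move=> h; apply: proper_card; apply/properP; split.
    by apply/fintype.subsetP => a; rewrite !inE => /lt_trans; apply.
  by exists b; rewrite !inE ?ltxx.
have stable m c : (rank c < m)%N -> iter m.+1 S (fun=> 0) c = iter m S (fun=> 0) c.
  have SE (g1 g2 : 'I_N -> pol) a : (forall b, before j a = Some b -> g1 b = g2 b) -> S g1 a = S g2 a.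
    by rewrite /S /column_step; case: (before j a) => [b /(_ _ erefl) /= ->|].
  elim: m c => // m IH c; rewrite ltnS => h; apply: (SE (iter m.+1 S _) (iter m S _)) => b E.
  by apply: IH; apply: leq_trans h; apply: rank_lt; exact: before_lt E.
pose g := iter N S (fun=> 0).
have gE c : g c = S g c.
  by rewrite -[RHS]/(iter N.+1 S (fun=> 0) c) stable // -[X in (_ < X)%N](card_ord N);
    apply/proper_card/properP; split; [exact/fintype.subsetP|exists c; rewrite ?inE ?ltxx].
exists g; split=> [c|c d|b c x h xc].
- rewrite gE mderivD mderiv_pint; case: (before j c) => [b|] /=; rewrite ?mderiv_esub ?mderiv0 addr0 //.
- suff h m a : degle d (n d) (iter m S (fun=> 0) a) by exact: h.
  elim: m a => [|m IH] a; first exact: degle0.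
  rewrite iterS /S /column_step; apply: degleD; first exact: degle_pintE.
  by case: (before j a) => [b|] /=; [apply: degle_esub (IH b); left|exact: degle0].
- by rewrite gE pevalD peval_pint // add0r (beforeP h) /= peval_esub upd_idE.
Qed.

Lemma div_onto (q : vfield R N) : Q_h k q -> exists2 t : mfield R N, Xi_h T k t & divm t = q.
Proof.
move=> /(Q_shapeE k3) dq.
(* Any choice of a direction other than i works: an off-diagonal entry leaves the trace zero, and
   the entry i, [jj i] must match only across faces normal to [jj i], that is, along columns. *)
pose jj (i : 'I_3) : 'I_3 := if i == 2 then 0 else 2.
have ij i : jj i != i by elim/ord3P: i.
have /choice [g gP] i : exists g : 'I_N -> pol,
  [/\ forall c, mderiv (jj i) (g c) = q c 0 i,
      forall c d, degle d (k%:Z - 1 + (d == jj i)%:Z - (d == i)%:Z) (g c) &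
      forall b c x, adjacent T (jj i) b c -> x 0 (jj i) = lo (T c) 0 (jj i) -> peval (g c) x = peval (g b) x].
  apply: column_primitive => [d|c d]; first by case: (d == i); case: (d == jj i); lia.
  by apply: degle_le (dq c i d); lia.
pose t : mfield R N := [ffun c => \matrix_(i, j) if j == jj i then g i c else 0].
exists t; last first.
  apply/ffunP => c; apply/rowP => i; rewrite ffunE mxE (bigD1 (jj i)) //= big1 => [|j /negbTE jn].
    by rewrite addr0 ffunE mxE eqxx; have [-> _ _] := gP i.
  by rewrite ffunE mxE jn mderiv0.
apply/(Xi_hP Tlt Tinj k3); split=> [c|c i j d|a b G sG].
- by rewrite /mxtrace big1 // => i _; rewrite ffunE mxE eq_sym (negbTE (ij i)).
- rewrite ffunE mxE; case: (eqVneq j (jj i)) => [->|_]; last exact: degle0.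
  by have [_ h _] := gP i; exact: h.
split=> [_ i|i j l _ _ _|i j l u pi pl] x Gx.
- by rewrite !ffunE !mxE eq_sym (negbTE (ij i)) subrr peval0.
- by rewrite !ffunE !mxE eq_sym (negbTE (ij i)) subrr peval0.
case: (eqVneq a b) => [->|ab]; first by rewrite subrr mxE peval0.
rewrite !ffunE !mxE; case: eqP => [jE|_]; last by rewrite subrr peval0.
have [_ _ h] := gP i; rewrite -jE in h; rewrite pevalB; apply/eqP; rewrite subr_eq0; apply/eqP.
have pG e : e != j -> par G e by case: (uniq3 u e) => -> //; rewrite eqxx.
have [E [[adj xE]|[adj xE]]] := shared_adjacent hT ab sG pG.
- apply/esym/(h a b x adj); case: adj => <- _; rewrite -xE.
  by apply/eqP; rewrite eq_le andbC {2}E; exact: Gx.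
- by apply: h adj _; rewrite -xE; apply/eqP; rewrite eq_le andbC {2}E; exact: Gx.
Qed.

End Onto.

(** * Integration by parts *)

Section Parts.
Variable R : realType.
Notation pol := (mpoly 3 R).
Notation pt := 'rV[R]_3.
Notation mu := (@lebesgue_measure R).
Implicit Types (p f : pol) (i j l d : 'I_3) (G : box R) (x y v : pt) (a b e r s t : R) (h K : pt -> R).

Lemma continuous_nearP h x : {for x, continuous h} <->
  forall e, 0 < e -> exists2 r, 0 < r & forall y, near r x y -> `|h x - h y| < e.
Proof.
split=> [/cvgrPdist_lt ch e e0|H]; first by have /nbhs_near [r r0 rP] := ch e e0; exists r.
move=> A /nbhs_ballP [e /= e0 eA]; have [r r0 rP] := H e e0.
by apply/nbhs_near; exists r => // y /rP hy; apply: eA; rewrite -ball_normE.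
Qed.

Lemma unif_near (K : set pt) h e : compact K -> continuous h -> 0 < e ->
  exists2 r, 0 < r & forall x y, K x -> near r x y -> `|h x - h y| < e.
Proof.
move=> cK ch e0; have /compact_near_coveringP := cK.
move=> /(_ R 0^'+ (fun r x => forall y, near r x y -> `|h x - h y| < e)); case.
  move=> x Kx; have e2 : 0 < e / 2 by rewrite divr_gt0.
  have [r r0 rP] := (continuous_nearP h x).1 (ch x) (e / 2) e2.
  exists (ball x (r / 2), [set d' | d' < r / 2]) => /=.
    split; last by apply: nbhs_right_lt; rewrite divr_gt0.
    by apply: nbhsx_ballx; rewrite divr_gt0.
  move=> [x1 r1] /= [/ball_near]; rewrite divr_gt0 // => /(_ isT) xx1 r1r y x1y.
  have h1 : `|h x - h x1| < e / 2 by apply: rP; apply: near_le xx1; lra.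
  have h2 : `|h x - h y| < e / 2 by apply: rP; apply: near_le (near_trans xx1 x1y); lra.
  have := ler_distD (h x) (h x1) (h y); rewrite [`|h x1 - h x|]distrC; lra.
move=> r /= r0 rP; have r20 : 0 < r / 2 by rewrite divr_gt0.
exists (r / 2) => // x y Kx xy.
have dd : ball_ Num.norm 0 r (r / 2) by rewrite /= sub0r normrN gtr0_norm //; lra.
exact: (rP _ dd r20 x Kx y).
Qed.

Lemma near_upd r x y i t : 0 < r -> near r x y -> near r (upd x i t) (upd y i t).
Proof. by move=> r0 xy j; rewrite !mxE; case: eqP => // _; rewrite subrr normr0. Qed.

Lemma near_upd_pt r x i s t : 0 < r -> `|s - t| < r -> near r (upd x i s) (upd x i t).
Proof. by move=> r0 st j; rewrite !mxE; case: eqP => // _; rewrite subrr normr0. Qed.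

Lemma continuous_upd h i t : continuous h -> continuous (fun x => h (upd x i t)).
Proof.
move=> ch x; apply/continuous_nearP => e e0; have [r r0 rP] := (continuous_nearP _ _).1 (ch (upd x i t)) e e0.
by exists r => // y xy; apply: rP; exact: near_upd.
Qed.

Lemma continuous_line h i x : continuous h -> continuous (fun t => h (upd x i t)).
Proof.
move=> ch t A /ch /nbhs_near [r r0 rP]; apply/nbhs_ballP; exists r => //= s.
by rewrite -ball_normE /= => st; apply: rP; exact: near_upd_pt.
Qed.

Lemma segment_unif h x d a b e : continuous h -> 0 < e -> exists2 r, 0 < r &
  forall t y, a <= t <= b -> near r (upd x d t) y -> `|h (upd x d t) - h y| < e.
Proof.
move=> ch e0; have [r r0 rP] := unif_near (@compact_box _ (Box (upd x d a) (upd x d b))) ch e0.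
exists r => // t y ab; apply: rP => i; rewrite !mxE.
by case: eqP => // _; rewrite lexx.
Qed.

Lemma integrable_line h x d a b : continuous h ->
  mu.-integrable `[a, b] (EFin \o (fun t => h (upd x d t))).
Proof.
move=> ch; apply: continuous_compact_integrable; first exact: segment_compact.
by apply: continuous_subspaceT; exact: continuous_line.
Qed.

(** Kept as a function of the whole point, constant in x_d, so that continuity and partial
    derivatives of iterated integrals make sense without changing the space. *)
Definition Int d a b h : pt -> R := fun x => int1 a b (fun t => h (upd x d t)).

Lemma Int_cont d a b h : a <= b -> continuous h -> continuous (Int d a b h).
Proof.
move=> ab ch; rewrite /Int /int1; case: eqVneq => [_|nab]; first exact: continuous_upd.
have {}ab : a < b by rewrite lt_neqAle nab.
move=> x; apply/continuous_nearP => e e0.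
have e1 : 0 < e / (b - a + 1) by rewrite divr_gt0 //; lra.
have [r r0 rP] := segment_unif x d a b ch e1.
exists r => // y xy.
have cd : continuous (fun t => h (upd x d t) - h (upd y d t)).
  by move=> t; apply: cvgB; exact: continuous_line.
rewrite -RintegralB //; try exact: integrable_line.
apply: (le_lt_trans (le_normr_Rintegral _ _)) => //.
  by apply: (continuous_compact_integrable (f := fun t => _ - _)); [exact: segment_compact|exact: continuous_subspaceT].
have := @le_Rintegral _ _ _ mu `[a, b] (fun t => `|h (upd x d t) - h (upd y d t)|) (fun=> e / (b - a + 1)).
move=> /(_ _ _ _ _)/le_lt_trans; apply => //.
- apply: (continuous_compact_integrable (f := fun t => `|h (upd x d t) - h (upd y d t)|)); first exact: segment_compact.
  by apply: continuous_subspaceT => t; apply: cvg_norm; exact: cd.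
- by apply: continuous_compact_integrable; [exact: segment_compact|apply: continuous_subspaceT => ?; exact: cvg_cst].
- by move=> t; rewrite /= in_itv /= => tab; apply/ltW/rP => //; exact: near_upd.
rewrite Rintegral_cst //.
have -> : fine (mu `[a, b]) = b - a by rewrite /= lebesgue_measure_itv /= lte_fin ab.
by rewrite mulrAC ltr_pdivrMr; nra.
Qed.

Lemma Int_pt d s h : Int d s s h = fun x => h (upd x d s).
Proof. by apply/funext => x; exact: int1_pt. Qed.

Lemma IntD d a b h K x : a <= b -> continuous h -> continuous K ->
  Int d a b (fun y => h y + K y) x = Int d a b h x + Int d a b K x.
Proof.
move=> ab ch cK; rewrite /Int /int1; case: eqP => // _.
by rewrite RintegralD //; exact: integrable_line.
Qed.

Lemma IntB d a b h K x : a <= b -> continuous h -> continuous K ->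
  Int d a b (fun y => h y - K y) x = Int d a b h x - Int d a b K x.
Proof.
move=> ab ch cK; rewrite /Int /int1; case: eqP => // _.
by rewrite RintegralB //; exact: integrable_line.
Qed.

Lemma derivable_lineE h d x : 
  derivable h x (delta_mx 0 d) <-> derivable (fun t => h (upd x d t)) (x 0 d) 1.
Proof.
rewrite /derivable; suff -> : (fun s => s^-1 *: ((h \o shift x) (s *: delta_mx 0 d) - h x)) =
  (fun s => s^-1 *: (((fun t => h (upd x d t)) \o shift (x 0 d)) (s *: 1) - h (upd x d (x 0 d)))) by [].
apply/funext => s; rewrite /= upd_id; congr (_ *: (h _ - _)).
by apply/rowP => i; rewrite !mxE /=; case: eqVneq => [->|_] //; rewrite mulr0 add0r.
Qed.

Lemma partial_lineE h d x : partial d h x = derive1 (fun t => h (upd x d t)) (x 0 d).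
Proof.
rewrite /partial derive1E /derive; congr (lim (_ @ 0^')).
apply/funext => s; rewrite /= upd_id; congr (_ *: (h _ - _)).
by apply/rowP => i; rewrite !mxE /=; case: eqVneq => [->|_] //; rewrite mulr0 add0r.
Qed.

Lemma derivable_line h d x t : derivable h (upd x d t) (delta_mx 0 d) ->
  derivable (fun s => h (upd x d s)) t 1.
Proof.
move=> /derivable_lineE; rewrite upd_same.
by under eq_fun do rewrite upd_upd.
Qed.

Lemma partial_line h d x t : partial d h (upd x d t) = derive1 (fun s => h (upd x d s)) t.
Proof. by rewrite partial_lineE upd_same; under eq_fun do rewrite upd_upd. Qed.

Lemma Int_partial i d a b h x : i != d -> a <= b -> continuous h ->
  (forall y, derivable h y (delta_mx 0 i)) -> continuous (partial i h) ->
  derivable (Int d a b h) x (delta_mx 0 i) /\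
  partial i (Int d a b h) x = Int d a b (partial i h) x.
Proof.
move=> id ab ch dh cdh.
have E s t : upd (upd x i s) d t = upd (upd x d t) i s by rewrite updC.
rewrite derivable_lineE partial_lineE /Int /int1; case: eqVneq => [_|nab].
  under eq_fun do rewrite E.
  by rewrite partial_lineE upd_other //; split=> //; apply: derivable_line; rewrite upd_idE ?upd_other.
have [r r0 rP] := segment_unif x d a b cdh ltr01.
pose f s t := h (upd (upd x i s) d t).
pose I : set R := [set` `]x 0 i - r, x 0 i + r[].
have inI s : I s -> `|x 0 i - s| < r.
  by rewrite /I /= in_itv /= => /andP [? ?]; rewrite ltr_norml; apply/andP; split; lra.
have Ix : I (x 0 i) by rewrite /I /= in_itv /=; apply/andP; split; lra.
have intf s : I s -> mu.-integrable `[a, b] (EFin \o f s) by move=> _; exact: integrable_line.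
have df s t : I s -> [set` `[a, b]] t -> derivable (f ^~ t) s 1.
  by move=> _ _; rewrite /f; under eq_fun do rewrite E; apply: derivable_line.
have d1f s t : partial1of2 f s t = partial i h (upd (upd x d t) i s).
  by rewrite /partial1of2 partial_line /f; under eq_fun do rewrite E.
(* The dominating function: by uniform continuity along the segment, nearby values of the partial
   derivative differ from those on the segment by less than 1. *)
pose g t := `|partial i h (upd x d t)| + 1.
have cg : continuous g.
  by move=> t; apply: cvgD; [apply: cvg_norm; exact: continuous_line|exact: cvg_cst].
have ig : mu.-integrable `[a, b] (EFin \o g).
  by apply: continuous_compact_integrable; [exact: segment_compact|exact: continuous_subspaceT].
have g0 t : 0 <= g t by rewrite addr_ge0.
have gub s t : I s -> [set` `[a, b]] t -> `|partial1of2 f s t| <= g t.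
  rewrite /= in_itv /= d1f => /inI xs /rP tab.
  have : `|partial i h (upd x d t) - partial i h (upd (upd x d t) i s)| < 1.
    apply: tab => j; rewrite [X in `|_ - X|]mxE; case: eqP => [->|_]; last by rewrite subrr normr0.
    by rewrite upd_other.
  rewrite /g; set u := partial i h _; set v := partial i h _ => uv.
  have := ler_normB u (u - v); rewrite subKr; lra.
split; first exact: (derivable_under_integral _ Ix intf df g0 ig gub).
have mI : measurable ([set` `[a, b]] : set (measurableTypeR R)) by exact: measurable_itv.
have := differentiation_under_integral mI Ix intf df g0 ig gub.
move=> ->.
by apply: eq_Rintegral => t _; rewrite d1f upd_idE // upd_other.
Qed.

Lemma Int_FTC d a b h x : a < b -> continuous h ->
  (forall y, derivable h y (delta_mx 0 d)) -> continuous (partial d h) ->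
  Int d a b (partial d h) x = h (upd x d b) - h (upd x d a).
Proof.
move=> ab ch dh cdh; rewrite /Int /int1 lt_eqF // /Rintegral.
rewrite (@continuous_FTC2 _ (fun t => partial d h (upd x d t)) (fun t => h (upd x d t))) //.
- by apply: continuous_subspaceT; exact: continuous_line.
- split=> [t _||]; first exact: derivable_line.
  + by apply: cvg_at_right_filter; exact: continuous_line.
  + by apply: cvg_at_left_filter; exact: continuous_line.
- by move=> t _; rewrite partial_line.
Qed.

Definition Box_int G h : pt -> R :=
  Int 0 (lo G 0 0) (hi G 0 0) (Int 1 (lo G 0 1) (hi G 0 1) (Int 2 (lo G 0 2) (hi G 0 2) h)).

Lemma box_intE G h x : box_int G h = Box_int G h x.
Proof.
apply: (congr1 (int1 _ _)); apply/funext => r; apply: (congr1 (int1 _ _)); apply/funext => s.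
apply: (congr1 (int1 _ _)); apply/funext => t; apply: (congr1 h).
by apply/rowP; elim/ord3P; rewrite !mxE.
Qed.

Lemma box_intD G h K : valid G -> continuous h -> continuous K ->
  box_int G (fun x => h x + K x) = box_int G h + box_int G K.
Proof.
move=> vG ch cK; rewrite !(box_intE _ _ 0) /Box_int.
have -> : Int 2 (lo G 0 2) (hi G 0 2) (fun x => h x + K x) =
  (fun x => Int 2 (lo G 0 2) (hi G 0 2) h x + Int 2 (lo G 0 2) (hi G 0 2) K x).
  by apply/funext => x; exact: IntD.
have c2h := Int_cont (d := 2) (vG 2) ch; have c2K := Int_cont (d := 2) (vG 2) cK.
have -> : Int 1 (lo G 0 1) (hi G 0 1)
    (fun x => Int 2 (lo G 0 2) (hi G 0 2) h x + Int 2 (lo G 0 2) (hi G 0 2) K x) =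
  (fun x => Int 1 (lo G 0 1) (hi G 0 1) (Int 2 (lo G 0 2) (hi G 0 2) h) x +
            Int 1 (lo G 0 1) (hi G 0 1) (Int 2 (lo G 0 2) (hi G 0 2) K) x).
  by apply/funext => x; exact: IntD.
by apply: IntD => //; exact: Int_cont.
Qed.

(* The fundamental theorem of calculus in the direction d; for the outer
   directions it is used after differentiating under the inner integrals. *)
Lemma box_int_FTC G d h : (forall i, lo G 0 i < hi G 0 i) -> continuous h ->
  (forall y, derivable h y (delta_mx 0 d)) -> continuous (partial d h) ->
  box_int G (partial d h) = box_int (slab G d (hi G 0 d)) h - box_int (slab G d (lo G 0 d)) h.
Proof.
move=> Glt ch dh cdh; have vG : valid G by move=> i; exact/ltW/Glt.
pose I i := Int i (lo G 0 i) (hi G 0 i).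
have cI i K : continuous K -> continuous (I i K) by exact: Int_cont.
have IP i K : i != d -> continuous K -> (forall y, derivable K y (delta_mx 0 d)) ->
    continuous (partial d K) -> [/\ continuous (I i K), forall y, derivable (I i K) y (delta_mx 0 d),
      partial d (I i K) = I i (partial d K) & continuous (partial d (I i K))].
  move=> id cK dK cdK; have di : d != i by rewrite eq_sym.
  have E : partial d (I i K) = I i (partial d K).
    by apply/funext => y; exact: (Int_partial y di (vG i) cK dK cdK).2.
  split; [exact: cI|by move=> y; exact: (Int_partial y di (vG i) cK dK cdK).1|exact: E|].
  by rewrite E; exact: cI.
have FTC K : continuous K -> (forall y, derivable K y (delta_mx 0 d)) -> continuous (partial d K) ->
    I d (partial d K) = fun x => K (upd x d (hi G 0 d)) - K (upd x d (lo G 0 d)).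
  by move=> cK dK cdK; apply/funext => x; exact: Int_FTC.
have IB i K K' : continuous K -> continuous K' -> I i (fun x => K x - K' x) = fun x => I i K x - I i K' x.
  by move=> cK cK'; apply/funext => x; exact: IntB.
have cu K s : continuous K -> continuous (fun x => K (upd x d s)) by exact: continuous_upd.
have slabE s x : box_int (slab G d s) h = Box_int (slab G d s) h x by exact: box_intE.
rewrite (box_intE _ _ 0) !(slabE _ 0) /Box_int -![Int _ (lo G 0 _) (hi G 0 _)]/(I _).
have ld s i : lo (slab G d s) 0 i = if i == d then s else lo G 0 i by rewrite mxE.
have hd s i : hi (slab G d s) 0 i = if i == d then s else hi G 0 i by rewrite mxE.
rewrite !ld !hd; clear ld hd slabE.
move: d dh cdh cu IP FTC; elim/ord3P => dh cdh cu IP FTC /=; rewrite ?Int_pt -/(I _).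
- have [|c2 d2 E2 p2] := IP 2 h _ ch dh cdh; first by [].
  have [|c1 d1 E1 p1] := IP 1 _ _ c2 d2 p2; first by [].
  by rewrite -E2 -E1 FTC.
- have [|c2 d2 E2 p2] := IP 2 h _ ch dh cdh; first by [].
  by rewrite -E2 FTC // IB; [|exact: cu|exact: cu].
- rewrite FTC // IB; [|exact: cu|exact: cu].
  by rewrite IB //; apply: cI; exact: cu.
Qed.

End Parts.

(** * Integration by parts over the mesh *)

Section Distributions.
Variable R : realType.
Notation pol := (mpoly 3 R).
Notation pt := 'rV[R]_3.
Implicit Types (p f : pol) (i j l d e : 'I_3) (G : box R) (x y v : pt) (phi : pt -> R).

Lemma peval_continuous p : continuous (peval p).
Proof.
have -> : peval p = fun y : pt => \sum_(m <- msupp p) mcoeff m p * \prod_i y 0 i ^+ m i.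
  by apply/funext => y; exact: mevalE.
apply: continuous_big => [|m _]; first exact: add_continuous.
have cX i : continuous (fun y : pt => y 0 i ^+ m i).
  move=> x; apply: (@continuous_comp _ _ _ (fun y : pt => y 0 i) (fun t => t ^+ m i)); last exact: exprn_continuous.
  exact: coord_continuous.
have cP : continuous (fun y : pt => \prod_i y 0 i ^+ m i).
  by apply: continuous_big => [|i _]; [exact: mul_continuous|exact: cX].
by move=> x; exact: (continuousM (@cst_continuous _ _ (mcoeff m p : R^o) x) (cP x)).
Qed.

Lemma derivable_peval p x d : derivable (peval p) x (delta_mx 0 d).
Proof.
rewrite derivable_lineE; under eq_fun do rewrite -slice_horner.
exact: derivable_horner.
Qed.

Lemma partial_peval p d x : partial d (peval p) x = peval (mderiv d p) x.
Proof.
rewrite partial_lineE; under eq_fun do rewrite -slice_horner.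
by rewrite -derivE slice_deriv slice_horner upd_id.
Qed.

Variables (Omega : set pt) (N : nat) (T : 'I_N -> box R).
Hypothesis hT : cuboid_mesh Omega T.
Hypothesis openO : open Omega.
Implicit Types (a b c : 'I_N) (u : sfield R N).

Lemma test_smooth phi : test_function Omega phi ->
  [/\ continuous phi, forall d x, derivable phi x (delta_mx 0 d), forall d, continuous (partial d phi)
    & forall x, ~ Omega x -> phi x = 0].
Proof.
move=> [sp _ sO]; have [c0 d0] := sp [::]; split=> // [d|x nx]; first by have [] := sp [:: d].
by apply/eqP/negPn/negP => px; apply/nx/sO; exact: subset_closure.
Qed.

Lemma test_partial phi d : test_function Omega phi -> test_function Omega (partial d phi).
Proof.
move=> tp; have [_ dp _ _] := test_smooth tp; case: tp => sp cp sO.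
have sub : closure [set x | partial d phi x != 0] `<=` closure [set x | phi x != 0].
  rewrite [X in _ `<=` X](closure_id _).1; last exact: closed_closure.
  apply: closureS => x; apply: contraPP => nx; apply/negP; rewrite negbK; apply/eqP.
  have nO : nbhs x (~` closure [set y | phi y != 0]).
    by apply: open_nbhs_nbhs; split=> //; apply: closed_openC; exact: closed_closure.
  have nz : {near x, phi =1 cst 0}.
    apply: filterS nO => y ny; apply/eqP/negPn/negP => py.
    by apply/ny/subset_closure.
  by rewrite /partial (near_eq_derive _ nz) ?derive_cst.
split=> [s||]; first by have := sp (rcons s d); rewrite foldr_rcons.
- by apply: subclosed_compact cp sub; exact: closed_closure.
- exact: subset_trans sub sO.
Qed.

Lemma cell_parts c f d phi : test_function Omega phi ->
  box_int (T c) (fun x => peval f x * partial d phi x) =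
  box_int (slab (T c) d (hi (T c) 0 d)) (fun x => peval f x * phi x) -
  box_int (slab (T c) d (lo (T c) 0 d)) (fun x => peval f x * phi x) -
  box_int (T c) (fun x => peval (mderiv d f) x * phi x).
Proof.
move=> /test_smooth [cp dp cdp _].
have cM (h1 h2 : pt -> R) : continuous h1 -> continuous h2 -> continuous (fun x => h1 x * h2 x).
  by move=> c1 c2 x; exact: (continuousM (c1 x) (c2 x)).
have cD (h1 h2 : pt -> R) : continuous h1 -> continuous h2 -> continuous (fun x => h1 x + h2 x).
  by move=> c1 c2 x; exact: (cvgD (c1 x) (c2 x)).
have E : partial d (fun x => peval f x * phi x) =
  fun x => peval f x * partial d phi x + peval (mderiv d f) x * phi x.
  apply/funext => x; rewrite /partial (deriveM (@derivable_peval f x d) (dp d x)).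
  rewrite -[in RHS]partial_peval [X in _ = _ + X]mulrC; congr (_ + _).
rewrite -(box_int_FTC (G := T c) (d := d) (h := fun x => peval f x * phi x)).
- rewrite E box_intD ?addrK //; first exact: mesh_valid hT c.
  + by apply: cM => //; exact: peval_continuous.
  + by apply: cM => //; exact: peval_continuous.
- exact: (mesh_lt hT).
- by apply: cM => //; exact: peval_continuous.
- by move=> y; exact: (derivableM (@derivable_peval f y d) (dp d y)).
- rewrite E; apply: cD; apply: cM => //; exact: peval_continuous.
Qed.

Lemma slab_valid c d t : valid (slab (T c) d t).
Proof. by move=> i; rewrite !mxE; case: eqP => // _; exact: (mesh_valid hT). Qed.

(* A point of a face without neighbouring cell is a limit of points of the
   relative interior of the face, none of which lies in Omega. *)
Lemma boundary_face_zero c d t x phi : test_function Omega phi ->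
  (t = hi (T c) 0 d /\ forall c', ~ adjacent T d c c') \/
  (t = lo (T c) 0 d /\ forall c', ~ adjacent T d c' c) ->
  box_set (slab (T c) d t) x -> phi x = 0.
Proof.
move=> tp ht xF; have [cp _ _ zO] := test_smooth tp.
have xd : x 0 d = t by apply/eqP; have := xF d; rewrite !mxE eqxx eq_le andbC.
have xe e : e != d -> lo (T c) 0 e <= x 0 e <= hi (T c) 0 e.
  by move=> /negbTE ed; have := xF e; rewrite !mxE ed.
have inner y : y 0 d = t -> (forall e, e != d -> lo (T c) 0 e < y 0 e < hi (T c) 0 e) -> phi y = 0.
  move=> yd ye; apply: zO => Oy; have [h1 h2] := inside_adjacent hT openO Oy ye.
  by case: ht => -[E nc]; [have [] := h1 (etrans yd E)|have [] := h2 (etrans yd E)] => c' /nc.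
apply/eqP/negPn/negP => px; have p0 : 0 < `|phi x| by rewrite normr_gt0.
have [r r0 rP] := (continuous_nearP phi x).1 (cp x) _ p0.
pose m e := (lo (T c) 0 e + hi (T c) 0 e) / 2.
pose M := 1 + \sum_e `|x 0 e - m e|.
have Mb e : `|x 0 e - m e| < M.
  by rewrite /M (bigD1 e) //= ltr_pwDl // lerDl sumr_ge0.
have M0 : 0 < M by rewrite /M ltr_pwDl // sumr_ge0.
(* The approximating point moves x towards the centre of the face by the fraction s: positive to
   enter the relative interior, at most 1/2, and small enough that s M < r. *)
pose s := Num.min (r / M) 1 / 2.
have rM : 0 < r / M by rewrite divr_gt0.
have s0 : 0 < s /\ s <= 1 / 2 /\ s * M < r.
  have h1 : Num.min (r / M) 1 <= r / M by rewrite ge_min lexx.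
  have h2 : Num.min (r / M) 1 <= 1 by rewrite ge_min lexx orbT.
  have h3 : 0 < Num.min (r / M) 1 by rewrite lt_min rM ltr01.
  split; first by rewrite /s; lra.
  split; first by rewrite /s; lra.
  by rewrite -ltr_pdivlMr // /s; lra.
case: s0 => s0 [s1 sM].
pose y : pt := \row_e (if e == d then t else x 0 e + s * (m e - x 0 e)).
have y0 : phi y = 0.
  apply: inner => [|e /negbTE ed]; rewrite mxE ?eqxx // ed /m.
  have := mesh_lt hT c e; have /andP [? ?] := xe e (negbT ed) => ?.
  by apply/andP; split; nra.
have : `|phi x - phi y| < `|phi x|.
  apply: rP => e; rewrite mxE; case: eqP => [->|_]; first by rewrite xd subrr normr0.
  rewrite opprD addNKr normrN normrM (gtr0_norm s0) distrC.
  by apply: le_lt_trans sM; rewrite ler_pM2l // ltW.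
by rewrite y0 subr0 ltxx.
Qed.

Lemma box_int0 G : valid G -> box_int G (fun=> 0) = 0 :> R.
Proof.
move=> vG; have := box_intD (h := fun=> 0) (K := fun=> 0) vG (@cst_continuous _ _ _) (@cst_continuous _ _ _).
rewrite (eq_box_int (F := fun=> 0 + 0) (F' := fun=> 0)) //; last by move=> ? _; rewrite addr0.
lra.
Qed.

(** A and B stand for the upper and lower face terms of the cells. A face between adjacent cells
    occurs once in each sum, and unmatched faces contribute zero, so both sums are equal. *)
Lemma matching_sum (adj : rel 'I_N) (A B C : 'I_N -> R) :
  (forall c c', adj c c' -> A c = B c') ->
  (forall c c1 c2, adj c c1 -> adj c c2 -> c1 = c2) ->
  (forall c c1 c2, adj c1 c -> adj c2 c -> c1 = c2) ->
  (forall c, (forall c', ~~ adj c c') -> A c = 0) ->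
  (forall c, (forall c', ~~ adj c' c) -> B c = 0) ->
  \sum_c (A c - B c - C c) = - \sum_c C c.
Proof.
move=> AB injr injl A0 B0.
have AE c : A c = \sum_(c' | adj c c') B c'.
  case: (pickP (adj c)) => [c' cc'|nc]; last by rewrite A0 ?big_pred0 // => c'; rewrite nc.
  rewrite (bigD1 c') //= big1 ?addr0 ?(AB c c') // => b /andP [h1 /negP []].
  by apply/eqP; exact: injr h1 cc'.
have BE c : B c = \sum_(c' | adj c' c) B c.
  case: (pickP (adj^~ c)) => [c' cc'|nc]; last by rewrite B0 ?big_pred0 // => c'; have /= -> := nc c'.
  rewrite (bigD1 c') //= big1 ?addr0 // => b /andP [h1 /negP []].
  by apply/eqP; exact: injl h1 cc'.
rewrite !sumrB [X in X - _ - _](_ : _ = \sum_c B c) ?subrr ?sub0r //.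
rewrite (eq_bigr _ (fun c _ => AE c)) (exchange_big_dep predT) //=.
by apply: eq_bigr => c _; rewrite -BE.
Qed.

Lemma parts u d phi : test_function Omega phi ->
  (forall c c' x, adjacent T d c c' -> box_set (slab (T c) d (hi (T c) 0 d)) x ->
     peval (u c) x = peval (u c') x) ->
  pairing T u (partial d phi) = - pairing T (dd d u) phi.
Proof.
move=> tp hu; rewrite /pairing.
pose A c := box_int (slab (T c) d (hi (T c) 0 d)) (fun x => peval (u c) x * phi x).
pose B c := box_int (slab (T c) d (lo (T c) 0 d)) (fun x => peval (u c) x * phi x).
pose C c := box_int (T c) (fun x => peval (dd d u c) x * phi x).
have H c : box_int (T c) (fun x => peval (u c) x * partial d phi x) = A c - B c - C c.
  by rewrite /C ffunE; exact: cell_parts.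
apply: etrans (eq_bigr _ (fun c _ => H c)) _.
have zero c t : (forall x, box_set (slab (T c) d t) x -> phi x = 0) ->
    box_int (slab (T c) d t) (fun x => peval (u c) x * phi x) = 0.
  move=> z; apply: etrans (box_int0 (@slab_valid c d t)).
  apply: eq_box_int; first exact: slab_valid.
  by move=> x /z ->; rewrite mulr0.
apply: (@matching_sum (fun c c' => `[< adjacent T d c c' >]) A B C) => [c c'|c c1 c2|c c1 c2|c nc|c nc].
- move=> /asboolP a; have [E E'] := a.
  have -> : B c' = box_int (slab (T c) d (hi (T c) 0 d)) (fun x => peval (u c') x * phi x).
    rewrite /B; congr (box_int (Box _ _) _); apply/rowP => e; rewrite !mxE E;
      by case: eqVneq => // /E' [E1 E2]; rewrite ?E1 ?E2.
  by apply: eq_box_int => [|x xF]; [exact: slab_valid|rewrite (hu c c' x a xF)].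
- by move=> /asboolP h1 /asboolP h2; exact: (adjacent_injr hT h1 h2).
- by move=> /asboolP h1 /asboolP h2; exact: (adjacent_injl hT h1 h2).
- apply: zero => x; apply: (boundary_face_zero tp); left; split=> // c' a.
  by have /asboolP := nc c'.
- apply: zero => x; apply: (boundary_face_zero tp); right; split=> // c' a.
  by have /asboolP := nc c'.
Qed.

End Distributions.

(** * The operators in the sense of distributions *)

Section Operators.
Variable R : realType.
Notation pol := (mpoly 3 R).
Notation pt := 'rV[R]_3.
Variables (Omega : set pt) (N : nat) (T : 'I_N -> box R) (k : nat).
Hypothesis openO : open Omega.
Hypothesis hT : cuboid_mesh Omega T.
Hypothesis k3 : (3 <= k)%N.
Implicit Types (i j l d e : 'I_3) (phi : pt -> R) (u f g : sfield R N) (s t : mfield R N).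

Let Tlt := mesh_lt hT.
Let Tinj := @mesh_inj _ _ _ _ hT.

Lemma pairingD f g phi : continuous phi ->
  pairing T (f + g) phi = pairing T f phi + pairing T g phi.
Proof.
move=> cp; rewrite /pairing -big_split; apply: eq_bigr => c _.
have cM p : continuous (fun x => peval p x * phi x).
  by move=> x; exact: (continuousM (@peval_continuous R p x) (cp x)).
apply: etrans (box_intD (mesh_valid hT c) (cM _) (cM _)).
by apply: eq_box_int => [|x _]; [exact: (mesh_valid hT c)|rewrite ffunE pevalD mulrDl].
Qed.

Lemma adjacent_trace d f phi : test_function Omega phi ->
  (forall c c' G, shared T c c' G -> (forall e, e != d -> par G e) -> zero_on G (f c - f c')) ->
  pairing T f (partial d phi) = - pairing T (dd d f) phi.
Proof.
move=> tp h; apply: (parts hT openO tp) => c c' x a xF; apply/eqP; rewrite -subr_eq0 -pevalB; apply/eqP.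
apply: (h c c' _ (adjacent_shared a) _ x xF) => e ed.
by rewrite par_slab ed; exact: Tlt.
Qed.

(** Two integrations by parts: the first uses that u agrees across faces, the second that its first
    derivatives do. *)
Lemma hess_distribution u : U_h T k u -> is_hess T Omega u (hess u).
Proof.
move=> /(U_hP Tlt Tinj k) [_ h] phi tp i j.
have -> : entry (hess u) i j = dd j (dd i u).
  by apply/ffunP => c; rewrite !ffunE hess1E mderiv_comm.
rewrite (adjacent_trace (test_partial j tp)) => [|c c' G sG _].
  rewrite (adjacent_trace tp) ?opprK // => c c' G sG _.
  by rewrite ddB; have /U_trace0E [_ h1 _ _] := h c c' G sG; exact: h1.
by have /U_trace0E [h0 _ _ _] := h c c' G sG; exact: h0.
Qed.

(** Only derivatives in x_d of entries im with m different from d occur. On a face normal to x_d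
    such an entry is off-diagonal or a tangential diagonal one, and so matches. *)
Lemma curl_distribution s : Sigma_h T k s -> is_curl T Omega s (curl s).
Proof.
move=> /(Sigma_hP Tlt Tinj k3) [_ _ h] phi tp i j; have [cp _ _ _] := test_smooth tp.
have tr m d : m != d -> pairing T (entry s i m) (partial d phi) = - pairing T (dd d (entry s i m)) phi.
  move=> md; apply: (adjacent_trace tp) => c c' G sG pG; rewrite entryB.
  have [h1 h2 _] := h c c' G sG; case: (eqVneq i m) => [E|im]; last exact: h2.
  by rewrite E; apply: h1; exact: pG.
rewrite !tr; try by elim/ord3P: j.
have -> : entry (curl s) i j = dd (j + 1) (entry s i (j + 2)) + - dd (j + 2) (entry s i (j + 1)).
  by apply/ffunP => c; rewrite !ffunE !mxE.
have pN f : pairing T (- f) phi = - pairing T f phi.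
  have E0 := pairingD (0 : sfield R N) 0 cp; have E1 := pairingD f (- f) cp.
  rewrite (addr0 (0 : sfield R N)) in E0; rewrite (subrr f) in E1; move: E0 E1.
  by move: (pairing T 0 phi) (pairing T f phi) (pairing T (- f) phi) => a b c E0 E1; lra.
apply: etrans (pairingD _ _ cp) _; rewrite (pN (dd (j + 2) (entry s i (j + 1)))).
move: (pairing T (dd (j + 2) (entry s i (j + 1))) phi) (pairing T (dd (j + 1) (entry s i (j + 2))) phi).
by move=> a b; lra.
Qed.

(** Across a face normal to x_j exactly the entries in column j have to match: t_jj by the second
    clause of [Xi_trace0], the others by the third. *)
Lemma div_distribution t : Xi_h T k t -> is_div T Omega t (divm t).
Proof.
move=> /(Xi_hP Tlt Tinj k3) [_ _ h] phi tp i; have [cp _ _ _] := test_smooth tp.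
have tr j : pairing T (entry t i j) (partial j phi) = - pairing T (dd j (entry t i j)) phi.
  apply: (adjacent_trace tp) => c c' G sG pG; rewrite entryB.
  have [_ h2 h3] := h c c' G sG; case: (eqVneq i j) => [E|ij].
    by rewrite E; apply: (h2 _ _ _ (uniq3_next j)); apply: pG; elim/ord3P: (j).
  have [l u] := uniq3_third ij.
  by have [_ _ _ [_ _ lj]] := uniq3P u; apply: (h3 _ _ _ u); apply: pG.
rewrite sum3 !tr; apply: etrans (_ : _ = pairing T (dd 0 (entry t i 0)) phi +
  pairing T (dd 1 (entry t i 1)) phi + pairing T (dd 2 (entry t i 2)) phi) _; last first.
  by rewrite -!opprD opprK.
rewrite -(pairingD (dd 0 _) _ cp) -(pairingD (_ + _) _ cp).
have -> : vcomp (divm t) i = dd 0 (entry t i 0) + dd 1 (entry t i 1) + dd 2 (entry t i 2).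
  by apply/ffunP => c; rewrite !ffunE div1E.
exact: erefl.
Qed.

End Operators.

Theorem theorem3p2 (R : realType) (Omega : set 'rV[R]_3) (N : nat)
    (T : 'I_N -> box R) (k : nat)
    (hOmega : contractible_lipschitz_domain Omega)
    (hT : cuboid_mesh Omega T) (hk : (3 <= k)%N) :
  [/\ (* each operator maps its space into the next one *)
      [/\ (forall p, P1 p -> U_h T k (global N p)),
          (forall u, U_h T k u ->
             Sigma_h T k (hess u) /\ is_hess T Omega u (hess u)),
          (forall s, Sigma_h T k s ->
             Xi_h T k (curl s) /\ is_curl T Omega s (curl s))
        & (forall t, Xi_h T k t ->
             Q_h k (divm t) /\ is_div T Omega t (divm t))],
      [set u | U_h T k u /\ hess u = 0] = [set global N p | p in @P1 R],
      [set s | Sigma_h T k s /\ curl s = 0] = [set hess u | u in U_h T k],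
      [set t | Xi_h T k t /\ divm t = 0] = [set curl s | s in Sigma_h T k]
    & [set divm t | t in Xi_h T k] = @Q_h R N k].
Proof.
have oO : open Omega by case: hOmega.
split; [split|apply/seteqP; split..].
- exact: global_U hT hk.
- by move=> u Uu; split; [exact: (hess_Sigma hT hk)|exact: (hess_distribution oO hT Uu)].
- by move=> s Ss; split; [exact: (curl_Xi hT hk)|exact: (curl_distribution oO hT hk Ss)].
- by move=> t Xt; split; [exact: (div_Q hT hk)|exact: (div_distribution oO hT hk Xt)].
- by move=> u [Uu u0]; have [p Pp ->] := hess_kernel hOmega hT Uu u0; exists p.
- move=> _ [p Pp <-]; split; first exact: (global_U hT hk).
  by apply/ffunP => c; have [r ->] := (P1_aff p).1 Pp; rewrite !ffunE hess1_aff.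
- by move=> s [Ss s0]; have [u Uu ->] := curl_kernel hOmega hT hk Ss s0; exists u.
- by move=> _ [u Uu <-]; split; [exact: (hess_Sigma hT hk)|exact: hess_curl].
- by move=> t [Xt t0]; have [s Ss ->] := div_kernel hOmega hT hk Xt t0; exists s.
- by move=> _ [s Ss <-]; split; [exact: (curl_Xi hT hk)|exact: curl_div].
- by move=> _ [t Xt <-]; exact: (div_Q hT hk).
- by move=> q /(div_onto hT hk) [t Xt <-]; exists t.
Qed.
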